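(* Take a zonotopal tiling of an octagon by coherent tiles in the real (resp. complex) projective plane, with labels generic so that all the Desargues flips below are uniquely defined. Apply a sequence of eight Desargues flips corresponding to going once around the octagon (8-cycle) of flips among the zonotopal tilings of the octagon, ending at the initial tiling. Then the resulting coherent labeling coincides with the original one.
   Context: Let $\mathbf{O}$ be a centrally symmetric convex octagon. A zonotopal tiling of $\mathbf{O}$ is a tiling of $\mathbf{O}$ by parallelograms with sides parallel and equal to the sides of $\mathbf{O}$; each such tiling consists of six tiles, and its vertices are properly 2-colored black and white (adjacent vertices have different colors; the coloring of the boundary is fixed). A tiling by coherent tiles is such a tiling in which every black vertex is labeled by a point and every white vertex by a line (or vice versa) of the projective plane so that each tile is coherent: a tile with vertices labeled cyclically $A,\ell,B,m$ ($A,B$ points, $\ell,m$ lines) is coherent if neither $A$ nor $B$ lies on $\ell$ or $m$, and either $A=B$, or $\ell=m$, or the line $(AB)$ passes through $\ell\cap m$. A flip of a tiling takes three pairwise adjacent tiles which share a common vertex of degree 3 and together form a hexagon, removes that vertex, and replaces the three tiles by the other tiling of the same hexagon by three parallelograms, which has a new interior vertex (of the opposite color) joined to the other three vertices of the hexagon. There are exactly eight zonotopal tilings of $\mathbf{O}$, and the graph whose vertices are these tilings and whose edges are flips is an 8-cycle. A Desargues flip of a tiling by coherent tiles is a flip in which all existing labels at the remaining vertices are kept and the new vertex is labeled (by a point or a line, according to its color) in such a way that the three new tiles are coherent; under suitable genericity assumptions (concretely, for labelings in a suitable nonempty Zariski open, hence Zariski dense, set), this new label exists and is unique, by Desargues'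 theorem. *)

(* Defs.v *)
From HB Require Import structures.
From mathcomp Require Import all_boot all_order all_algebra.
From mathcomp Require Import finmap.
From mathcomp Require Import boolp classical_sets reals complex.

Set Implicit Arguments.
Unset Strict Implicit.
Unset Printing Implicit Defensive.

Import GRing.Theory Num.Theory.
Local Open Scope ring_scope.
Local Open Scope classical_set_scope.

Section Tilings.
Variable R : realType.
Local Notation plane := 'rV[R]_2.

Definition det2 (u w : plane) : R := u 0 0 * w 0 1 - u 0 1 * w 0 0.

Definition segment (a b : plane) : set plane :=
  [set p | exists2 s : R, 0 <= s <= 1 & p = (1 - s) *: a + s *: b].

(* The corners are listed counterclockwise, with indices modulo 8.  Convexity
   is strict: the line through each side leaves all other corners on its left. *)
Definition cs_convex_octagon (q : 'Z_8 -> plane) : Prop :=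
  (forall k l : 'Z_8, l != k -> l != k + 1 ->
     0 < det2 (q (k + 1) - q k) (q l - q k))
  /\ (exists c : plane, forall k : 'Z_8, q k + q (k + 4) = c *+ 2).

Definition octagon_region (q : 'Z_8 -> plane) : set plane :=
  [set p | exists2 w : 'Z_8 -> R,
     (forall k, 0 <= w k) /\ \sum_k w k = 1 & p = \sum_k w k *: q k].

(* By central symmetry the other four sides are the opposites of these. *)
Definition side (q : 'Z_8 -> plane) (i : 'I_4) : plane :=
  q (i.+1)%:R - q (i : nat)%:R.

(* (x, (i, j)), used with i < j only, is the parallelogram with corner x
   spanned by side i and side j.  Every parallelogram with sides parallel and
   equal to sides of the octagon is of this form in exactly one way. *)
Definition tile : Type := (plane * ('I_4 * 'I_4))%type.

Section Fixed_octagon.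
Variable q : 'Z_8 -> plane.
Local Notation v := (side q).

Definition tile_region (t : tile) : set plane :=
  [set p | exists s1 s2 : R, [/\ 0 <= s1 <= 1, 0 <= s2 <= 1
     & p = t.1 + s1 *: v t.2.1 + s2 *: v t.2.2]].

(* In cyclic order. *)
Definition tile_vertices (t : tile) : seq plane :=
  [:: t.1; t.1 + v t.2.1; t.1 + v t.2.1 + v t.2.2; t.1 + v t.2.2].

(* Each edge is directed along a side i of the octagon (and never along its
   opposite), so that equal edges of two tiles are equal as pairs. *)
Definition tile_edges (t : tile) : seq (plane * plane) :=
  [:: (t.1, t.1 + v t.2.1); (t.1, t.1 + v t.2.2);
      (t.1 + v t.2.1, t.1 + v t.2.1 + v t.2.2);
      (t.1 + v t.2.2, t.1 + v t.2.1 + v t.2.2)].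

Definition face_to_face (t t' : tile) : Prop :=
  let I := tile_region t `&` tile_region t' in
  [\/ I = set0,
      exists a, [/\ a \in tile_vertices t, a \in tile_vertices t'
                  & I = [set a]]
    | exists e, [/\ e \in tile_edges t, e \in tile_edges t'
                  & I = segment e.1 e.2]].

Definition zonotopal_tiling (T : {fset tile}) : Prop :=
  [/\ forall t, t \in T -> (t.2.1 < t.2.2)%N,
      [set p | exists2 t, t \in T & tile_region t p] = octagon_region q
    & forall t t', t \in T -> t' \in T -> t != t' -> face_to_face t t'].

Definition tiling_vertex (T : {fset tile}) (y : plane) : Prop :=
  exists2 t, t \in T & y \in tile_vertices t.

Definition tiling_edge (T : {fset tile}) (y z : plane) : Prop :=
  exists2 t, t \in T & (y, z) \in tile_edges t.

Definition proper_coloring (T : {fset tile}) (black : plane -> bool) : Prop :=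
  (forall y z, tiling_edge T y z -> black y != black z)
  /\ (forall k : 'Z_8, black (q k) = ~~ odd k).

(* The two ways to tile the hexagon with corner x and sides v i, v j, v k
   (i < j < k), with their interior vertices. *)
Definition hexagon_tiling1 (x : plane) (i j k : 'I_4) : {fset tile} :=
  [fset (x, (i, j)); (x, (j, k)); ((x + v j)%R, (i, k))]%fset.
Definition hexagon_center1 (x : plane) (j : 'I_4) : plane := x + v j.
Definition hexagon_tiling2 (x : plane) (i j k : 'I_4) : {fset tile} :=
  [fset (x, (i, k)); ((x + v i)%R, (j, k)); ((x + v k)%R, (i, j))]%fset.
Definition hexagon_center2 (x : plane) (i k : 'I_4) : plane := x + v i + v k.

(* Three tiles of a tiling that are pairwise adjacent around a common vertex c
   of degree 3 always form such a set [old]; [new] is the other tiling of the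
   same hexagon and c' its interior vertex. *)
Definition hexagon_flip (old : {fset tile}) (c : plane)
    (new : {fset tile}) (c' : plane) : Prop :=
  exists (x : plane) (i j k : 'I_4), [/\ (i < j)%N, (j < k)%N
    & [/\ old = hexagon_tiling1 x i j k, c = hexagon_center1 x j,
          new = hexagon_tiling2 x i j k & c' = hexagon_center2 x i k]
      \/ [/\ old = hexagon_tiling2 x i j k, c = hexagon_center2 x i k,
          new = hexagon_tiling1 x i j k & c' = hexagon_center1 x j]].

Section Labels.
Variable K : fieldType.

(* A label is a subspace of K^3: of dimension 1 for a point of the projective
   plane over K, of dimension 2 for a line. *)
Local Notation label := {vspace 'rV[K]_3}.

Definition is_point (P : label) : Prop := \dim P = 1%N.
Definition is_line (l : label) : Prop := \dim l = 2%N.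

Definition coherent (A l B m : label) : Prop :=
  [/\ [/\ is_point A, is_point B, is_line l & is_line m],
      [/\ ~ (A <= l)%VS, ~ (A <= m)%VS, ~ (B <= l)%VS & ~ (B <= m)%VS]
    & [\/ A = B, l = m | (l :&: m <= A + B)%VS]].

Definition coherent_tile (lam : plane -> label) (t : tile) : Prop :=
  let w0 := lam t.1 in
  let w1 := lam (t.1 + v t.2.1) in
  let w2 := lam (t.1 + v t.2.1 + v t.2.2) in
  let w3 := lam (t.1 + v t.2.2) in
  coherent w0 w1 w2 w3 \/ coherent w1 w2 w3 w0.

(* Only the values of lam at the vertices of T matter. *)
Definition coherent_labeling (T : {fset tile}) (lam : plane -> label) : Prop :=
  (exists2 black, proper_coloring T black
    & (forall y, tiling_vertex T y ->
         if black y then is_point (lam y) else is_line (lam y))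
      \/ (forall y, tiling_vertex T y ->
         if black y then is_line (lam y) else is_point (lam y)))
  /\ (forall t, t \in T -> coherent_tile lam t).

(* A Desargues flip whose new label is uniquely defined.  Coherence of the new
   tiles forces the type (point or line) of the label at c'. *)
Definition unique_desargues_flip (T : {fset tile}) (lam : plane -> label)
    (T' : {fset tile}) (lam' : plane -> label) : Prop :=
  exists old c new c',
  [/\ hexagon_flip old c new c' /\ (old `<=` T)%fset,
      T' = ((T `\` old) `|` new)%fset,
      forall y, tiling_vertex T y -> y != c -> lam' y = lam y,
      forall t, t \in new -> coherent_tile lam' t
    & forall L : label,
        (forall t, t \in new ->
           coherent_tile (fun y => if y == c' then L else lam' y) t) ->
        L = lam' c'].

End Labels.
End Fixed_octagon.
End Tilings.

(* Main.v *)
Require Import Defs.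
From HB Require Import structures.
From mathcomp Require Import all_boot all_order all_algebra.
From mathcomp Require Import finmap.
From mathcomp Require Import boolp classical_sets reals complex.
From mathcomp Require Import ring lra zify.

Set Implicit Arguments.
Unset Strict Implicit.
Unset Printing Implicit Defensive.
Import Order.TTheory GRing.Theory Num.Theory.

(** Represent a point of the projective plane by a vector spanning it and a line
    by a vector orthogonal to it.  A tile with labels A, l, B, m is coherent exactly
    when its four pairings are nonzero and (A.l)(B.m) = (l.B)(m.A): see
    [coherent_to_vectors] and [vectors_to_coherent].  This condition says that the
    pairings form a closed multiplicative cochain on the tiling of a disc, so the
    vectors can be rescaled until the pairing along every edge is 1
    ([normalized_boundary]).  A Desargues flip then asks for a vector that pairs to 1
    with three neighbours, and it is unique precisely when these are independent.

    The eight tilings have eight inner vertices altogether, and these can be put in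
    a cycle c_0, c_1, ..., c_7 such that the k-th tiling contains c_k, c_(k+1) and
    c_(k+2), and a flip replaces c_k by c_(k+3).  With the corners of the octagon
    renumbered as B_0, ..., B_7, both B_m and c_m are joined to B_(m+3) and B_(m-3),
    and c_m is joined to c_(m-1) and c_(m+1).  So c_m = B_m + t_m n_m, where n_m is
    the cross product of B_(m+3) and B_(m-3), and the equation c_m . c_(m+1) = 1
    makes t_(m+1) a projective function of t_m.  The claim is that eight of these
    maps compose to the identity.

    Read a normalized vector w as the point (w, 1) of projective 3-space, with the
    form w.w' - h h'.  Vectors of even index become points and those of odd index
    planes, every edge of a tiling becomes an incidence, and the sixteen vectors
    form a Moebius configuration: c_0, c_2, ... move on lines through the vertices
    of the tetrahedron B_0 B_2 B_4 B_6, and c_1, c_3, ... are planes through its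
    edges.  In tetrahedral coordinates two consecutive maps are an inversion
    u -> k / u, and since neighbouring lines are coplanar the four constants
    satisfy k_0 k_4 = k_2 k_6, which makes the product of the eight maps scalar
    ([chain8_of_tetrahedron]).  When the tetrahedron is flat, its vertices B_0 and
    B_2 are moved along their lines, linearly in a parameter X, so that for X = 1 it
    is not flat: the uniqueness of two consecutive flips provides such a motion
    ([chain8_scalar]).  The identity holds over K[X] and is evaluated at X = 0.  The
    scalar is a product of nonzero pairings, so every map is invertible; hence the
    last two initial labels come back along with the first ([octagon_closes]).

    It remains to see that the tilings and flips of the plane are the expected ones.
    A vertex of a tiling is the first corner plus the sum of a subset of the four
    sides, and the eight tilings are tabulated by such subsets.  Every tiling is one
    of them ([tiling_classification]): sweep a path of edges from the right boundary
    to the left one.  If the tile on the left of an edge continues upwards, and the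
    tile on the left of the next edge comes from below, both overlap near the common
    point, hence are equal, and the path can be pushed across that tile.  The
    vertices of one tiling are distinct points ([pt_inj]), so a hexagon of tiles in
    the plane is a hexagon of subsets, and a flip leads to one of the two neighbours
    in the table ([flip_neighbour]).  As the tilings are distinct, the flips go on
    in one direction. *)

(** * The eight tilings in terms of subsets of the four sides *)

(** The set of the indices of the sides that lead from the first corner to a vertex. *)
Definition code : Type := (bool * bool * bool * bool)%type.

Definition has_dir (S : code) (i : nat) : bool :=
  match i with 0 => S.1.1.1 | 1 => S.1.1.2 | 2 => S.1.2 | 3 => S.2 | _ => false end.

Definition add_dir (S : code) (i : nat) : code :=
  (has_dir S 0 || (i == 0), has_dir S 1 || (i == 1), has_dir S 2 || (i == 2),
   has_dir S 3 || (i == 3)).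

Definition bools := [:: true; false].
Definition codes : seq code :=
  [seq (abc, d) | abc <- [seq (ab, c) | ab <- [seq (a, b) | a <- bools, b <- bools], c <- bools], d <- bools].
Definition empty_code : code := (false, false, false, false).
Definition code_of (s : seq nat) : code := foldl add_dir empty_code s.

Definition pairs : seq (nat * nat) := [:: (0,1); (0,2); (0,3); (1,2); (1,3); (2,3)].
Definition triples : seq (nat * nat * nat) := [:: (0,1,2); (0,1,3); (0,2,3); (1,2,3)].

(** The inner vertices in the order in which the flips create them: the k-th tiling
    has the inner vertices k, k+1 and k+2. *)
Definition inner (k : nat) : code := nth empty_code (map code_of
  [:: [:: 2]; [:: 1; 2]; [:: 1]; [:: 1; 3]; [:: 0; 1; 3]; [:: 0; 3]; [:: 0; 2; 3]; [:: 0; 2]])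
  (k %% 8).

(** The corners, numbered so that [inner m] and [outer m] are both joined to
    [outer (m + 3)] and [outer (m - 3)].  Consecutive corners of the octagon have
    numbers that differ by 3 modulo 8. *)
Definition outer (k : nat) : code := nth empty_code (map code_of
  [:: [:: 3]; [:: 0; 1; 2; 3]; [:: 0]; [:: 2; 3]; [:: 0; 1; 2]; [::]; [:: 1; 2; 3]; [:: 0; 1]])
  (k %% 8).

Definition vertices (k : nat) : seq code :=
  map outer (iota 0 8) ++ [:: inner k; inner k.+1; inner k.+2].

Definition ctile : Type := (code * (nat * nat))%type.

Definition cycle4 (t : ctile) : seq code :=
  [:: t.1; add_dir t.1 t.2.1; add_dir (add_dir t.1 t.2.1) t.2.2; add_dir t.1 t.2.2].

Definition is_ctile (t : ctile) : bool :=
  ~~ has_dir t.1 t.2.1 && ~~ has_dir t.1 t.2.2.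

(** A tiling is determined by its vertices: it consists of all the tiles on them. *)
Definition tiles_on_vertices (vs : seq code) : seq ctile :=
  [seq t <- [seq (c, p) | c <- codes, p <- pairs] |
     is_ctile t && all (fun c => c \in vs) (cycle4 t)].

Definition ctiles_table : seq (seq ctile) :=
  Eval vm_compute in [seq tiles_on_vertices (vertices k) | k <- iota 0 8].

Definition ctiles (k : nat) : seq ctile := nth [::] ctiles_table (k %% 8).

(** A line through the origin has the sides in [c] but not in [c'] on one side and
    the sides in [c'] but not in [c] on the other; this separates the two vertices. *)
Definition code_lt (c c' : code) : bool :=
  has (fun m => all (fun i => (has_dir c i && ~~ has_dir c' i ==> (i < m)) &&
    (has_dir c' i && ~~ has_dir c i ==> (m <= i))) (iota 0 4)) (iota 0 5).

(** The flag [e] is the direction of travel in the cycle of tilings. *)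
Definition turn (e : bool) (k : nat) : nat := (if e then k.+1 else k + 7) %% 8.

(** The m-th vertex met from the k-th tiling on.  The backward walk starts from the
    last inner vertex, k + 2; minus m is written 7 m. *)
Definition idx (e : bool) (k m : nat) : nat := (if e then k + m else k + 2 + 7 * m) %% 8.

(** The quadrilaterals of a tiling, seen from its first inner vertex: one around
    each inner vertex and a corner joined to the same corners, one for each edge
    between inner vertices, and one with all three inner vertices.  In both
    directions of travel they have the same form, which is why only one of them has
    to be followed later. *)
Definition quadG e k m := [:: inner (idx e k m); outer (idx e k (m + 3));
   outer (idx e k m); outer (idx e k (m + 5))].
Definition quadH e k m := [:: inner (idx e k m); inner (idx e k m.+1);
   outer (idx e k (m + 6)); outer (idx e k (m + 3))].
Definition quadJ e k m := [:: inner (idx e k m); inner (idx e k m.+1);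
   inner (idx e k m.+2); outer (idx e k (m + 5))].

Definition dihedral (Q : seq code) : seq (seq code) :=
  let Q' := rot 1 (rev Q) in
  [seq rot m Q | m <- iota 0 4] ++ [seq rot m Q' | m <- iota 0 4].

Definition fresh_tiles k k' : seq ctile := [seq t <- ctiles k' | t \notin ctiles k].

Definition dihedral_in Q (s : seq (seq code)) := has (fun Q' => Q' \in s) (dihedral Q).

Definition check_start := all (fun e => all (fun k =>
   all (fun Q => dihedral_in Q (map cycle4 (ctiles k)))
     [:: quadG e k 0; quadG e k 1; quadG e k 2; quadH e k 0; quadH e k 1; quadJ e k 0])
   (iota 0 8)) bools.

Definition check_fresh := all (fun e => all (fun k =>
   let new := map cycle4 (fresh_tiles k (turn e k)) in
   let quads := [:: quadG e k 3; quadH e k 2; quadJ e k 1] in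
   all (fun Q => dihedral_in Q new) quads && all (fun Q => dihedral_in Q quads) new)
   (iota 0 8)) bools.

Definition check_separated := all (fun k => all (fun c => all (fun c' =>
   (c == c') || code_lt c c' || code_lt c' c) (vertices k)) (vertices k)) (iota 0 8).

(** The two tilings of a hexagon, as in [hexagon_tiling1] and [hexagon_tiling2]. *)
Definition half1 (c : code) (i j l : nat) : seq ctile :=
  [:: (c, (i, j)); (c, (j, l)); (add_dir c j, (i, l))].
Definition half2 (c : code) (i j l : nat) : seq ctile :=
  [:: (c, (i, l)); (add_dir c i, (j, l)); (add_dir c l, (i, j))].

Definition flips_to k (old new : seq ctile) (c c' : code) e :=
  let k' := turn e k in
  [&& c == inner (idx e k 0), c' == inner (idx e k 3),
     perm_eq (ctiles k') ([seq t <- ctiles k | t \notin old] ++ new),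
     perm_eq (fresh_tiles k k') new & all (mem (ctiles k)) old].

Definition check_flips := all (fun k => all (fun p : nat * nat * nat => all (fun c =>
    let: (i, j, l) := p in
    let: c1 := add_dir c j in let: c2 := add_dir (add_dir c i) l in
    (if ~~ all (mem (ctiles k)) (half1 c i j l) then true else has (flips_to k (half1 c i j l) (half2 c i j l) c1 c2) bools) &&
    (if ~~ all (mem (ctiles k)) (half2 c i j l) then true else has (flips_to k (half2 c i j l) (half1 c i j l) c2 c1) bools))
   codes) triples) (iota 0 8).

(** Consecutive tilings of the table differ by a flip, so that a covering by one of
    them gives a covering by the next. *)
Definition check_forward := all (fun k => has (fun p : nat * nat * nat => has (fun c =>
    let: (i, j, l) := p in
    let: c1 := add_dir c j in let: c2 := add_dir (add_dir c i) l in
    [&& ~~ has_dir c i, ~~ has_dir c j, ~~ has_dir c l &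
    flips_to k (half1 c i j l) (half2 c i j l) c1 c2 true ||
    flips_to k (half2 c i j l) (half1 c i j l) c2 c1 true])
   codes) triples) (iota 0 8).

(** Paths of edges from the first corner to the opposite one are words in the four
    directions.  Exchanging two letters in ascending order pushes the path to the
    left across one tile. *)
Definition words := permutations [:: 0; 1; 2; 3].

Definition prefix (w : seq nat) (p : nat) : code := code_of (take p w).

Definition swap (w : seq nat) (p : nat) : seq nat :=
  take p w ++ [:: nth 0 w p.+1; nth 0 w p] ++ drop p.+2 w.

Definition moves (w : seq nat) : seq (seq nat * ctile) :=
  [seq (swap w p, (prefix w p, (nth 0 w p, nth 0 w p.+1)))
  | p <- [seq p <- iota 0 3 | nth 0 w p < nth 0 w p.+1]].

Definition ascents (w : seq nat) : nat :=
  count (fun p : nat * nat => index p.1 w < index p.2 w) pairs.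

Fixpoint sweeps n (w : seq nat) (done : seq ctile) : seq (seq ctile) :=
  if n is n'.+1 then flatten [seq sweeps n' m.1 (m.2 :: done) | m <- moves w]
  else [:: done].

(** The vertices of the left boundary of the octagon. *)
Definition upper (c : code) : bool :=
  c \in map code_of [:: [::]; [:: 3]; [:: 2; 3]; [:: 1; 2; 3]; [:: 0; 1; 2; 3]].

Definition check_moves := all (fun w =>
  all (fun m : seq nat * ctile => (m.1 \in words) && (ascents w == (ascents m.1).+1)) (moves w) &&
  ((ascents w == 0) == all (fun p => upper (prefix w p)) (iota 0 5))) words.

Definition check_words := all (fun w => all (fun p =>
    [&& nth 0 w p < 4, ~~ has_dir (prefix w p) (nth 0 w p) &
        prefix w p.+1 == add_dir (prefix w p) (nth 0 w p)]) (iota 0 4)) words.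

Definition check_swap := all (fun w => all (fun p => all (fun r =>
    [|| (prefix (swap w p) r == prefix w r) && (nth 0 (swap w p) r == nth 0 w r),
        (prefix (swap w p) r == prefix w p) && (nth 0 (swap w p) r == nth 0 w p.+1) |
        (prefix (swap w p) r == add_dir (prefix w p) (nth 0 w p.+1)) &&
          (nth 0 (swap w p) r == nth 0 w p) && ~~ has_dir (prefix w p) (nth 0 w p.+1)])
   (iota 0 4)) (iota 0 3)) words.

Definition check_vertices := all (fun k =>
   all (fun t => all (fun c => c \in vertices k) (cycle4 t)) (ctiles k) &&
   all (fun c => has (fun t => c \in cycle4 t) (ctiles k)) (vertices k)) (iota 0 8).

Definition check_turn := all (fun e => all (fun k =>
   [&& turn (~~ e) (turn e k) == k, turn e k < 8, inner (idx e k 3) \in vertices (turn e k),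
    all (fun m => inner (idx e k m) \in vertices k) (iota 0 3),
    uniq [seq inner (idx e k m) | m <- iota 0 4],
    ~~ has (fun m => inner m \in map outer (iota 0 8)) (iota 0 8) &
    all (fun c => (c \in map outer (iota 0 8)) || (c \in [seq inner (idx e k m) | m <- iota 0 3])) (vertices k)])
   (iota 0 8)) bools.

Definition check_sweeps := all (fun s => has (fun k => all (fun t => t \in s) (ctiles k)) (iota 0 8))
  (sweeps 6 [:: 0; 1; 2; 3] [::]).

(** An edge off the left boundary has some room to its left: a larger direction may
    be added to it or a smaller one removed. *)
Definition check_upper := all (fun c => all (fun i => 
  [|| has_dir c i, upper c && upper (add_dir c i) |
   has (fun j => (i < j) && ~~ has_dir c j || (j < i) && has_dir c j) (iota 0 4)]) (iota 0 4)) codes.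

Definition check_upper_lt := all (fun c => upper c ==>
  has (fun m => all (fun i => has_dir c i == (m <= i)) (iota 0 4)) (iota 0 5)) codes.

Definition check_ctiles := all (fun t => (t.2.1 < t.2.2 < 4) && is_ctile t) (flatten (map ctiles (iota 0 8))).

Lemma check_forwardP : check_forward. Proof. by vm_compute. Qed.
Lemma check_movesP : check_moves. Proof. by vm_compute. Qed.
Lemma check_sweepsP : check_sweeps. Proof. by vm_compute. Qed.
Lemma check_upperP : check_upper. Proof. by vm_compute. Qed.
Lemma check_upper_ltP : check_upper_lt. Proof. by vm_compute. Qed.
Lemma check_ctilesP : check_ctiles. Proof. by vm_compute. Qed.
Lemma check_startP : check_start. Proof. by vm_compute. Qed.
Lemma check_freshP : check_fresh. Proof. by vm_compute. Qed.
Lemma check_separatedP : check_separated. Proof. by vm_compute. Qed.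
Lemma check_flipsP : check_flips. Proof. by vm_compute. Qed.
Lemma check_wordsP : check_words. Proof. by vm_compute. Qed.
Lemma check_swapP : check_swap. Proof. by vm_compute. Qed.
Lemma check_verticesP : check_vertices. Proof. by vm_compute. Qed.
Lemma check_turnP : check_turn. Proof. by vm_compute. Qed.

Lemma half1_flips k i j l c : k < 8 -> (i, j, l) \in triples ->
  all (mem (ctiles k)) (half1 c i j l) -> c \in codes ->
  exists e, flips_to k (half1 c i j l) (half2 c i j l) (add_dir c j) (add_dir (add_dir c i) l) e.
Proof.
move=> hk ht h hc; have /allP/(_ k) := check_flipsP; rewrite mem_iota.
move=> /(_ hk)/allP/(_ _ ht)/allP/(_ c hc)/andP[+ _].
by case: ifP => [|_ /hasP[e _ ?]]; [rewrite h | exists e].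
Qed.

Lemma half2_flips k i j l c : k < 8 -> (i, j, l) \in triples ->
  all (mem (ctiles k)) (half2 c i j l) -> c \in codes ->
  exists e, flips_to k (half2 c i j l) (half1 c i j l) (add_dir (add_dir c i) l) (add_dir c j) e.
Proof.
move=> hk ht h hc; have /allP/(_ k) := check_flipsP; rewrite mem_iota.
move=> /(_ hk)/allP/(_ _ ht)/allP/(_ c hc)/andP[_].
by case: ifP => [|_ /hasP[e _ ?]]; [rewrite h | exists e].
Qed.

Local Open Scope ring_scope.

(** * Vectors with three coordinates *)

Section Vectors.
Variable A : comNzRingType.
Definition vec3 : Type := (A * A * A)%type.
Definition dot (u w : vec3) : A := u.1.1 * w.1.1 + u.1.2 * w.1.2 + u.2 * w.2.
Definition cross (u w : vec3) : vec3 :=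
  (u.1.2 * w.2 - u.2 * w.1.2, u.2 * w.1.1 - u.1.1 * w.2,
   u.1.1 * w.1.2 - u.1.2 * w.1.1).
Definition shift (u : vec3) (t : A) (w : vec3) : vec3 :=
  (u.1.1 + t * w.1.1, u.1.2 + t * w.1.2, u.2 + t * w.2).
Definition det3 (u v w : vec3) : A := dot u (cross v w).
(** The determinant of four vectors with an additional last coordinate. *)
Definition det4 (u : vec3) (a : A) (v : vec3) (b : A) (w : vec3) (c : A)
    (x : vec3) (d : A) : A :=
  - a * det3 v w x + b * det3 u w x - c * det3 u v x + d * det3 u v w.

Lemma dotC u w : dot u w = dot w u.
Proof. by rewrite /dot; ring. Qed.

Lemma dot_shiftl u t w x : dot (shift u t w) x = dot u x + t * dot w x.
Proof. by rewrite /dot /=; ring. Qed.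

Lemma dot_crossl u w : dot (cross u w) u = 0.
Proof. by rewrite /dot /=; ring. Qed.

Lemma dot_crossr u w : dot (cross u w) w = 0.
Proof. by rewrite /dot /=; ring. Qed.

(** Cramer's rule for (n, 0) on the basis (p_i, 1), paired with (x, h). *)
Lemma cramer4 (p0 p1 p2 p3 n x : vec3) (h : A) :
  det4 p0 1 p1 1 p2 1 p3 1 * dot n x =
    det4 n 0 p1 1 p2 1 p3 1 * (dot p0 x - h)
  + det4 p0 1 n 0 p2 1 p3 1 * (dot p1 x - h)
  + det4 p0 1 p1 1 n 0 p3 1 * (dot p2 x - h)
  + det4 p0 1 p1 1 p2 1 n 0 * (dot p3 x - h).
Proof.
case: p0 p1 p2 p3 n x => [[? ?] ?] [[? ?] ?] [[? ?] ?] [[? ?] ?] [[? ?] ?] [[? ?] ?].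
by rewrite /det4 /det3 /dot /=; ring.
Qed.

(** Adding a combination of the other columns to the last one. *)
Lemma det4_column (p0 p1 p2 p3 x : vec3) :
  det4 p0 1 p1 1 p2 1 p3 1 =
  det4 p0 (1 - dot p0 x) p1 (1 - dot p1 x) p2 (1 - dot p2 x) p3 (1 - dot p3 x).
Proof.
case: p0 p1 p2 p3 x => [[? ?] ?] [[? ?] ?] [[? ?] ?] [[? ?] ?] [[? ?] ?].
by rewrite /det4 /det3 /dot /=; ring.
Qed.
End Vectors.

(** * Eight steps around the octagon *)
Section Chain.
Variable A : comNzRingType.
Variable B : nat -> vec3 A.
Definition normal m : vec3 A := cross (B (m + 3)) (B (m + 5)).

(** The pair z stands for the vector z_1 (B_m, 1) + z_2 (n_m, 0), on the line of the
    m-th inner vertex; its image is the vector on the next line whose pairing with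
    it is zero. *)
Definition step m (z : A * A) : A * A :=
  (z.1 * dot (B m) (normal m.+1) + z.2 * dot (normal m) (normal m.+1),
   - (z.1 * (dot (B m) (B m.+1) - 1) + z.2 * dot (normal m) (B m.+1))).

Fixpoint chain k (z : A * A) : A * A :=
  if k is k'.+1 then step k' (chain k' z) else z.

Definition step_det m : A :=
  dot (normal m) (normal m.+1) * (dot (B m) (B m.+1) - 1)
  - dot (B m) (normal m.+1) * dot (normal m) (B m.+1).

Lemma step_wedge m z w :
  (step m z).1 * (step m w).2 - (step m z).2 * (step m w).1
  = step_det m * (z.1 * w.2 - z.2 * w.1).
Proof. by rewrite /step /step_det /=; ring. Qed.

Lemma stepD m z w :
  step m (z.1 + w.1, z.2 + w.2)
  = ((step m z).1 + (step m w).1, (step m z).2 + (step m w).2).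
Proof. by rewrite /step /=; congr (_, _); ring. Qed.

Lemma chainD k z w :
  chain k (z.1 + w.1, z.2 + w.2)
  = ((chain k z).1 + (chain k w).1, (chain k z).2 + (chain k w).2).
Proof. by elim: k => //= k ->; rewrite stepD. Qed.
End Chain.

(** Two steps lead from the line at one vertex of the tetrahedron to the line at the
    next.  The constants d are the coordinates of the directions of these lines; in
    the coordinates D x + d00 y and y the map is an inversion with constant
    d20 d02. *)
Lemma two_steps (A : comNzRingType) (D x y a b g f a' b' g' f' d00 d02 d22 d20 : A) :
  D * f = d00 * g + d02 * g' -> D * b = d00 * a + d02 * f' ->
  D * a' = d22 * g' + d20 * g -> D * b' = d22 * f' + d20 * a ->
  let xr := x * a + y * b in let yr := - (x * g + y * f) in
  let x' := xr * a' + yr * b' in let y' := - (xr * g' + yr * f') in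
  let w := a * g' - f' * g in
  D * (D * x' + d22 * y') = - w * (d20 * d02) * y /\
  D * y' = - w * (D * x + d00 * y).
Proof.
move=> hf hb ha' hb' xr yr x' y' w.
have hx : D * xr = D * x * a + y * (D * b) by rewrite /xr; ring.
have hy : D * yr = - (D * x * g + y * (D * f)) by rewrite /yr; ring.
have e2 : D * y' = - w * (D * x + d00 * y).
  have -> : D * y' = - ((D * xr) * g' + (D * yr) * f') by rewrite /y'; ring.
  by rewrite hx hy hf hb /w; ring.
split=> //.
have -> : D * (D * x' + d22 * y') =
  (D * xr) * (D * a') + (D * yr) * (D * b') + d22 * (D * y') by rewrite /x'; ring.
by rewrite e2 hx hy ha' hb' hf hb /w; ring.
Qed.

Section Tetrahedron.
Variable A : idomainType.
Variable B : nat -> vec3 A.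
Hypothesis hper : forall m, B (m + 8) = B m.
Hypothesis hadj : forall m, dot (B m) (B (m + 3)) = 1.
Local Notation n := (normal B).
Let D := det4 (B 0) 1 (B 2) 1 (B 4) 1 (B 6) 1.
Hypothesis hD : D != 0.
Let d0 u := det4 u 0 (B 2) 1 (B 4) 1 (B 6) 1.
Let d2 u := det4 (B 0) 1 u 0 (B 4) 1 (B 6) 1.
Let d4 u := det4 (B 0) 1 (B 2) 1 u 0 (B 6) 1.
Let d6 u := det4 (B 0) 1 (B 2) 1 (B 4) 1 u 0.

Let expand u x h : D * dot u x = d0 u * (dot (B 0) x - h) + d2 u * (dot (B 2) x - h)
   + d4 u * (dot (B 4) x - h) + d6 u * (dot (B 6) x - h).
Proof. exact: cramer4. Qed.

Let adj m k : (m + 3 = k)%N \/ (m + 5 = k)%N -> dot (B m) (B k) = 1.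
Proof.
case=> <-; first exact: hadj.
by rewrite -(hper m) dotC -(hadj (m + 5)) -!addnA.
Qed.
Let adj' m k : (m + 3 = k)%N \/ (m + 5 = k)%N -> dot (B k) (B m) = 1.
Proof. by move=> h; rewrite dotC adj. Qed.
Let nadj m k : (m + 3 = k)%N \/ (m + 5 = k)%N -> dot (n m) (B k) = 0.
Proof. by case=> <-; rewrite ?dot_crossl ?dot_crossr. Qed.
Let nadj' m k : (m + 3 = k)%N \/ (m + 5 = k)%N -> dot (B k) (n m) = 0.
Proof. by move=> h; rewrite dotC nadj. Qed.

Let B8 : B 8 = B 0. Proof. exact: (hper 0). Qed.
Let B9 : B 9 = B 1. Proof. exact: (hper 1). Qed.
Let B10 : B 10 = B 2. Proof. exact: (hper 2). Qed.
Let B11 : B 11 = B 3. Proof. exact: (hper 3). Qed.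
Let B12 : B 12 = B 4. Proof. exact: (hper 4). Qed.
Let n8 : n 8 = n 0. Proof. by rewrite /normal (hper 3) (hper 5). Qed.

(** The four vertices of a tetrahedron are not in one plane. *)
Let not_all x : dot (B 0) x = 1 -> dot (B 2) x = 1 -> dot (B 4) x = 1 ->
  dot (B 6) x = 1 -> False.
Proof.
move=> h0 h2 h4 h6; move: hD; rewrite /D (det4_column _ _ _ _ x) h0 h2 h4 h6 subrr.
by rewrite /det4 oppr0 !mul0r !addr0 subr0 eqxx.
Qed.

Let cancel2 (u v u' v' g g' : A) : u * g + v * g' = 0 -> u' * g + v' * g' = 0 ->
  (g = 0 -> g' = 0 -> False) -> u * v' = v * u'.
Proof.
move=> e1 e2 h.
have h1 : (u * v' - v * u') * g = 0.
  by transitivity (v' * (u * g + v * g') - v * (u' * g + v' * g')); [ring | rewrite e1 e2; ring].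
have h2 : (u * v' - v * u') * g' = 0.
  by transitivity (u * (u' * g + v' * g') - u' * (u * g + v * g')); [ring | rewrite e1 e2; ring].
move/eqP: h1; rewrite mulf_eq0 => /orP[|/eqP gz]; first by rewrite subr_eq0 => /eqP.
move/eqP: h2; rewrite mulf_eq0 => /orP[|/eqP gz']; first by rewrite subr_eq0 => /eqP.
by case: h.
Qed.

Let zero0 u k : dot u (B k) = 0 -> 
  d0 u * (dot (B 0) (B k) - 1) + d2 u * (dot (B 2) (B k) - 1)
   + d4 u * (dot (B 4) (B k) - 1) + d6 u * (dot (B 6) (B k) - 1) = 0.
Proof. by rewrite -expand => ->; rewrite mulr0. Qed.

Let a03 : dot (B 0) (B 3) = 1. Proof. by apply: adj; left. Qed.
Let a05 : dot (B 0) (B 5) = 1. Proof. by apply: adj; right. Qed.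
Let a25 : dot (B 2) (B 5) = 1. Proof. by apply: adj; left. Qed.
Let a27 : dot (B 2) (B 7) = 1. Proof. by apply: adj; right. Qed.
Let a41 : dot (B 4) (B 1) = 1. Proof. by apply: adj'; left. Qed.
Let a47 : dot (B 4) (B 7) = 1. Proof. by apply: adj; left. Qed.
Let a61 : dot (B 6) (B 1) = 1. Proof. by apply: adj'; right. Qed.
Let a63 : dot (B 6) (B 3) = 1. Proof. by apply: adj'; left. Qed.
Let z03 : dot (n 0) (B 3) = 0. Proof. by apply: nadj; left. Qed.
Let z05 : dot (n 0) (B 5) = 0. Proof. by apply: nadj; right. Qed.
Let z25 : dot (n 2) (B 5) = 0. Proof. by apply: nadj; left. Qed.
Let z27 : dot (n 2) (B 7) = 0. Proof. by apply: nadj; right. Qed.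
Let z41 : dot (n 4) (B 1) = 0. Proof. by rewrite -B9; apply: nadj; right. Qed.
Let z47 : dot (n 4) (B 7) = 0. Proof. by apply: nadj; left. Qed.
Let z61 : dot (n 6) (B 1) = 0. Proof. by rewrite -B9; apply: nadj; left. Qed.
Let z63 : dot (n 6) (B 3) = 0. Proof. by rewrite -B11; apply: nadj; right. Qed.
Let y14 : dot (B 4) (n 1) = 0. Proof. by apply: nadj'; left. Qed.
Let y16 : dot (B 6) (n 1) = 0. Proof. by apply: nadj'; right. Qed.
Let y36 : dot (B 6) (n 3) = 0. Proof. by apply: nadj'; left. Qed.
Let y30 : dot (B 0) (n 3) = 0. Proof. by rewrite -B8; apply: nadj'; right. Qed.
Let y50 : dot (B 0) (n 5) = 0. Proof. by rewrite -B8; apply: nadj'; left. Qed.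
Let y52 : dot (B 2) (n 5) = 0. Proof. by rewrite -B10; apply: nadj'; right. Qed.
Let y72 : dot (B 2) (n 7) = 0. Proof. by rewrite -B10; apply: nadj'; left. Qed.
Let y74 : dot (B 4) (n 7) = 0. Proof. by rewrite -B12; apply: nadj'; right. Qed.

(** The plane B_3 contains the lines at B_0 and B_6, and so relates their
    directions; likewise for the other three planes. *)
Let coplanar3 : d2 (n 0) * d4 (n 6) = d4 (n 0) * d2 (n 6).
Proof.
apply: (@cancel2 _ _ _ _ (dot (B 2) (B 3) - 1) (dot (B 4) (B 3) - 1)).
- by have := zero0 z03; rewrite a03 a63 subrr !mulr0 add0r addr0.
- by have := zero0 z63; rewrite a03 a63 subrr !mulr0 add0r addr0.
- by move=> /subr0_eq h2 /subr0_eq h4; exact: (not_all a03 h2 h4 a63).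
Qed.
Let coplanar5 : d4 (n 2) * d6 (n 0) = d6 (n 2) * d4 (n 0).
Proof.
apply: (@cancel2 _ _ _ _ (dot (B 4) (B 5) - 1) (dot (B 6) (B 5) - 1)).
- by have := zero0 z25; rewrite a05 a25 subrr !mulr0 !add0r.
- by have := zero0 z05; rewrite a05 a25 subrr !mulr0 !add0r.
- by move=> /subr0_eq h4 /subr0_eq h6; exact: (not_all a05 a25 h4 h6).
Qed.
Let coplanar7 : d6 (n 4) * d0 (n 2) = d0 (n 4) * d6 (n 2).
Proof.
apply: (@cancel2 _ _ _ _ (dot (B 6) (B 7) - 1) (dot (B 0) (B 7) - 1)).
- by have := zero0 z47; rewrite a27 a47 subrr !mulr0 !addr0 addrC.
- by have := zero0 z27; rewrite a27 a47 subrr !mulr0 !addr0 addrC.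
- by move=> /subr0_eq h6 /subr0_eq h0; exact: (not_all h0 a27 a47 h6).
Qed.
Let coplanar1 : d0 (n 6) * d2 (n 4) = d2 (n 6) * d0 (n 4).
Proof.
apply: (@cancel2 _ _ _ _ (dot (B 0) (B 1) - 1) (dot (B 2) (B 1) - 1)).
- by have := zero0 z61; rewrite a41 a61 subrr !mulr0 !addr0.
- by have := zero0 z41; rewrite a41 a61 subrr !mulr0 !addr0.
- by move=> /subr0_eq h0 /subr0_eq h2; exact: (not_all h0 h2 a41 a61).
Qed.

(** Two steps are an inversion, so four pairs of steps multiply the coordinates by
    k_2 k_6 and k_0 k_4; the four coplanarities make these equal. *)
Lemma chain8_of_tetrahedron z :
  (chain B 8 z).1 * z.2 = (chain B 8 z).2 * z.1.
Proof.
set z2 := chain B 2 z; set z4 := chain B 4 z; set z6 := chain B 6 z; set z8 := chain B 8 z.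
set w1 := dot (B 0) (n 1) * (dot (B 1) (B 2) - 1) - dot (n 1) (B 2) * (dot (B 0) (B 1) - 1).
set w3 := dot (B 2) (n 3) * (dot (B 3) (B 4) - 1) - dot (n 3) (B 4) * (dot (B 2) (B 3) - 1).
set w5 := dot (B 4) (n 5) * (dot (B 5) (B 6) - 1) - dot (n 5) (B 6) * (dot (B 4) (B 5) - 1).
set w7 := dot (B 6) (n 7) * (dot (B 7) (B 0) - 1) - dot (n 7) (B 0) * (dot (B 6) (B 7) - 1).
have [p2 q2] : D * (D * z2.1 + d2 (n 2) * z2.2) = - w1 * (d0 (n 2) * d2 (n 0)) * z.2 /\
    D * z2.2 = - w1 * (D * z.1 + d0 (n 0) * z.2).
  apply: two_steps.
  - by rewrite (expand _ _ 1) a41 a61 subrr !mulr0 !addr0 (dotC (B 1) (B 2)).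
  - by rewrite (expand _ _ 0) y14 y16 subrr !mulr0 !addr0 !subr0 (dotC (n 1)).
  - by rewrite (dotC (B 1) (n 2)) (expand _ _ 1) a41 a61 subrr !mulr0 !addr0 (dotC (B 1) (B 2)) addrC.
  - by rewrite (dotC (n 1) (n 2)) (expand _ _ 0) y14 y16 subrr !mulr0 !addr0 !subr0 (dotC (n 1)) addrC.
have [p4 q4] : D * (D * z4.1 + d4 (n 4) * z4.2) = - w3 * (d2 (n 4) * d4 (n 2)) * z2.2 /\
    D * z4.2 = - w3 * (D * z2.1 + d2 (n 2) * z2.2).
  apply: two_steps.
  - by rewrite (expand _ _ 1) a03 a63 subrr !mulr0 !addr0 add0r (dotC (B 3) (B 4)).
  - by rewrite (expand _ _ 0) y30 y36 subrr !mulr0 !addr0 add0r !subr0 (dotC (n 3)).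
  - by rewrite (dotC (B 3) (n 4)) (expand _ _ 1) a03 a63 subrr !mulr0 !addr0 add0r (dotC (B 3) (B 4)) addrC.
  - by rewrite (dotC (n 3) (n 4)) (expand _ _ 0) y30 y36 subrr !mulr0 !addr0 add0r !subr0 (dotC (n 3)) addrC.
have [p6 q6] : D * (D * z6.1 + d6 (n 6) * z6.2) = - w5 * (d4 (n 6) * d6 (n 4)) * z4.2 /\
    D * z6.2 = - w5 * (D * z4.1 + d4 (n 4) * z4.2).
  apply: two_steps.
  - by rewrite (expand _ _ 1) a05 a25 subrr !mulr0 !add0r (dotC (B 5) (B 6)).
  - by rewrite (expand _ _ 0) y50 y52 subrr !mulr0 !add0r !subr0 (dotC (n 5)).
  - by rewrite (dotC (B 5) (n 6)) (expand _ _ 1) a05 a25 subrr !mulr0 !add0r (dotC (B 5) (B 6)) addrC.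
  - by rewrite (dotC (n 5) (n 6)) (expand _ _ 0) y50 y52 subrr !mulr0 !add0r !subr0 (dotC (n 5)) addrC.
have [p8 q8] : D * (D * z8.1 + d0 (n 0) * z8.2) = - w7 * (d6 (n 0) * d0 (n 6)) * z6.2 /\
    D * z8.2 = - w7 * (D * z6.1 + d6 (n 6) * z6.2).
  rewrite /z8 /= /step B8 n8; apply: two_steps.
  - by rewrite (expand _ _ 1) a27 a47 subrr !mulr0 !addr0 (dotC (B 7) (B 0)) addrC.
  - by rewrite (expand _ _ 0) y72 y74 subrr !mulr0 !addr0 !subr0 (dotC (n 7)) addrC.
  - by rewrite (dotC (B 7) (n 0)) (expand _ _ 1) a27 a47 subrr !mulr0 !addr0 (dotC (B 7) (B 0)).
  - by rewrite (dotC (n 7) (n 0)) (expand _ _ 0) y72 y74 subrr !mulr0 !addr0 !subr0 (dotC (n 7)).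
set k0 := d0 (n 2) * d2 (n 0) in p2; set k2 := d2 (n 4) * d4 (n 2) in p4.
set k4 := d4 (n 6) * d6 (n 4) in p6; set k6 := d6 (n 0) * d0 (n 6) in p8.
have kk : k0 * k4 = k2 * k6.
  have -> : k0 * k4 = (d2 (n 0) * d4 (n 6)) * (d6 (n 4) * d0 (n 2)) by rewrite /k0 /k4; ring.
  have -> : k2 * k6 = (d4 (n 2) * d6 (n 0)) * (d0 (n 6) * d2 (n 4)) by rewrite /k2 /k6; ring.
  by rewrite coplanar1 coplanar3 coplanar5 coplanar7; ring.
set W := w1 * w3 * w5 * w7.
have h1 : D ^+ 4 * (D * z8.1 + d0 (n 0) * z8.2) = W * (k0 * k4) * (D * z.1 + d0 (n 0) * z.2).
  transitivity (D ^+ 3 * (D * (D * z8.1 + d0 (n 0) * z8.2))); first ring.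
  rewrite p8; transitivity (- w7 * k6 * D ^+ 2 * (D * z6.2)); first ring.
  rewrite q6; transitivity (w7 * w5 * k6 * D * (D * (D * z4.1 + d4 (n 4) * z4.2))); first ring.
  rewrite p4 kk /W; transitivity (- w3 * w5 * w7 * k2 * k6 * (D * z2.2)); first ring.
  by rewrite q2; ring.
have h2 : D ^+ 4 * z8.2 = W * (k0 * k4) * z.2.
  transitivity (D ^+ 3 * (D * z8.2)); first ring.
  rewrite q8; transitivity (- w7 * D ^+ 2 * (D * (D * z6.1 + d6 (n 6) * z6.2))); first ring.
  rewrite p6; transitivity (w7 * w5 * k4 * D * (D * z4.2)); first ring.
  rewrite q4; transitivity (- w7 * w5 * w3 * k4 * (D * (D * z2.1 + d2 (n 2) * z2.2))); first ring.
  by rewrite p2 /W; ring.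
have hD5 : D ^+ 5 != 0 by rewrite expf_neq0.
apply: (mulfI hD5).
transitivity (D ^+ 4 * (D * z8.1 + d0 (n 0) * z8.2) * z.2 - d0 (n 0) * z.2 * (D ^+ 4 * z8.2)); first ring.
transitivity (D * z.1 * (D ^+ 4 * z8.2)); last ring.
by rewrite h1 h2; ring.
Qed.
End Tetrahedron.

Section Morphism.
Variables (A A' : comNzRingType) (f : {rmorphism A -> A'}).
Definition map3 (u : vec3 A) : vec3 A' := (f u.1.1, f u.1.2, f u.2).

Lemma map_dot u w : f (dot u w) = dot (map3 u) (map3 w).
Proof. by rewrite /dot !rmorphD !rmorphM. Qed.

Lemma map_cross u w : map3 (cross u w) = cross (map3 u) (map3 w).
Proof. by rewrite /map3 /cross /= !rmorphB !rmorphM. Qed.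

Lemma map_shift u t w : map3 (shift u t w) = shift (map3 u) (f t) (map3 w).
Proof. by rewrite /map3 /shift /= !rmorphD !rmorphM. Qed.

Lemma map_det3 u v w : f (det3 u v w) = det3 (map3 u) (map3 v) (map3 w).
Proof. by rewrite /det3 map_dot map_cross. Qed.

Lemma map_det4 u a v b w c x d : f (det4 u a v b w c x d) =
  det4 (map3 u) (f a) (map3 v) (f b) (map3 w) (f c) (map3 x) (f d).
Proof.
rewrite /det4 -!map_det3.
move: (det3 v w x) (det3 u w x) (det3 u v x) (det3 u v w) => d1 d2 d3 d4.
by rewrite !rmorphD !rmorphN !rmorphM rmorphN.
Qed.

Lemma map_chain (B : nat -> vec3 A) (B' : nat -> vec3 A') k x y :
  (forall m, map3 (B m) = B' m) ->
  f (chain B k (x, y)).1 = (chain B' k (f x, f y)).1 /\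
  f (chain B k (x, y)).2 = (chain B' k (f x, f y)).2.
Proof.
move=> hB; have hn m : map3 (normal B m) = normal B' m by rewrite map_cross !hB.
elim: k => //= k [ih1 ih2]; rewrite -ih1 -ih2 -!hB -!hn -!map_dot.
move: (dot (B k) _) (dot (normal B k) _) (dot (B k) _) (dot (normal B k) _) => d1 d2 d3 d4.
by rewrite rmorphN !rmorphD !rmorphM rmorphB rmorph1.
Qed.
End Morphism.

Section EightSteps.
Variable K : fieldType.
Variable B : nat -> vec3 K.
Hypothesis hper : forall m, B (m + 8) = B m.
Hypothesis hadj : forall m, dot (B m) (B (m + 3)) = 1.
Local Notation n := (normal B).

Lemma adjacent5 m : dot (B m) (B (m + 5)) = 1.
Proof. by rewrite -(hper m) dotC -(hadj (m + 5)) -!addnA. Qed.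

Lemma normal_periodic m : n (m + 8) = n m.
Proof. by rewrite /normal -addnA (addnC 8 3) addnA hper -addnA (addnC 8 5) addnA hper. Qed.

(** Each vertex moves along its own line, which keeps all the incidences. *)
Definition perturbation (e : nat -> K) m : vec3 {poly K} :=
  shift (map3 polyC (B m)) ('X * (e m)%:P) (map3 polyC (n m)).

(** The polynomial identity for the moving tetrahedron, which holds because the
    determinant does not vanish at X = 1, is evaluated at X = 0.  Adjacent vertices
    must not both move, or else their pairing would have a term in X^2. *)
Lemma chain8_of_perturbation (e : nat -> K) (B' : nat -> vec3 K) z :
  (forall m, e (m + 8)%N = e m) -> (forall m, e m * e (m + 3)%N = 0) ->
  (forall m, B' m = shift (B m) (e m) (n m)) ->
  det4 (B' 0%N) 1 (B' 2%N) 1 (B' 4%N) 1 (B' 6%N) 1 != 0 ->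
  (chain B 8 z).1 * z.2 = (chain B 8 z).2 * z.1.
Proof.
move=> eper eadj hB' hD.
set P := perturbation e.
have evP a m : map3 (horner_eval a) (P m) = shift (B m) (a * e m) (n m).
  rewrite /P /perturbation map_shift rmorphM; move: (B m) (n m) => [[? ?] ?] [[? ?] ?].
  by rewrite /map3 /= !horner_evalE hornerX !hornerC.
have hPper m : P (m + 8) = P m.
  by rewrite /P /perturbation eper hper normal_periodic.
have hPadj m : dot (P m) (P (m + 3)) = 1.
  rewrite /P /perturbation dot_shiftl (dotC (map3 _ (B m))) (dotC (map3 _ (n m))).
  rewrite !dot_shiftl -!map_dot (dotC _ (B m)) hadj.
  have -> : dot (n (m + 3)) (B m) = 0.
    by rewrite -(hper m) -[(m + 8)%N]/(m + (3 + 5))%N addnA dot_crossr.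
  rewrite (dotC _ (n m)) /normal dot_crossl.
  transitivity (1%:P + 'X ^+ 2 * (e m * e (m + 3))%:P
      * (dot (cross (B (m + 3 + 3)) (B (m + 3 + 5))) (cross (B (m + 3)) (B (m + 5))))%:P).
    by rewrite polyCM; ring.
  by rewrite eadj polyC0 mulr0 mul0r addr0 polyC1.
have hPD : det4 (P 0) 1 (P 2) 1 (P 4) 1 (P 6) 1 != 0.
  apply: contraNneq hD => /(congr1 (horner_eval 1)).
  by rewrite map_det4 rmorph1 !evP !mul1r -!hB' => ->; rewrite horner_evalE horner0.
have := chain8_of_tetrahedron hPper hPadj hPD (z.1%:P, z.2%:P).
move=> /(congr1 (horner_eval 0)); rewrite !rmorphM.
have hB0 m : map3 (horner_eval 0) (P m) = B m.
  by rewrite evP mul0r /shift !mul0r !addr0; case: (B m) => [[? ?] ?].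
have [-> ->] := map_chain 8 z.1%:P z.2%:P hB0.
by rewrite /= !horner_evalE !hornerC; case: z.
Qed.

Section Trajectory.
Variable t : nat -> K.
Local Notation c m := (shift (B m) (t m) (n m)).
Hypothesis hc : forall m, (m < 8)%N -> dot (c m) (c m.+1) = 1.
Hypothesis hk : forall m, (m < 8)%N -> dot (c m) (n m.+1) != 0.

Lemma trajectory_step m : (m < 8)%N ->
  step B m (1, t m) = (dot (c m) (n m.+1), dot (c m) (n m.+1) * t m.+1).
Proof.
move=> hm; rewrite /step /= !mul1r -!dot_shiftl; congr (_, _).
have := hc hm; rewrite (dotC (c m)) (dot_shiftl (B m.+1)) (dotC _ (c m)) (dotC (n _) (c m)) => e.
transitivity (1 - dot (c m) (B m.+1)); first by rewrite dot_shiftl; ring.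
by rewrite -e; ring.
Qed.

Lemma trajectory_chain k : (k <= 8)%N ->
  exists2 l, l != 0 & chain B k (1, t 0) = (l, l * t k).
Proof.
elim: k => [_|k ih hk8]; first by exists 1; rewrite ?oner_eq0 ?mul1r.
have [l l0 e] := ih (ltnW hk8); exists (l * dot (c k) (n k.+1)).
  by rewrite mulf_neq0 // hk.
rewrite /= e; have := trajectory_step hk8; rewrite /step /= !mul1r => -[e1 e2].
by congr (_, _); [rewrite -e1 | rewrite -mulrA -e2]; ring.
Qed.

(** Moving B_0 to c_0 and B_2 to a point of its line other than c_2 gives a
    tetrahedron: the plane c_1 contains c_0, B_4 and B_6, which are independent since
    the step to c_1 is determined, and it meets the line at B_2 only in c_2 since the
    step to c_2 is determined. *)
Lemma chain8_scalar z : (chain B 8 z).1 * z.2 = (chain B 8 z).2 * z.1.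
Proof.
(* B_0 moves to c_0 and B_2 to c_2 + n_2. *)
pose e m : K := if (m %% 8 == 0)%N then t 0 else if (m %% 8 == 2)%N then t 2 + 1 else 0.
pose B' m := shift (B m) (e m) (n m).
apply: (@chain8_of_perturbation e B').
- by move=> m; rewrite /e modnDr.
- move=> m; rewrite /e -modnDml; case: (m %% 8)%N (ltn_pmod m (isT : 0 < 8)%N) => [|[|[|[|[|[|[|[|//]]]]]]]] _ /=;
    by rewrite ?mulr0 ?mul0r.
- by [].
have e4 : B' 4%N = B 4 by rewrite /B' /e /= /shift !mul0r !addr0; case: (B 4) => [[? ?] ?].
have e6 : B' 6%N = B 6 by rewrite /B' /e /= /shift !mul0r !addr0; case: (B 6) => [[? ?] ?].
have e0 : B' 0%N = c 0 by [].
have e2 : B' 2%N = shift (c 2) 1 (n 2) by rewrite /B' /e /= /shift /=; congr (_, _, _); ring.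
have h4 : dot (B 4) (c 1) = 1.
  by rewrite dotC dot_shiftl dot_crossl mulr0 addr0 (hadj 1).
have h6 : dot (B 6) (c 1) = 1.
  by rewrite dotC dot_shiftl dot_crossr mulr0 addr0 (adjacent5 1).
rewrite e0 e2 e4 e6 (det4_column _ _ _ _ (c 1)) h4 h6 (hc (isT : 0 < 8)%N) dot_shiftl.
rewrite (dotC (c 2)) (hc (isT : 1 < 8)%N) (dotC (n 2)).
suff -> : det4 (c 0) (1 - 1) (shift (c 2) 1 (n 2)) (1 - (1 + 1 * dot (c 1) (n 2)))
     (B 4) (1 - 1) (B 6) (1 - 1) = - (dot (c 1) (n 2) * dot (c 0) (n 1)).
  by rewrite oppr_eq0 mulf_neq0 // hk.
by rewrite /det4 /det3 /normal /=; ring.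
Qed.

Lemma trajectory_closes : t 8 = t 0.
Proof.
have [l l0 e] := trajectory_chain (leqnn 8).
by have := chain8_scalar (1, t 0); rewrite e /= mulr1 => /(mulfI l0).
Qed.

Lemma chain_wedge0 k m z w : (m < k)%N -> step_det B m = 0 ->
  (chain B k z).1 * (chain B k w).2 - (chain B k z).2 * (chain B k w).1 = 0.
Proof.
elim: k => // k ih; rewrite ltnS leq_eqVlt => /orP[/eqP -> h|mk h] /=.
  by rewrite -[LHS]/((step B k _).1 * (step B k _).2 - (step B k _).2 * (step B k _).1) step_wedge h mul0r.
by rewrite -[LHS]/((step B k _).1 * (step B k _).2 - (step B k _).2 * (step B k _).1) step_wedge ih // mulr0.
Qed.

(** A singular step would make all images of the eight steps proportional, while
    each vector is an eigenvector and one eigenvalue is not zero. *)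
Lemma step_det_neq0 m : (m < 8)%N -> step_det B m != 0.
Proof.
move=> hm; apply/eqP => hd.
have [l l0 e] := trajectory_chain (leqnn 8).
have w0 := chain_wedge0 (1, t 0) (0, 1) hm hd.
have p2 := chain8_scalar (0, 1).
have p3 := chain8_scalar (1 + 0, t 0 + 1).
have eD : chain B 8 (1 + 0, t 0 + 1) = (l + (chain B 8 (0, 1)).1, l * t 8 + (chain B 8 (0, 1)).2).
  by rewrite (chainD B 8 (1, t 0) (0, 1)) e.
move: w0 p2 p3; rewrite eD e trajectory_closes.
case: (chain _ _ _) => a b; rewrite [_.1]/= [_.2]/= => h1 h2 h3.
move: h1 h2 h3; rewrite /= mulr1 mulr0 => h1 h2; move: h1; rewrite {}h2 mulr0 subr0.
move/eqP; rewrite mulf_eq0 (negbTE l0) => /eqP -> h3.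
by move/eqP: l0; apply; move/(congr1 (fun x => x - l * t 0)): h3 => h3; ring: h3.
Qed.
End Trajectory.
End EightSteps.

Section Octagon.
Variable K : fieldType.

(** The difference u - v is orthogonal to a and b.  The vector x only serves to show
    that a and b are independent. *)
Lemma on_normal_line (u v a b x : vec3 K) :
  dot v a = 1 -> dot v b = 1 -> dot u a = 1 -> dot u b = 1 ->
  dot x (cross a b) != 0 -> exists t, u = shift v t (cross a b).
Proof.
move=> va vb ua ub; set n := cross a b => xn.
exists ((dot x u - dot x v) / dot x n).
have ha : dot u a - dot v a = 0 by rewrite ua va subrr.
have hb : dot u b - dot v b = 0 by rewrite ub vb subrr.
have main : (dot x n * (u.1.1 - v.1.1) = (dot x u - dot x v) * n.1.1) *
  (dot x n * (u.1.2 - v.1.2) = (dot x u - dot x v) * n.1.2) *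
  (dot x n * (u.2 - v.2) = (dot x u - dot x v) * n.2).
  move: ha hb; rewrite /n /dot /=.
  case: u v a b x {ua ub va vb n xn} => [[u0 u1] u2] [[v0 v1] v2] [[a0 a1] a2] [[b0 b1] b2] [[x0 x1] x2] /=.
  set A := _ - _; set C := _ - _ => hA hC.
  have vanish (y z : K) : y - z = 0 -> y = z by move/subr0_eq.
  split; first split.
  - apply: vanish; transitivity (C * (x1 * a2 - x2 * a1) - A * (x1 * b2 - x2 * b1)).
      by rewrite /A /C; ring.
    by rewrite hA hC !mul0r subrr.
  - apply: vanish; transitivity (C * (x2 * a0 - x0 * a2) - A * (x2 * b0 - x0 * b2)).
      by rewrite /A /C; ring.
    by rewrite hA hC !mul0r subrr.
  - apply: vanish; transitivity (C * (x0 * a1 - x1 * a0) - A * (x0 * b1 - x1 * b0)).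
      by rewrite /A /C; ring.
    by rewrite hA hC !mul0r subrr.
have aux (y z w : K) : dot x n * (y - z) = (dot x u - dot x v) * w ->
    y = z + (dot x u - dot x v) / dot x n * w.
  by move=> e; rewrite mulrAC -e mulrAC mulfV // mul1r addrC subrK.
move: main => [[/aux e1 /aux e2] /aux e3].
by rewrite /shift -e1 -e2 -e3; case: (u) => [[? ?] ?].
Qed.

Variables B c : nat -> vec3 K.
Hypothesis hper : forall m, B (m + 8) = B m.
Hypothesis hadj : forall m, dot (B m) (B (m + 3)) = 1.
Hypothesis hc3 : forall m, (m <= 10)%N -> dot (c m) (B (m + 3)) = 1.
Hypothesis hc5 : forall m, (m <= 10)%N -> dot (c m) (B (m + 5)) = 1.
Hypothesis hc1 : forall m, (m < 10)%N -> dot (c m) (c m.+1) = 1.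
Hypothesis hdet : forall m, (1 < m < 10)%N -> det3 (c m) (B (m + 4)) (B (m + 6)) != 0.
Local Notation n := (normal B).

Lemma center_on_line m : (m <= 10)%N -> exists t, c m = shift (B m) t (n m).
Proof.
move=> hm; suff [k hk e] : exists2 k, (1 < k < 10)%N & (k + 1 = m \/ k + 1 = m + 8)%N.
  apply: (@on_normal_line _ _ _ _ (c k)); rewrite ?hadj ?adjacent5 ?hc3 ?hc5 //.
  have per j : (B (k + 1 + j) = B (m + j)).
    by case: e => -> //; rewrite -addnA (addnC 8) addnA hper.
  by rewrite -(per 3%N) -(per 5%N) -!addnA; exact: hdet.
case: m hm => [|[|[|m]]] hm; [by exists 7; auto|by exists 8; auto|by exists 9; auto|].
by exists m.+2; [rewrite ltnS | left; rewrite addn1].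
Qed.

(** An invertible step determines its argument from its image. *)
Lemma step_back m s t r : step_det B m != 0 ->
  dot (shift (B m) s (n m)) (shift (B m.+1) r (n m.+1)) = 1 ->
  dot (shift (B m) t (n m)) (shift (B m.+1) r (n m.+1)) = 1 -> s = t.
Proof.
set C := shift (B m.+1) _ _ => hd; rewrite !dot_shiftl => e1 e2.
have h : (s - t) * dot (n m) C = 0.
  by transitivity ((dot (B m) C + s * dot (n m) C) - (dot (B m) C + t * dot (n m) C)); [ring|rewrite e1 e2 subrr].
move/eqP: h; rewrite mulf_eq0 subr_eq0 => /orP[/eqP //|/eqP h].
have {}e1 : dot (B m) C = 1 by rewrite -e1 h mulr0 addr0.
move: e1 h; rewrite /C !(dotC _ (shift _ _ _)) !dot_shiftl => e1 h.
suff z : step_det B m = 0 by rewrite z eqxx in hd.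
rewrite /step_det (dotC (n m) (n _)) (dotC (B m) (B _)) (dotC (B m) (n _)) (dotC (n m) (B _)).
have -> : dot (B m.+1) (n m) = - (r * dot (n m.+1) (n m)) by apply/eqP; rewrite -addr_eq0 h.
have -> : dot (B m.+1) (B m) = 1 - r * dot (n m.+1) (B m) by rewrite -e1 addrK.
by ring.
Qed.

(** The steps from c_2 to c_10 are determined, so that c_10 = c_2; going back by the
    invertible steps gives c_9 = c_1 and c_8 = c_0. *)
Lemma octagon_closes : c 8 = c 0 /\ c 9 = c 1 /\ c 10 = c 2.
Proof.
have [t ht] : exists t : nat -> K, forall m, (m <= 10)%N -> c m = shift (B m) (t m) (n m).
  have [t ht] := fin_all_exists (fun i : 'I_11 => center_on_line (ltn_ord i : i <= 10)%N).
  by exists (fun m => t (inord m)) => m hm; rewrite -[in LHS](inordK hm) ht inordK.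
pose B' m := B (m + 2).
pose t' m := t (m + 2)%N.
have B'per m : B' (m + 8) = B' m by rewrite /B' addnAC hper.
have B'adj m : dot (B' m) (B' (m + 3)) = 1 by rewrite /B' addnAC hadj.
have n' m : normal B' m = n (m + 2) by rewrite /normal /B' addnAC (addnAC _ 5).
have hc' m : (m < 8)%N -> dot (shift (B' m) (t' m) (normal B' m))
    (shift (B' m.+1) (t' m.+1) (normal B' m.+1)) = 1.
  move=> hm; rewrite !n' /B' /t' !addn2 -!ht; [|lia..].
  by apply: hc1; lia.
have hk' m : (m < 8)%N -> dot (shift (B' m) (t' m) (normal B' m)) (normal B' m.+1) != 0.
  move=> hm; rewrite !n' /B' /t' addn2 -ht; last lia.
  rewrite addn2.
  rewrite /normal (addSnnS m.+2 3) (addSnnS m.+2 5).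
  by apply: hdet; lia.
have t10 : t 10 = t 2 by exact: (@trajectory_closes K B' B'per B'adj t' hc' hk').
have sd m : (m < 8)%N -> step_det B (m + 2) != 0.
  move=> hm; have := @step_det_neq0 K B' B'per B'adj t' hc' hk' m hm.
  by rewrite /step_det !n' /B' addSn.
have Bn8 m : (B (m + 8) = B m) * (n (m + 8) = n m).
  by rewrite hper normal_periodic.
have c10 : c 10 = c 2 by rewrite !ht // !(Bn8 2) t10.
have t9 : t 9 = t 1.
  apply: (@step_back 9 _ _ (t 10) (sd 7 isT)); first by rewrite -!ht // hc1.
  rewrite !(Bn8 1) -ht // -ht // c10; exact: (hc1 (m := 1)).
have c9 : c 9 = c 1 by rewrite !ht // !(Bn8 1) t9.
have t8 : t 8 = t 0.
  apply: (@step_back 8 _ _ (t 9) (sd 6 isT)); first by rewrite -!ht // hc1.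
  rewrite !(Bn8 0) -ht // -ht // c9; exact: (hc1 (m := 0)).
by split=> //; rewrite !ht // !(Bn8 0) t8.
Qed.
End Octagon.

(** * Labels as vectors *)
Section Representatives.
Variable K : fieldType.
Local Notation label := {vspace 'rV[K]_3}.
Local Notation vec := (vec3 K).

Definition row3 (u : vec) : 'rV[K]_3 := \row_(i < 3) [:: u.1.1; u.1.2; u.2]`_i.
Definition vec_of_row (x : 'rV[K]_3) : vec := (x 0 0, x 0 1, x 0 (2%:R)).
Definition scale (k : K) (u : vec) : vec := (k * u.1.1, k * u.1.2, k * u.2).

Lemma row3K : cancel row3 vec_of_row.
Proof. by case=> [[a b] c]; rewrite /vec_of_row !mxE. Qed.

Lemma vec_of_rowK : cancel vec_of_row row3.
Proof.
move=> x; apply/rowP => i; rewrite mxE /=.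
by case: i => [[|[|[|i]]] hi] //=; congr (x _ _); apply/val_inj.
Qed.

Lemma row3Z k u : row3 (scale k u) = k *: row3 u.
Proof. by apply/rowP => -[[|[|[|i]]] hi]; rewrite ?mxE. Qed.

Lemma row3D t u w : row3 (shift u t w) = row3 u + t *: row3 w.
Proof. by apply/rowP => -[[|[|[|i]]] hi]; rewrite ?mxE. Qed.

Lemma row3_eq0 u : (row3 u == 0) = (u == 0).
Proof.
apply/eqP/eqP => [h|->]; last by apply/rowP => -[[|[|[|i]]] hi]; rewrite ?mxE.
by rewrite -(row3K u) h /vec_of_row !mxE.
Qed.

Lemma dotZl k u w : dot (scale k u) w = k * dot u w.
Proof. by rewrite /dot /=; ring. Qed.

Lemma dotZr k u w : dot u (scale k w) = k * dot u w.
Proof. by rewrite dotC dotZl dotC. Qed.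

Definition orthogonal (w : vec) : label := lker (linfun (mulmxr (row3 w)^T)).

Lemma row3_mul u w : row3 u *m (row3 w)^T = (dot u w)%:M.
Proof.
apply/rowP => i; rewrite !ord1 !mxE !big_ord_recr big_ord0 /= !mxE /= add0r.
by rewrite mulr1n.
Qed.

Lemma mem_orthogonal u w : (row3 u \in orthogonal w) = (dot u w == 0).
Proof.
rewrite /orthogonal memv_ker lfunE /= row3_mul; apply/eqP/eqP => [|->].
  by move/(congr1 (fun M : 'M_1 => M 0 0)); rewrite !mxE mulr1n.
by rewrite raddf0.
Qed.

Lemma exists_dot_neq0 (w : vec) : w != 0 -> exists x, dot x w != 0.
Proof.
case: w => [[a b] c] w0; have [a0|a0] := eqVneq a 0; last first.
  by exists (1, 0, 0); rewrite /dot /= !mul0r !addr0 mul1r.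
have [b0|b0] := eqVneq b 0; last first.
  by exists (0, 1, 0); rewrite /dot /= !mul0r addr0 add0r mul1r.
exists (0, 0, 1); rewrite /dot /= !mul0r !add0r mul1r; move: w0; rewrite a0 b0.
by apply: contraNneq => ->.
Qed.

(** From x * (a * b) = (x.b) a - (x.a) b, for cross products. *)
Lemma cross_eq0 (a b : vec) : a != 0 -> cross a b = 0 -> exists k, b = scale k a.
Proof.
move=> /exists_dot_neq0[x xa] h; exists (dot x b / dot x a).
have main : (dot x a * b.1.1 = dot x b * a.1.1) * (dot x a * b.1.2 = dot x b * a.1.2)
   * (dot x a * b.2 = dot x b * a.2).
  case: a b x h {xa} => [[a0 a1] a2] [[b0 b1] b2] [[x0 x1] x2] [h0 h1 h2].
  rewrite /dot /=; split; first split; apply: subr0_eq.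
  - by transitivity (x1 * 0 * -1 + x2 * (0:K)); [rewrite -{1}h2 -h1; ring | ring].
  - by transitivity (x0 * 0 + - x2 * (0:K)); [rewrite -{1}h2 -h0; ring | ring].
  - by transitivity (- x0 * 0 + x1 * (0:K)); [rewrite -{1}h1 -h0; ring | ring].
have aux (y z : K) : dot x a * y = dot x b * z -> y = dot x b / dot x a * z.
  by move=> e; rewrite mulrAC -e mulrAC mulfV // mul1r.
move: main => [[/aux e1 /aux e2] /aux e3].
by rewrite /scale -e1 -e2 -e3; case: (b) => [[? ?] ?].
Qed.

Lemma dim_orthogonal w : w != 0 -> \dim (orthogonal w) = 2%N.
Proof.
move=> w0; pose f : 'Hom('rV[K]_3, 'rV[K]_1) := linfun (mulmxr (row3 w)^T).
have := limg_ker_dim f fullv; rewrite capfv dimvf /dim /= -/(orthogonal w).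
suff -> : \dim (limg f) = 1%N by rewrite addn1 mul1n => -[].
apply/eqP; rewrite eqn_leq; apply/andP; split.
  by rewrite -[leqRHS]/(dim 'rV[K]_1) -dimvf dimvS // subvf.
rewrite lt0n dimv_eq0; have [x xw] := exists_dot_neq0 w0.
apply/eqP => h; have : f (row3 x) \in limg f by rewrite memv_img // memvf.
rewrite h memv0 lfunE /= row3_mul => /eqP/(congr1 (fun M : 'M_1 => M 0 0)).
by rewrite !mxE mulr1n => e; rewrite e eqxx in xw.
Qed.

(** The flag is true for points and false for lines. *)
Definition rep (s : bool) (w : vec) (L : label) : Prop :=
  w != 0 /\ L = if s then <[row3 w]>%VS else orthogonal w.

Lemma rep_dim s w L : rep s w L -> \dim L = (~~ s).+1.
Proof.
case=> w0 ->; case: s => /=; first by rewrite dim_vline row3_eq0 w0.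
exact: dim_orthogonal.
Qed.

Lemma rep_type s s' w w' L : rep s w L -> rep s' w' L -> s = s'.
Proof. by move=> /rep_dim e /rep_dim; rewrite e; case: s {e}; case: s'. Qed.

Lemma rep_fun s w L L' : rep s w L -> rep s w L' -> L = L'.
Proof. by move=> [_ ->] [_ ->]. Qed.

Lemma rep_ex s w : w != 0 -> exists L, rep s w L.
Proof. by move=> w0; exists (if s then <[row3 w]>%VS else orthogonal w); split. Qed.

Lemma rep_point A : is_point A -> exists a, rep true a A.
Proof.
rewrite /is_point => dA; exists (vec_of_row (vpick A)); split.
  by rewrite -row3_eq0 vec_of_rowK vpick0 -dimv_eq0 dA.
rewrite vec_of_rowK; apply/eqP; rewrite eq_sym eqEdim -memvE memv_pick /=.
by rewrite dA dim_vline vpick0 -dimv_eq0 dA.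
Qed.

(** The vector is the cross product of two vectors of a basis. *)
Lemma rep_line L : is_line L -> exists w, rep false w L.
Proof.
rewrite /is_line => dL.
have [a [aL a0]] : exists a, row3 a \in L /\ a != 0.
  exists (vec_of_row (vpick L)); rewrite vec_of_rowK memv_pick.
  by rewrite -row3_eq0 vec_of_rowK vpick0 -dimv_eq0 dL.
have [b [bL bna]] : exists b, row3 b \in L /\ row3 b \notin <[row3 a]>%VS.
  have : ~~ (L <= <[row3 a]>)%VS.
    by apply/negP => /dimvS; rewrite dL dim_vline row3_eq0 a0.
  by case/subvPn=> x xL xn; exists (vec_of_row x); rewrite vec_of_rowK.
have w0 : cross a b != 0.
  apply/eqP => /(cross_eq0 a0)[k e]; case/negP: bna.
  by rewrite e row3Z memvZ // memv_line.
exists (cross a b); split=> //.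
have fr : free [:: row3 a; row3 b].
  by rewrite free_cons span_seq1 /= seq1_free; apply/andP; split; [
    apply: contra bna => /vlineP[k e]; apply/vlineP; exists k^-1; rewrite e scalerA mulVf ?scale1r //;
    apply: contra_neq a0 => k0; apply/eqP; rewrite -row3_eq0 e k0 scale0r
  | apply: contra bna => /eqP ->; rewrite mem0v].
have sp : \dim <<[:: row3 a; row3 b]>> = 2%N by move: fr; rewrite /free => /eqP.
have sub (X : label) : row3 a \in X -> row3 b \in X -> (<<[:: row3 a; row3 b]>> <= X)%VS.
  by move=> aX bX; apply/span_subvP => x; rewrite !inE => /orP[] /eqP ->.
have e1 : <<[:: row3 a; row3 b]>>%VS = L.
  by apply/eqP; rewrite eqEdim sub //= sp dL.
have e2 : <<[:: row3 a; row3 b]>>%VS = orthogonal (cross a b).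
  apply/eqP; rewrite eqEdim sub ?mem_orthogonal ?(dotC _ (cross _ _)) ?dot_crossl ?dot_crossr //=.
  by rewrite sp dim_orthogonal.
by rewrite -e1 e2.
Qed.

Lemma rep_scale s w L k : k != 0 -> rep s w L -> rep s (scale k w) L.
Proof.
move=> k0 [w0 ->]; split.
  by rewrite -row3_eq0 row3Z scaler_eq0 (negbTE k0) row3_eq0.
case: s.
  apply/vspaceP => x; apply/vlineP/vlineP => -[l ->].
    by exists (l / k); rewrite row3Z scalerA divfK.
  by exists (l * k); rewrite row3Z scalerA.
apply/vspaceP => x; rewrite -(vec_of_rowK x) !mem_orthogonal dotZr mulf_eq0.
by rewrite (negbTE k0).
Qed.

Lemma rep_uniq s w w' L : rep s w L -> rep s w' L -> exists k, w' = scale k w.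
Proof.
case=> w0 -> [w0']; case: s => e.
  have : row3 w' \in <[row3 w]>%VS by rewrite e memv_line.
  by case/vlineP=> k; rewrite -row3Z => /(can_inj row3K) ->; exists k.
apply: cross_eq0 => //.
have h x : dot (cross w x) w' = 0.
  by apply/eqP; rewrite -mem_orthogonal -e mem_orthogonal dot_crossl.
have [//|/exists_dot_neq0[x0 /eqP[]]] := eqVneq (cross w w') 0.
by rewrite -[RHS]oppr0 -(h x0) /dot /=; ring.
Qed.

Lemma rep_incident a l A L : rep true a A -> rep false l L ->
  (A <= L)%VS = (dot a l == 0).
Proof. by move=> [_ ->] [_ ->]; rewrite -memvE mem_orthogonal. Qed.
End Representatives.

Section Coherence.
Variable K : fieldType.
Local Notation label := {vspace 'rV[K]_3}.
Local Notation vec := (vec3 K).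

Definition coherent_vectors (w0 w1 w2 w3 : vec) : Prop :=
  [/\ dot w0 w1 != 0, dot w1 w2 != 0, dot w2 w3 != 0, dot w3 w0 != 0
    & dot w0 w1 * dot w2 w3 = dot w1 w2 * dot w3 w0].

(** Whether the first label is a point or a line, as in [coherent_tile]. *)
Definition coherent_quad (W0 W1 W2 W3 : label) : Prop :=
  coherent W0 W1 W2 W3 \/ coherent W1 W2 W3 W0.

Lemma coherent_sym A l B m : coherent (K := K) A l B m -> coherent A m B l.
Proof.
move=> [[pA pB ll lm] [Al Am Bl Bm] h]; split; [by split|by split|].
by case: h => [->|->|h]; [exact: Or31|exact: Or32|apply: Or33; rewrite capvC].
Qed.

Lemma coherent_sym' A l B m : coherent (K := K) A l B m -> coherent B l A m.
Proof.
move=> [[pA pB ll lm] [Al Am Bl Bm] h]; split; [by split|by split|].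
by case: h => [->|->|h]; [exact: Or31|exact: Or32|apply: Or33; rewrite addvC].
Qed.

Lemma coherent_quad_rot W0 W1 W2 W3 :
  coherent_quad W0 W1 W2 W3 -> coherent_quad W1 W2 W3 W0.
Proof. by case=> h; [right; apply/coherent_sym/coherent_sym'|left]. Qed.

Lemma coherent_quad_rev W0 W1 W2 W3 :
  coherent_quad W0 W1 W2 W3 -> coherent_quad W0 W3 W2 W1.
Proof. by case=> h; [left; apply/coherent_sym | right; apply/coherent_sym']. Qed.

Lemma coherent_vectors_rot w0 w1 w2 w3 :
  coherent_vectors w0 w1 w2 w3 -> coherent_vectors w1 w2 w3 w0.
Proof. by case=> h1 h2 h3 h4 e; split=> //; rewrite -e mulrC. Qed.

(** If A = B or l = m, two vectors are proportional.  Otherwise l and m meet in a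
    vector x = k a + j b, and the two equations x.l = x.m = 0 have a nonzero solution
    (k, j), so their determinant is zero. *)
Lemma coherent_to_vectors A l B m a u b w :
  coherent A l B m -> rep true a A -> rep false u l -> rep true b B -> rep false w m ->
  coherent_vectors a u b w.
Proof.
move=> [_ [Al Am Bl Bm] h] rA rl rB rm.
move/negP: Al; move/negP: Am; move/negP: Bl; move/negP: Bm.
rewrite (rep_incident rA rl) (rep_incident rA rm) (rep_incident rB rl) (rep_incident rB rm).
move=> bw bu aw au; split; rewrite ?(dotC w) ?(dotC u) //.
case: h => [E|E|h].
- move: rB; rewrite -E => /(rep_uniq rA)[k ->].
  by rewrite ?(dotC w) ?(dotC u) !dotZl; ring.
- move: rm; rewrite -E => /(rep_uniq rl)[k ->].
  by rewrite ?(dotC w) ?(dotC u) !dotZr; ring.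
have lm0 : (l :&: m)%VS != 0%VS.
  rewrite -dimv_eq0; apply/eqP => z.
  have := dimv_sum_cap l m; rewrite z (rep_dim rl) (rep_dim rm) addn0 => e.
  by have := dimvS (subvf (l + m)%VS); rewrite e dimvf.
pose x := vec_of_row (vpick (l :&: m)%VS).
have x0 : x != 0 by rewrite -row3_eq0 vec_of_rowK vpick0.
have : row3 x \in (l :&: m)%VS by rewrite vec_of_rowK memv_pick.
move=> xlm; have := subvP h _ xlm; move: xlm; rewrite memv_cap.
have [_ ->] := rl; have [_ ->] := rm; have [_ ->] := rA; have [_ ->] := rB.
rewrite !mem_orthogonal => /andP[/eqP xu /eqP xw] /memv_addP[y /vlineP[k ->]] [z /vlineP[j ->]].
rewrite -row3Z -row3D => /(can_inj (@row3K K)) xE.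
move: xu xw x0; rewrite {}xE !dot_shiftl !dotZl => xu xw x0.
have [k0|k0] := eqVneq k 0.
  have j0 : j != 0 by apply: contraNneq x0 => ->; rewrite k0 /scale /shift /= !mul0r !addr0.
  move: xu; rewrite k0 mul0r add0r => /eqP; rewrite mulf_eq0 (negbTE j0) /=.
  by rewrite (negbTE bu).
apply: (mulfI k0); apply: subr0_eq.
transitivity (dot b w * (k * dot a u + j * dot b u) - dot b u * (k * dot a w + j * dot b w)); first ring.
by rewrite xu xw !mulr0 subrr.
Qed.

(** The vector (b.l) a - (a.l) b of the line AB is orthogonal to l, and by the
    relation also to m. *)
Lemma vectors_to_coherent A l B m a u b w :
  coherent_vectors a u b w -> rep true a A -> rep false u l -> rep true b B -> rep false w m ->
  coherent A l B m.
Proof.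
move=> [au ub bw wa e] rA rl rB rm; split.
- split; [exact: (rep_dim rA)|exact: (rep_dim rB)|exact: (rep_dim rl)|exact: (rep_dim rm)].
- by split; apply/negP; rewrite ?(rep_incident rA rl) ?(rep_incident rA rm)
    ?(rep_incident rB rl) ?(rep_incident rB rm) // dotC.
have [->|AB] := eqVneq A B; first exact: Or31.
have [->|lm] := eqVneq l m; first exact: Or32.
apply: Or33.
pose x := shift (scale (dot b u) a) (- dot a u) b.
have x0 : x != 0.
  apply: contraNneq AB => xE; apply/eqP.
  have ab : a = scale (dot a u / dot b u) b.
    have bu : dot b u != 0 by rewrite dotC.
    have aux (y z : K) : dot b u * y + - dot a u * z = 0 -> y = dot a u / dot b u * z.
      rewrite mulNr => /subr0_eq h; rewrite mulrAC -h mulrAC mulfV // mul1r //.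
    move: xE; rewrite /x /shift /scale /= => -[/aux h1 /aux h2 /aux h3].
    by rewrite -h1 -h2 -h3; case: (a) => [[? ?] ?].
  have bu : dot b u != 0 by rewrite dotC.
  apply: rep_fun rA _; rewrite ab; apply: rep_scale rB.
  by rewrite mulf_neq0 ?invr_eq0.
have xu : dot x u = 0 by rewrite dot_shiftl dotZl; ring.
have xw : dot x w = 0.
  by rewrite dot_shiftl dotZl (dotC b u) (dotC a w) -e; ring.
have xlm : (<[row3 x]> <= l :&: m)%VS.
  have [_ ->] := rl; have [_ ->] := rm.
  by rewrite -memvE memv_cap !mem_orthogonal xu xw eqxx.
have d1 : (\dim (l :&: m) <= 1)%N.
  rewrite -ltnS -[X in (_ < X)%N](rep_dim rl) ltn_neqAle dimvS ?capvSl // andbT.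
  apply: contra lm => /eqP d.
  have e1 : (l :&: m)%VS = l by apply/eqP; rewrite eqEdim capvSl /= d.
  have e2 : (l :&: m)%VS = m by apply/eqP; rewrite eqEdim capvSr /= d (rep_dim rl) (rep_dim rm).
  by apply/eqP; exact: etrans (esym e1) e2.
have -> : (l :&: m)%VS = <[row3 x]>%VS.
  by apply/eqP; rewrite eq_sym eqEdim xlm dim_vline row3_eq0 x0.
rewrite -memvE /x row3D row3Z; have [_ ->] := rA; have [_ ->] := rB.
by rewrite memv_add // memvZ // memv_line.
Qed.

Lemma coherent_quad_vectors s W0 W1 W2 W3 w0 w1 w2 w3 :
  coherent_quad W0 W1 W2 W3 ->
  rep s w0 W0 -> rep (~~ s) w1 W1 -> rep s w2 W2 -> rep (~~ s) w3 W3 ->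
  coherent_vectors w0 w1 w2 w3.
Proof.
have two A a (L : Prop) : is_point A -> rep false a A -> L by move=> /rep_point[? /rep_type h] /h.
case: s => -[h r0 r1 r2 r3|h r0 r1 r2 r3].
- exact: coherent_to_vectors h r0 r1 r2 r3.
- by case: h => -[p _ _ _] _ _; exact: two p r1.
- by case: h => -[p _ _ _] _ _; exact: two p r0.
do 3!apply: coherent_vectors_rot.
exact: coherent_to_vectors h r1 r2 r3 r0.
Qed.

Lemma vectors_coherent_quad s W0 W1 W2 W3 w0 w1 w2 w3 :
  coherent_vectors w0 w1 w2 w3 ->
  rep s w0 W0 -> rep (~~ s) w1 W1 -> rep s w2 W2 -> rep (~~ s) w3 W3 ->
  coherent_quad W0 W1 W2 W3.
Proof.
case: s => h r0 r1 r2 r3; [left|right]; first exact: vectors_to_coherent h r0 r1 r2 r3.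
by apply: vectors_to_coherent (coherent_vectors_rot h) r1 r2 r3 r0.
Qed.

Lemma coherent_quad_types s W0 W1 W2 W3 w0 :
  coherent_quad W0 W1 W2 W3 -> rep s w0 W0 ->
  (exists w1, rep (~~ s) w1 W1) /\ (exists w2, rep s w2 W2).
Proof.
case=> -[[p0 p2 l1 l3] _ _] r0.
  have [a ra] := rep_point p0; rewrite -(rep_type ra r0) /=.
  by split; [exact: rep_line | exact: rep_point].
have [a ra] := rep_line l3; rewrite -(rep_type ra r0) /=.
by split; [exact: rep_point | exact: rep_line].
Qed.

Lemma coherent_normalize s W0 W1 W2 W3 w0 :
  coherent_quad W0 W1 W2 W3 -> rep s w0 W0 ->
  exists2 w1, rep (~~ s) w1 W1 & dot w0 w1 = 1.
Proof.
move=> h r0; have [[w1 r1] [w2 r2]] := coherent_quad_types h r0.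
have [[w3 r3] _] := coherent_quad_types (coherent_quad_rev h) r0.
have [d01 _ _ _ _] := coherent_quad_vectors h r0 r1 r2 r3.
exists (scale (dot w0 w1)^-1 w1); first by apply: rep_scale; rewrite ?invr_eq0.
by rewrite dotZr mulVf.
Qed.

Lemma coherent_complete s W0 W1 W2 W3 w0 w1 w3 :
  coherent_quad W0 W1 W2 W3 -> rep s w0 W0 -> rep (~~ s) w1 W1 -> rep (~~ s) w3 W3 ->
  dot w0 w1 = 1 -> dot w0 w3 = 1 ->
  exists w2, [/\ rep s w2 W2, dot w2 w1 = 1 & dot w2 w3 = 1].
Proof.
move=> h r0 r1 r3 d01 d03; have [_ [w2 r2]] := coherent_quad_types h r0.
have [_ d12 _ _] := coherent_quad_vectors h r0 r1 r2 r3.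
rewrite d01 (dotC w3) d03 mul1r mulr1 => e.
exists (scale (dot w1 w2)^-1 w2); split; first by apply: rep_scale; rewrite ?invr_eq0.
  by rewrite dotZl (dotC w2) mulVf.
by rewrite dotZl e mulVf.
Qed.

Lemma coherent_last s W0 W1 W2 W3 w0 w1 w2 w3 :
  coherent_quad W0 W1 W2 W3 ->
  rep s w0 W0 -> rep (~~ s) w1 W1 -> rep s w2 W2 -> rep (~~ s) w3 W3 ->
  dot w1 w2 = 1 -> dot w2 w3 = 1 -> dot w3 w0 = 1 -> dot w0 w1 = 1.
Proof.
move=> h r0 r1 r2 r3 d12 d23 d30.
by have [_ _ _ _] := coherent_quad_vectors h r0 r1 r2 r3; rewrite d12 d23 d30 !mulr1.
Qed.
End Coherence.

(** * The labels of the octagon *)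
Section OctagonLabels.
Variable K : fieldType.
Local Notation label := {vspace 'rV[K]_3}.
Local Notation vec := (vec3 K).

Lemma coherent_quad_rep (W0 W1 W2 W3 : label) :
  coherent_quad W0 W1 W2 W3 -> exists s w, rep s w W0.
Proof.
case=> -[[p _ _ l] _ _]; [have [w r] := rep_point p; by exists true, w|].
by have [w r] := rep_line l; exists false, w.
Qed.

(** A singular homogeneous system has a nonzero solution. *)
Lemma det3_eq0 (u v w : vec) : v != 0 -> det3 u v w = 0 ->
  exists z, [/\ z != 0, dot z u = 0, dot z v = 0 & dot z w = 0].
Proof.
move=> v0 d0; have [e|vw] := eqVneq (cross v w) 0; last first.
  exists (cross v w); split; rewrite ?dot_crossl ?dot_crossr //.
  by rewrite dotC.
have [k ->] := cross_eq0 v0 e.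
have [e'|uv] := eqVneq (cross v u) 0; last first.
  by exists (cross v u); split; rewrite ?dotZr ?dot_crossl ?dot_crossr ?mulr0.
have [k' ->] := cross_eq0 v0 e'.
suff [z [z0 zv]] : exists z, z != 0 /\ dot z v = 0.
  by exists z; rewrite !dotZr zv !mulr0; split.
case: v {d0 e e'} v0 => [[a b] c] v0; have [a0|a0] := eqVneq a 0.
  exists (1, 0, 0); split; first by apply/eqP => -[/eqP]; rewrite oner_eq0.
  by rewrite /dot /= a0; ring.
exists (b, - a, 0); split; last by rewrite /dot /=; ring.
by apply/eqP => -[_ /eqP]; rewrite oppr_eq0 (negbTE a0).
Qed.

Variables Bl Cl : nat -> label.
Hypothesis hper : forall m, Bl (m + 8) = Bl m.
Hypothesis hG : forall m, (m <= 10)%N ->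
  coherent_quad (Cl m) (Bl (m + 3)) (Bl m) (Bl (m + 5)).
Hypothesis hH : forall m, (m <= 9)%N ->
  coherent_quad (Cl m) (Cl m.+1) (Bl (m + 6)) (Bl (m + 3)).
Hypothesis hJ : forall m, (m <= 8)%N ->
  coherent_quad (Cl m) (Cl m.+1) (Cl m.+2) (Bl (m + 5)).
Hypothesis hU : forall m L, (m < 8)%N ->
  coherent_quad L (Bl (m + 6)) (Bl (m + 3)) (Bl (m + 8)) ->
  coherent_quad (Cl m.+2) L (Bl (m + 8)) (Bl (m + 5)) ->
  coherent_quad (Cl m.+1) (Cl m.+2) L (Bl (m + 6)) -> L = Cl m.+3.

Let periodic_mod m : Bl m = Bl (m %% 8)%N.
Proof.
rewrite {1}(divn_eq m 8) addnC; elim: (m %/ 8)%N => [|k ih]; first by rewrite addn0.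
by rewrite mulSn addnCA addnC hper.
Qed.

(** Start from the middle inner vertex and scale its neighbours; each quadrilateral
    then provides the next vertex, and its relation gives the fourth edge. *)
Lemma normalized_boundary : exists s (B : nat -> vec),
  [/\ forall m, B (m + 8)%N = B m, forall m, dot (B m) (B (m + 3)%N) = 1
    & forall m, rep (s (+) odd m) (B m) (Bl m)].
Proof.
have [s1 [c1 r1]] := coherent_quad_rep (hG (isT : 1 <= 10)%N).
have qH0 := coherent_quad_rot (hH (isT : 0 <= 9)%N).
have qH1 := hH (isT : 1 <= 9)%N.
have [b6 r6 d6] := coherent_normalize qH0 r1.
have [c0 rc0 d0] := coherent_normalize (coherent_quad_rev qH0) r1.
have [c2 rc2 d2] := coherent_normalize qH1 r1.
have [b4 r4 d4] := coherent_normalize (coherent_quad_rev qH1) r1.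
have [b3 [r3 d36 d30]] := coherent_complete qH0 r1 r6 rc0 d6 d0.
have [b7 [r7 d72 d74]] := coherent_complete qH1 r1 rc2 r4 d2 d4.
have [b1 [rb1 d14 d16]] := coherent_complete (hG (isT : 1 <= 10)%N) r1 r4 r6 d4 d6.
have [b5 [r5 d52 d50]] :=
  coherent_complete (coherent_quad_rot (hJ (isT : 0 <= 8)%N)) r1 rc2 rc0 d2 d0.
have [s s1E] : exists s, s1 = ~~ s by exists (~~ s1); rewrite negbK.
move: rb1 r3 r4 r5 r6 r7 rc0 rc2; rewrite s1E negbK => rb1 r3 r4 r5 r6 r7 rc0 rc2.
rewrite (dotC _ c0) in d30; rewrite (dotC _ c0) in d50.
rewrite (dotC _ c2) in d52; rewrite (dotC _ c2) in d72.
have [b0 [r0 d03 d05]] := coherent_complete (hG (isT : 0 <= 10)%N) rc0 r3 r5 d30 d50.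
have [b2 [r2 d25 d27]] := coherent_complete (hG (isT : 2 <= 10)%N) rc2 r5 r7 d52 d72.
exists s, (fun m => nth 0 [:: b0; b1; b2; b3; b4; b5; b6; b7] (m %% 8)%N); split=> m.
- by rewrite modnDr.
- rewrite -modnDml; case: (m %% 8)%N (ltn_pmod m (isT : 0 < 8)%N) => [|[|[|[|[|[|[|[|//]]]]]]]] _ //=.
  + by rewrite dotC.
  + by rewrite dotC.
  + by rewrite dotC.
  + by rewrite dotC.
- have -> : odd m = odd (m %% 8)%N.
    by rewrite [in LHS](divn_eq m 8) oddD oddM andbF.
  rewrite periodic_mod; case: (m %% 8)%N (ltn_pmod m (isT : 0 < 8)%N) => [|[|[|[|[|[|[|[|//]]]]]]]] _ /=;
  by rewrite ?addbT ?addbF.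
Qed.

(** The normalized vectors of the corners are fixed once and for all, and every inner
    vertex is normalized against its two corners.  If the three neighbours of a new
    vertex were dependent, adding to it a vector orthogonal to them would give another
    admissible label. *)
Lemma label_octagon_closes : [/\ Cl 8 = Cl 0, Cl 9 = Cl 1 & Cl 10 = Cl 2].
Proof.
have [s [B [Bper Badj rB]]] := normalized_boundary.
have B5 := adjacent5 Bper Badj.
have sw m k : s (+) odd (m + k) = if odd k then ~~ (s (+) odd m) else s (+) odd m.
  by rewrite oddD; case: (odd k); case: (odd m); case: (s).
have ex m : exists c, (m <= 10)%N -> [/\ rep (s (+) odd m) c (Cl m), dot c (B (m + 3)%N) = 1 & dot c (B (m + 5)%N) = 1].
  have [hm|] := leqP m 10; last by exists 0.
  have rB3 := rB (m + 3)%N; have rB5 := rB (m + 5)%N; rewrite sw /= in rB3; rewrite sw /= in rB5.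
  have q := coherent_quad_rot (coherent_quad_rot (hG hm)).
  have [c [h1 h2 h3]] := coherent_complete q (rB m) rB5 rB3 (B5 m) (Badj m).
  by exists c.
have [c hc] := fin_all_exists (fun i : 'I_11 => ex i).
pose C m := c (inord m).
have hC m : (m <= 10)%N -> [/\ rep (s (+) odd m) (C m) (Cl m), dot (C m) (B (m + 3)%N) = 1 & dot (C m) (B (m + 5)%N) = 1].
  by move=> hm; have := hc (inord m); rewrite inordK // => /(_ hm).
have sS m : s (+) odd m.+1 = ~~ (s (+) odd m) by rewrite /= addbN.
have hC1 m : (m < 10)%N -> dot (C m) (C m.+1) = 1.
  move=> hm; have [r0 e3 e5] := hC m (ltnW hm); have [r1 f3 f5] := hC m.+1 hm.
  have r6 := rB (m + 6)%N; have r3 := rB (m + 3)%N; rewrite sw /= in r6; rewrite sw /= in r3.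
  rewrite sS in r1; apply: (coherent_last (hH hm) r0 r1 r6 r3).
  - by move: f5; rewrite addSnnS.
  - by rewrite dotC (_ : m + 6 = m + 3 + 3)%N ?Badj // -addnA.
  - by rewrite dotC.
have hdet m : (1 < m < 10)%N -> det3 (C m) (B (m + 4)%N) (B (m + 6)%N) != 0.
  case: m => [//|[//|m]] /= hm; have m10 : (m.+2 <= 10)%N by lia.
  have m9 : (m.+1 <= 10)%N by lia.
  have [r2 e3 e5] := hC _ m10; have [r3 f3 f5] := hC m.+3 hm; have [r1 g3 g5] := hC m.+1 m9.
  have r6 := rB (m + 6)%N; have r8 := rB (m + 8)%N; have r35 := rB (m + 3)%N; have r5 := rB (m + 5)%N.
  rewrite sw /= in r6; rewrite sw /= in r8; rewrite sw /= in r35; rewrite sw /= in r5.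
  rewrite (addSnnS m.+1 4) (addSnnS m 5) (addSnnS m.+1 6) (addSnnS m 7).
  rewrite sS in r1; rewrite !sS negbK in r2; rewrite !sS negbK in r3.
  apply/eqP => /det3_eq0[|z [z0 zc z6 z8]].
    by have [+ _] := r6.
  have x0 : shift (C m.+3) 1 z != 0.
    apply/eqP => e; have : dot (shift (C m.+3) 1 z) (B (m + 6)%N) = 0 by rewrite e /dot !mul0r !addr0.
    rewrite dot_shiftl z6 mulr0 addr0; move: f3; rewrite (addSnnS m.+2) (addSnnS m.+1) (addSnnS m) => -> /eqP.
    by rewrite oner_eq0.
  have [L rL] := rep_ex (~~ (s (+) odd m)) x0.
  have x6 : dot (shift (C m.+3) 1 z) (B (m + 6)%N) = 1.
    rewrite dot_shiftl z6 mulr0 addr0; move: f3; rewrite (addSnnS m.+2) (addSnnS m.+1) (addSnnS m) //.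
  have x8 : dot (shift (C m.+3) 1 z) (B (m + 8)%N) = 1.
    rewrite dot_shiftl z8 mulr0 addr0; move: f5; rewrite (addSnnS m.+2) (addSnnS m.+1) (addSnnS m) //.
  have xc : dot (shift (C m.+3) 1 z) (C m.+2) = 1.
    by rewrite dot_shiftl zc mulr0 addr0 dotC hC1.
  have LE : L = Cl m.+3.
    have b36 : dot (B (m + 6)%N) (B (m + 3)%N) = 1.
      by rewrite dotC (_ : m + 6 = m + 3 + 3)%N ?Badj // -addnA.
    have b38 : dot (B (m + 3)%N) (B (m + 8)%N) = 1.
      by rewrite (_ : m + 8 = m + 3 + 5)%N ?B5 // -addnA.
    have b58 : dot (B (m + 8)%N) (B (m + 5)%N) = 1.
      by rewrite dotC (_ : m + 8 = m + 5 + 3)%N ?Badj // -addnA.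
    have c25 : dot (B (m + 5)%N) (C m.+2) = 1.
      by move: e3; rewrite dotC (addSnnS m.+1) (addSnnS m).
    have c16 : dot (B (m + 6)%N) (C m.+1) = 1.
      by move: g5; rewrite dotC (addSnnS m).
    have ones w0 w1 w2 w3 : dot w0 w1 = 1 -> dot w1 w2 = 1 -> dot w2 w3 = 1 ->
        dot w3 w0 = 1 -> @coherent_vectors K w0 w1 w2 w3.
      by move=> h1 h2 h3 h4; split; rewrite ?h1 ?h2 ?h3 ?h4 ?oner_eq0.
    have c12 := hC1 m.+1 m10.
    apply: hU; first by lia.
    - apply: (vectors_coherent_quad _ rL _ r35 _); last first.
      + by rewrite negbK; exact: r8.
      + by rewrite negbK; exact: r6.
      + by apply: ones; rewrite // dotC.
    - apply: (vectors_coherent_quad _ r2 rL r8 r5).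
      by apply: ones; rewrite // dotC.
    - apply: (vectors_coherent_quad _ r1 _ rL _); last first.
      + by rewrite negbK; exact: r6.
      + by rewrite negbK; exact: r2.
      + by apply: ones; rewrite // dotC.
  have [k xk] := rep_uniq r3 (eq_ind L (rep _ _) rL _ LE).
  have k1 : k = 1.
    move: x6; rewrite xk dotZl; move: f3; rewrite (addSnnS m.+2) (addSnnS m.+1) (addSnnS m) => ->.
    by rewrite mulr1.
  have [y yz] := exists_dot_neq0 z0.
  move/(congr1 (dot y)): xk; rewrite k1 dotZr mul1r (dotC y) dot_shiftl mul1r (dotC y).
  move/(canRL (addKr _)); rewrite addNr (dotC z) => yz0.
  by rewrite yz0 eqxx in yz.
have [e8 [e9 e10]] := octagon_closes Bper Badj (fun m hm => let: And3 _ h _ := hC m hm in h)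
  (fun m hm => let: And3 _ _ h := hC m hm in h) hC1 hdet.
have fin m : (m <= 2)%N -> C (m + 8)%N = C m -> Cl (m + 8) = Cl m.
  move=> hm e; have m10 : (m <= 10)%N by lia.
  have m18 : (m + 8 <= 10)%N by lia.
  have [r _ _] := hC _ m10; have [r' _ _] := hC _ m18.
  by move: r'; rewrite sw /= e => r'; exact: rep_fun r' r.
by split; [apply: (fin 0%N)|apply: (fin 1%N)|apply: (fin 2%N)].
Qed.
End OctagonLabels.

(** * The octagon as a zonotope *)
Section Det2.
Variable R : realType.
Implicit Types u w : 'rV[R]_2.
Lemma det2Dr u w w' : det2 u (w + w') = det2 u w + det2 u w'.
Proof. by rewrite /det2 !mxE; ring. Qed.
Lemma det2Zr u a w : det2 u (a *: w) = a * det2 u w.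
Proof. by rewrite /det2 !mxE; ring. Qed.
Lemma det2Nr u w : det2 u (- w) = - det2 u w.
Proof. by rewrite /det2 !mxE; ring. Qed.
Lemma det2Dl u u' w : det2 (u + u') w = det2 u w + det2 u' w.
Proof. by rewrite /det2 !mxE; ring. Qed.
Lemma det2Zl u a w : det2 (a *: u) w = a * det2 u w.
Proof. by rewrite /det2 !mxE; ring. Qed.
Lemma det2Nl u w : det2 (- u) w = - det2 u w.
Proof. by rewrite /det2 !mxE; ring. Qed.
Lemma det2C u w : det2 u w = - det2 w u.
Proof. by rewrite /det2; ring. Qed.
Lemma det2uu u : det2 u u = 0.
Proof. by rewrite /det2; ring. Qed.
Lemma det2_plucker (a b c d : 'rV[R]_2) :
  det2 a b * det2 c d + det2 a d * det2 b c = det2 a c * det2 b d.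
Proof. by rewrite /det2; ring. Qed.
Definition det2E := (det2Dr, det2Zr, det2Nr, det2Dl, det2Zl, det2Nl, det2uu).

Lemma plane_eq (u w : 'rV[R]_2) : u 0 0 = w 0 0 -> u 0 1 = w 0 1 -> u = w.
Proof.
move=> h0 h1; apply/rowP => -[[|[|//]] hi]; rewrite -/(nat_of_ord _).
  by have -> : Ordinal hi = 0 by apply/val_inj.
by have -> : Ordinal hi = 1 by apply/val_inj.
Qed.
End Det2.

Section Geometry.
Variable R : realType.
Variable q : 'Z_8 -> 'rV[R]_2.
Hypothesis hq : cs_convex_octagon q.
Local Open Scope classical_set_scope.

(** Corners and directions are locked: otherwise comparing two of them computes in
    the integers modulo 8. *)
Fact octagon_key : unit. Proof. exact: tt. Qed.
Definition corner (k : nat) : 'rV[R]_2 := locked_with octagon_key (q (k%:R)).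
Definition dir (i : nat) : 'rV[R]_2 := locked_with octagon_key (side q (inord i)).

Lemma cornerK k : corner k = q (k%:R).
Proof. by rewrite /corner unlock. Qed.

Lemma dir_side i : dir i = side q (inord i).
Proof. by rewrite /dir unlock. Qed.
Definition zpoint (s : nat -> R) : 'rV[R]_2 :=
  corner 0 + s 0%N *: dir 0 + s 1%N *: dir 1 + s 2%N *: dir 2 + s 3%N *: dir 3.

Lemma dirE (i : nat) : (i < 4)%N -> dir i = corner i.+1 - corner i.
Proof. by move=> hi; rewrite dir_side !cornerK /side inordK. Qed.

Lemma corner_opp k : corner (k + 4) = corner 0 + corner 4 - corner k.
Proof.
have [_ [c hc]] := hq; rewrite !cornerK natrD; apply: (addrI (q k%:R)).
by rewrite hc -(hc 0) add0r [RHS]addrC subrK.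
Qed.

Lemma corner_convex k l : (k < 8)%N -> (l < 8)%N -> l != k -> l != (k.+1 %% 8)%N ->
  0 < det2 (corner k.+1 - corner k) (corner l - corner k).
Proof.
move=> hk hl lk lk1; have [h _] := hq.
rewrite !cornerK -natr1; apply: h; apply/eqP => /(congr1 (@nat_of_ord _)).
  by rewrite !val_Zp_nat //= !modn_small // => e; rewrite e eqxx in lk.
rewrite natr1 !val_Zp_nat //= modn_small // => e.
by rewrite e eqxx in lk1.
Qed.

Lemma corner1 : corner 1 = corner 0 + dir 0.
Proof. by rewrite dirE // addrC subrK. Qed.
Lemma corner2 : corner 2 = corner 0 + dir 0 + dir 1.
Proof. by rewrite -corner1 dirE // addrC subrK. Qed.
Lemma corner3 : corner 3 = corner 0 + dir 0 + dir 1 + dir 2.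
Proof. by rewrite -corner2 dirE // addrC subrK. Qed.
Lemma corner4 : corner 4 = corner 0 + dir 0 + dir 1 + dir 2 + dir 3.
Proof. by rewrite -corner3 dirE // addrC subrK. Qed.
Lemma corner5 : corner 5 = corner 0 + dir 1 + dir 2 + dir 3.
Proof. by rewrite (corner_opp 1) corner4 corner1; apply: plane_eq; rewrite !mxE; ring. Qed.
Lemma corner6 : corner 6 = corner 0 + dir 2 + dir 3.
Proof. by rewrite (corner_opp 2) corner4 corner2; apply: plane_eq; rewrite !mxE; ring. Qed.
Lemma corner7 : corner 7 = corner 0 + dir 3.
Proof. by rewrite (corner_opp 3) corner4 corner3; apply: plane_eq; rewrite !mxE; ring. Qed.
Lemma corner8 : corner 8 = corner 0.
Proof. by rewrite (corner_opp 4) corner4; apply: plane_eq; rewrite !mxE; ring. Qed.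
(** Consecutive directions, and the first and the last, form positive determinants by
    convexity at one corner.  By the Pluecker relation the two remaining determinants
    have the same sign, and convexity bounds their absolute values by the others, so
    that they cannot both be negative. *)
Lemma dir_det_gt0 i j : (i < j < 4)%N -> 0 < det2 (dir i) (dir j).
Proof.
have conv k l w : (k < 4)%N -> (l < 8)%N -> l != k -> l != (k.+1 %% 8)%N ->
    corner l = corner k + w -> 0 < det2 (dir k) w.
  move=> hk hl lk lk1 e; have := @corner_convex k l (ltn_trans hk (isT : 4 < 8)%N) hl lk lk1.
  by rewrite -dirE // e addrC addKr.
have h02 := @conv 0 2 _ isT isT isT isT (etrans corner2 (esym (addrA _ _ _))).
have h13 : 0 < det2 (dir 1) (dir 1 + dir 2).
  by apply: (@conv 1 3) => //; rewrite corner1 corner3 !addrA.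
have h24 : 0 < det2 (dir 2) (dir 2 + dir 3).
  by apply: (@conv 2 4) => //; rewrite corner2 corner4 !addrA.
have h07 := @conv 0 7 _ isT isT isT isT corner7.
have h03 : 0 < det2 (dir 0) (dir 0 + dir 1 + dir 2).
  by apply: (@conv 0 3) => //; rewrite corner3 !addrA.
have h31 : 0 < det2 (dir 3) (- (dir 1 + dir 2)).
  by apply: (@conv 3 1) => //; rewrite corner1 corner3 -(addrA _ (dir 1) (dir 2)) addrK.
rewrite !det2E add0r in h02; rewrite !det2E add0r in h13; rewrite !det2E add0r in h24.
rewrite !det2E add0r in h03; rewrite !det2E opprD -!(det2C _ (dir 3)) in h31.
(* Only the determinants of the directions 0, 2 and 1, 3 are still unknown. *)
have pl : det2 (dir 0) (dir 1) * det2 (dir 2) (dir 3) + det2 (dir 0) (dir 3) * det2 (dir 1) (dir 2)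
   = det2 (dir 0) (dir 2) * det2 (dir 1) (dir 3) by apply: det2_plucker.

suff [d02 d13] : 0 < det2 (dir 0) (dir 2) /\ 0 < det2 (dir 1) (dir 3).
  move=> /andP[ij j4]; move: j4 ij.
  by case: j => [|[|[|[|//]]]] _; case: i => [|[|[|[|//]]]] // _.
move: h02 h13 h24 h07 h03 h31 pl {conv}.
move: (det2 (dir 0) (dir 1)) (det2 (dir 1) (dir 2)) (det2 (dir 2) (dir 3))
  (det2 (dir 0) (dir 3)) (det2 (dir 0) (dir 2)) (det2 (dir 1) (dir 3)).
clear=> a b c d e f a0 b0 c0 d0 ae fc pl.
have e0 : 0 < e by nra.
split=> //; nra.
Qed.


Lemma zpoint_ext s s' : (forall i, (i < 4)%N -> s i = s' i) -> zpoint s = zpoint s'.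
Proof. by move=> h; rewrite /zpoint !h. Qed.

Lemma zpointB s s' : zpoint s - zpoint s' = (s 0%N - s' 0%N) *: dir 0 +
  (s 1%N - s' 1%N) *: dir 1 + (s 2%N - s' 2%N) *: dir 2 + (s 3%N - s' 3%N) *: dir 3.
Proof. by rewrite /zpoint; apply: plane_eq; rewrite !mxE; ring. Qed.

Lemma zpoint_add s i a : (i < 4)%N ->
  zpoint s + a *: dir i = zpoint (fun j => s j + (if j == i then a else 0)).
Proof.
case: i => [|[|[|[|//]]]] _; rewrite /zpoint /= ?addr0 scalerDl;
by apply: plane_eq; rewrite !mxE; ring.
Qed.

(** The corners run through the initial and then the final segments of the sides. *)
Definition corner_coord (k i : nat) : R := ((if k <= 4 then i < k else k - 4 <= i)%N)%:R.

Lemma corner_zpoint k : (k <= 8)%N -> corner k = zpoint (corner_coord k).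
Proof.
rewrite /zpoint /corner_coord.
case: k => [|[|[|[|[|[|[|[|[|//]]]]]]]]] _ /=; rewrite ?scale1r ?scale0r ?addr0 //.
- exact: corner1.
- exact: corner2.
- exact: corner3.
- exact: corner4.
- exact: corner5.
- exact: corner6.
- exact: corner7.
- exact: corner8.
Qed.

Lemma zpoint_sum (w : 'Z_8 -> R) (c : 'Z_8 -> nat -> R) : \sum_k w k = 1 ->
  \sum_k w k *: zpoint (c k) = zpoint (fun i => \sum_k w k * c k i).
Proof.
move=> hw; rewrite /zpoint.
under eq_bigr do rewrite !scalerDr !scalerA.
by rewrite !big_split /= -!scaler_suml hw scale1r.
Qed.

Lemma octagon_zpoint p : octagon_region q p ->
  exists2 s : nat -> R, (forall i, 0 <= s i <= 1) & p = zpoint s.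
Proof.
case=> w [w0 w1] ->.
have e k : q k = zpoint (corner_coord k).
  rewrite -corner_zpoint ?cornerK ?natr_Zp //.
  exact: ltnW (ltn_ord k).
exists (fun i => \sum_k w k * corner_coord k i).
  move=> i; apply/andP; split.
    by apply: sumr_ge0 => k _; rewrite mulr_ge0 // ler0n.
  rewrite -w1; apply: ler_sum => k _; apply: ler_piMr => //.
  by rewrite /corner_coord lern1 leq_b1.
under eq_bigr do rewrite e.
exact: zpoint_sum.
Qed.

Lemma edge_dir k : (k < 8)%N ->
  corner k.+1 - corner k = if (k < 4)%N then dir k else - dir (k - 4).
Proof.
move=> hk; case: ifP => h4; first by rewrite dirE.
rewrite dirE; last by lia.
rewrite [in LHS](_ : k.+1 = (k - 4).+1 + 4)%N; last by lia.
rewrite [in X in _ - X](_ : k = (k - 4) + 4)%N; last by lia.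
rewrite !(corner_opp); apply: plane_eq; rewrite !mxE; ring.
Qed.

Lemma zpoint_left s k : (forall i, 0 <= s i <= 1) -> (k < 8)%N ->
  0 <= det2 (corner k.+1 - corner k) (zpoint s - corner k).
Proof.
move=> hs hk; rewrite edge_dir // (corner_zpoint (ltnW hk)) zpointB.
have D i j : (i < j < 4)%N -> 0 < det2 (dir i) (dir j) by apply: dir_det_gt0.
have a10 := det2C (dir 1) (dir 0); have a20 := det2C (dir 2) (dir 0).
have a21 := det2C (dir 2) (dir 1); have a30 := det2C (dir 3) (dir 0).
have a31 := det2C (dir 3) (dir 1); have a32 := det2C (dir 3) (dir 2).
have d01 := D 0 1 isT; have d02 := D 0 2 isT; have d03 := D 0 3 isT.
have d12 := D 1 2 isT; have d13 := D 1 3 isT; have d23 := D 2 3 isT.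
have /andP[s00 s01] := hs 0%N; have /andP[s10 s11] := hs 1%N.
have /andP[s20 s21] := hs 2%N; have /andP[s30 s31] := hs 3%N.
suff main (e01 e02 e03 e12 e13 e23 x y z t : R) : 0 < e01 -> 0 < e02 -> 0 < e03 ->
    0 < e12 -> 0 < e13 -> 0 < e23 -> 0 <= x <= 1 -> 0 <= y <= 1 -> 0 <= z <= 1 -> 0 <= t <= 1 ->
    [/\ 0 <= y * e01 + z * e02 + t * e03, 0 <= (1 - x) * e01 + z * e12 + t * e13,
     0 <= (1 - x) * e02 + (1 - y) * e12 + t * e23 & 0 <= (1 - x) * e03 + (1 - y) * e13 + (1 - z) * e23].
  have m s' : (forall i, 0 <= s' i <= 1) -> _ :=
    fun hs' => main _ _ _ _ _ _ _ _ _ _ d01 d02 d03 d12 d13 d23 (hs' 0%N) (hs' 1%N) (hs' 2%N) (hs' 3%N).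
  have [m0 m1 m2 m3] := m s hs.
  have hs' i : 0 <= 1 - s i <= 1 by have := hs i; lra.
  have [n0 n1 n2 n3] := m (fun i => 1 - s i) hs'.
  case: k hk => [|[|[|[|[|[|[|[|//]]]]]]]] _; rewrite /corner_coord /= !det2E ?(a10, a20, a21, a30, a31, a32).
  - by apply: le_trans m0 _; rewrite le_eqVlt; apply/orP; left; apply/eqP; ring.
  - by apply: le_trans m1 _; rewrite le_eqVlt; apply/orP; left; apply/eqP; ring.
  - by apply: le_trans m2 _; rewrite le_eqVlt; apply/orP; left; apply/eqP; ring.
  - by apply: le_trans m3 _; rewrite le_eqVlt; apply/orP; left; apply/eqP; ring.
  - by apply: le_trans n0 _; rewrite le_eqVlt; apply/orP; left; apply/eqP; ring.
  - by apply: le_trans n1 _; rewrite le_eqVlt; apply/orP; left; apply/eqP; ring.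
  - by apply: le_trans n2 _; rewrite le_eqVlt; apply/orP; left; apply/eqP; ring.
  - by apply: le_trans n3 _; rewrite le_eqVlt; apply/orP; left; apply/eqP; ring.
move=> h1 h2 h3 h4 h5 h6 /andP[x0 x1] /andP[y0 y1] /andP[z0 z1] /andP[t0 t1].
by split; rewrite !addr_ge0 // mulr_ge0 ?subr_ge0 // ltW.
Qed.

(** Barycentric coordinates in the triangle of the corners 0, k and k+1. *)
Lemma triangle_octagon k p : (0 < k < 7)%N ->
  0 <= det2 (corner k - corner 0) (p - corner 0) ->
  det2 (corner k.+1 - corner 0) (p - corner 0) <= 0 ->
  0 <= det2 (corner k.+1 - corner k) (p - corner k) -> octagon_region q p.
Proof.
move=> /andP[k0 k7] h1 h2 h3.
have k8 : (k < 8)%N by lia.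
have D0 : 0 < det2 (corner k.+1 - corner k) (corner 0 - corner k).
  apply: corner_convex => //; first by rewrite eq_sym -lt0n.
  by rewrite modn_small.
set D := det2 _ _ in D0.
pose a := - det2 (corner k.+1 - corner 0) (p - corner 0) / D.
pose b := det2 (corner k - corner 0) (p - corner 0) / D.
have a0 : 0 <= a by rewrite divr_ge0 ?oppr_ge0 // ltW.
have b0 : 0 <= b by rewrite divr_ge0 // ltW.
have Dn0 : D != 0 by rewrite gt_eqF.
have cE : 1 - a - b = det2 (corner k.+1 - corner k) (p - corner k) / D.
  apply: (mulIf Dn0); rewrite divfK // !mulrBl /a /b !divfK // mul1r /D /det2 !mxE.
  by ring.
have c0 : 0 <= 1 - a - b by rewrite cE divr_ge0 // ltW.
have pE : p = (1 - a - b) *: corner 0 + a *: corner k + b *: corner k.+1.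
  by apply: plane_eq; rewrite !mxE /a /b; apply: (mulfI Dn0); rewrite /D;
     move: Dn0; rewrite /D /det2 !mxE => Dn0; field.
clearbody a b.
pose w (j : 'Z_8) : R := (j == 0)%:R * (1 - a - b) + (j == k%:R)%:R * a + (j == k.+1%:R)%:R * b.
have pick (x : 'Z_8) (V : lmodType R) (F : 'Z_8 -> V) : \sum_j (j == x)%:R *: F j = F x.
  rewrite (bigD1 x) //= eqxx scale1r big1 ?addr0 // => j /negbTE ->.
  by rewrite scale0r.
exists w; first split.
- by move=> j; rewrite /w !addr_ge0 // mulr_ge0 // ler0n.
- rewrite /w !big_split /= (pick 0 R^o (fun _ => 1 - a - b)) (pick k%:R R^o (fun _ => a)) (pick k.+1%:R R^o (fun _ => b)).
  by ring.
under eq_bigr do rewrite /w !scalerDl -!scalerA.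
by rewrite !big_split /= !pick pE !cornerK.
Qed.

(** The point is on the left of every side, and the diagonals from the first corner
    cut the octagon into triangles, one of which contains it. *)
Lemma zpoint_octagon s : (forall i, 0 <= s i <= 1) -> octagon_region q (zpoint s).
Proof.
move=> hs; set p := zpoint s.
pose g k := det2 (corner k - corner 0) (p - corner 0).
have g1 : 0 <= g 1%N by apply: (zpoint_left hs (k := 0)).
have g7 : g 7%N <= 0.
  have := zpoint_left hs (isT : 7 < 8)%N; rewrite (corner8) -/p /g.
  rewrite -oppr_ge0; congr (0 <= _); by rewrite /det2 !mxE; ring.
suff [k hk /andP[gk gk1]] : exists2 k, (0 < k < 7)%N & (0 <= g k) && (g k.+1 <= 0).
  apply: (triangle_octagon hk gk gk1); apply: zpoint_left => //.
  by case/andP: hk => _ /ltnW.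
have [h2|/ltW h2] := leP (g 2%N) 0; first by exists 1%N => //; rewrite g1.
have [h3|/ltW h3] := leP (g 3%N) 0; first by exists 2%N => //; rewrite h2.
have [h4|/ltW h4] := leP (g 4%N) 0; first by exists 3%N => //; rewrite h3.
have [h5|/ltW h5] := leP (g 5%N) 0; first by exists 4%N => //; rewrite h4.
have [h6|/ltW h6] := leP (g 6%N) 0; first by exists 5%N => //; rewrite h5.
by exists 6%N => //; rewrite h6.
Qed.


Lemma side_dir (i : 'I_4) : side q i = dir i.
Proof. by rewrite dir_side inord_val. Qed.

(** * Vertices and tiles from subsets *)
Definition pt (c : code) : 'rV[R]_2 := zpoint (fun i => (has_dir c i)%:R).
Definition realt (t : ctile) : tile R := (pt t.1, (inord t.2.1, inord t.2.2)).
Definition is_tiling (k : nat) (T : {fset tile R}) : Prop :=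
  forall t, t \in T <-> exists2 c, c \in ctiles k & t = realt c.

Lemma has_add_dir c i j : (i < 4)%N -> (j < 4)%N ->
  has_dir (add_dir c i) j = has_dir c j || (j == i).
Proof.
by case: i j => [|[|[|[|//]]]] [|[|[|[|//]]]] _ _; rewrite /add_dir /= ?orbF ?orbT.
Qed.

Lemma pt_add c i : (i < 4)%N -> ~~ has_dir c i -> pt (add_dir c i) = pt c + dir i.
Proof.
move=> hi nc; rewrite -[dir i]scale1r /pt zpoint_add //; apply: zpoint_ext => j hj.
rewrite has_add_dir //; case: eqP => [->|_]; last by rewrite orbF addr0.
by rewrite orbT (negbTE nc) add0r.
Qed.

Lemma det_neq0 (i j : nat) : (i < 4)%N -> (j < 4)%N -> i != j -> det2 (dir i) (dir j) != 0.
Proof.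
move=> hi hj; rewrite neq_ltn => /orP[] h; last rewrite det2C oppr_eq0.
  by rewrite gt_eqF // dir_det_gt0 ?h.
by rewrite gt_eqF // dir_det_gt0 ?h.
Qed.

Lemma dir_inj (i j : nat) : (i < 4)%N -> (j < 4)%N -> dir i = dir j -> i = j.
Proof.
move=> hi hj e; apply/eqP; apply: contraT => /(det_neq0 hi hj).
by rewrite e det2uu eqxx.
Qed.

(** The line in question runs between the directions m-1 and m. *)
Lemma separating m : (m <= 4)%N -> exists u : 'rV[R]_2, forall i, (i < 4)%N ->
  if (m <= i)%N then 0 < det2 u (dir i) else det2 u (dir i) < 0.
Proof.
have D i j : (i < j < 4)%N -> 0 < det2 (dir i) (dir j) by apply: dir_det_gt0.
have a10 := det2C (dir 1) (dir 0); have a20 := det2C (dir 2) (dir 0).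
have a21 := det2C (dir 2) (dir 1); have a30 := det2C (dir 3) (dir 0).
have a31 := det2C (dir 3) (dir 1); have a32 := det2C (dir 3) (dir 2).
have := D 0 1 isT; have := D 0 2 isT; have := D 0 3 isT.
have := D 1 2 isT; have := D 1 3 isT; have := D 2 3 isT.
move=> d23 d13 d12 d03 d02 d01.
pose u m : 'rV[R]_2 := nth 0 [:: dir 0 - dir 3; dir 0 + dir 1; dir 1 + dir 2; dir 2 + dir 3; dir 3 - dir 0] m.
move=> hm; exists (u m) => i hi.
case: m hm => [|[|[|[|[|//]]]]] _; case: i hi => [|[|[|[|//]]]] _ /=;
  rewrite !det2E ?(a10, a20, a21, a30, a31, a32);
  move: d23 d13 d12 d03 d02 d01; clear;
  move: (det2 (dir 0) (dir 1)) (det2 (dir 1) (dir 2)) (det2 (dir 2) (dir 3))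
    (det2 (dir 0) (dir 3)) (det2 (dir 0) (dir 2)) (det2 (dir 1) (dir 3)) => *; lra.
Qed.

Lemma det2_zpointB u s s' : det2 u (zpoint s - zpoint s') =
  \sum_(i < 4) (s i - s' i) * det2 u (dir i).
Proof. by rewrite zpointB !det2E !big_ord_recr big_ord0 /= add0r. Qed.

(** A linear form with different signs on the two differences of the subsets. *)
Lemma pt_neq c c' : c != c' -> code_lt c c' || code_lt c' c -> pt c != pt c'.
Proof.
wlog lt_cc : c c' / code_lt c c'.
  by move=> h ne /orP[] l; [|rewrite eq_sym]; apply: h; rewrite ?l // eq_sym.
move=> ne _; case/hasP: lt_cc => m; rewrite mem_iota => hm /allP sep.
have [u hu] := separating (hm : (m <= 4)%N).
have sepi i : (i < 4)%N -> (has_dir c i && ~~ has_dir c' i ==> (i < m)%N) &&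
    (has_dir c' i && ~~ has_dir c i ==> (m <= i)%N).
  by move=> hi; apply: sep; rewrite mem_iota.
have le0 i : (i < 4)%N -> ((has_dir c i)%:R - (has_dir c' i)%:R) * det2 u (dir i) <= 0.
  move=> hi; have := hu i hi; have := sepi i hi.
  case: (has_dir c i); case: (has_dir c' i) => /=; rewrite ?subrr ?mul0r ?andbT //.
    by move=> im; rewrite leqNgt im /= subr0 mul1r => /ltW.
  by move=> -> ; rewrite sub0r mulN1r oppr_le0 => /ltW.
apply/eqP => e; have := det2_zpointB u (fun i => (has_dir c i)%:R) (fun i => (has_dir c' i)%:R).
rewrite -/(pt c) -/(pt c') e subrr => /esym.
have -> : det2 u 0 = 0 by rewrite /det2 !mxE; ring.
move/eqP; rewrite -oppr_eq0 -sumrN psumr_eq0; last by move=> i _; rewrite oppr_ge0 le0.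
move/allP => z0; case/eqP: ne.
have same i : (i < 4)%N -> has_dir c i = has_dir c' i.
  move=> hi; have := z0 (Ordinal hi) (mem_index_enum _); rewrite /= oppr_eq0 mulf_eq0.
  have -> : det2 u (dir i) == 0 = false.
    by have := hu i hi; case: ifP => _ h; [rewrite gt_eqF | rewrite lt_eqF].
  by rewrite orbF subr_eq0 eqr_nat; case: (has_dir c i); case: (has_dir c' i).
have := same 0%N isT; have := same 1%N isT; have := same 2%N isT; have := same 3%N isT.
by case: c {le0 sepi sep e z0 same} => [[[a b] d] f]; case: c' => [[[a' b'] d'] f'] /= -> -> -> ->.
Qed.

Lemma pt_inj k c c' : (k < 8)%N -> c \in vertices k -> c' \in vertices k ->
  pt c = pt c' -> c = c'.
Proof.
move=> hk hc hc' e; apply/eqP; apply: contraT => ne.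
have := check_separatedP => /allP/(_ k); rewrite mem_iota => /(_ hk)/allP/(_ c hc)/allP/(_ c' hc').
by rewrite (negbTE ne) /= => /(pt_neq ne); rewrite e eqxx.
Qed.

Section Interior.

Implicit Types t : tile R.

Lemma coord_uniq (v w : 'rV[R]_2) a b a' b' : det2 v w != 0 ->
  a *: v + b *: w = a' *: v + b' *: w -> a = a' /\ b = b'.
Proof.
move=> d e; have h1 := congr1 (det2 v) e; have h2 := congr1 (det2 w) e.
rewrite !det2E !mulr0 !add0r in h1; rewrite !det2E !mulr0 !addr0 in h2.
by split; [apply: (mulIf _ h2); rewrite det2C oppr_eq0 | exact: (mulIf d h1)].
Qed.

(** Coordinates in a tile, not restricted to the interval [0, 1]. *)
Definition in_tile (t : tile R) (s1 s2 : R) : 'rV[R]_2 :=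
  t.1 + s1 *: dir t.2.1 + s2 *: dir t.2.2.

Lemma tile_regionE t p : tile_region q t p <->
  exists s1 s2, [/\ 0 <= s1 <= 1, 0 <= s2 <= 1 & p = in_tile t s1 s2].
Proof. by rewrite /tile_region /in_tile /= !side_dir. Qed.

Lemma in_tile_uniq t s1 s2 s1' s2' : (t.2.1 < t.2.2)%N ->
  in_tile t s1 s2 = in_tile t s1' s2' -> s1 = s1' /\ s2 = s2'.
Proof.
move=> ht; rewrite /in_tile -!addrA => /addrI; apply: coord_uniq.
by apply: (det_neq0) => //; rewrite neq_ltn ht.
Qed.

Lemma vertex_coord t a : a \in tile_vertices q t ->
  exists s1 s2 : R, [/\ s1 = 0 \/ s1 = 1, s2 = 0 \/ s2 = 1 & a = in_tile t s1 s2].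
Proof.
rewrite /tile_vertices !inE !side_dir /in_tile => /or4P[] /eqP ->.
- by exists 0, 0; split; auto; rewrite !scale0r !addr0.
- by exists 1, 0; split; auto; rewrite scale0r addr0 scale1r.
- by exists 1, 1; split; auto; rewrite !scale1r.
- by exists 0, 1; split; auto; rewrite scale0r addr0 scale1r.
Qed.

(** On an edge one of the two coordinates is constant. *)
Lemma edge_coord t e p : e \in tile_edges q t -> segment e.1 e.2 p ->
  exists s1 s2 : R, p = in_tile t s1 s2 /\
   [\/ s1 = 0 /\ e = (t.1, t.1 + dir t.2.2),
       s1 = 1 /\ e = (t.1 + dir t.2.1, t.1 + dir t.2.1 + dir t.2.2),
       s2 = 0 /\ e = (t.1, t.1 + dir t.2.1)
     | s2 = 1 /\ e = (t.1 + dir t.2.2, t.1 + dir t.2.1 + dir t.2.2)].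
Proof.
rewrite /tile_edges !inE !side_dir /in_tile => /or4P[] /eqP -> [s _ ->] /=.
- exists s, 0; split; last by apply: Or43.
  by apply: plane_eq; rewrite !mxE; ring.
- exists 0, s; split; last by apply: Or41.
  by apply: plane_eq; rewrite !mxE; ring.
- exists 1, s; split; last by apply: Or42.
  by apply: plane_eq; rewrite !mxE; ring.
- exists s, 1; split; last by apply: Or44.
  by apply: plane_eq; rewrite !mxE; ring.
Qed.

(** Two different tiles meet in a vertex or in an edge of each, which contain no
    interior point. *)
Lemma interior_uniq (T : {fset tile R}) t t' s1 s2 : zonotopal_tiling q T -> t \in T -> t' \in T ->
  0 < s1 < 1 -> 0 < s2 < 1 -> tile_region q t' (in_tile t s1 s2) -> t = t'.
Proof.
move=> [hlt _ hff] tT t'T /andP[s10 s11] /andP[s20 s21] ht'.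
apply/eqP; apply: contraT => ne; have lt := hlt t tT.
have pI : (tile_region q t `&` tile_region q t') (in_tile t s1 s2).
  split=> //; apply/tile_regionE; exists s1, s2; split=> //; apply/andP; split; exact: ltW.
case: (hff t t' tT t'T ne); first by move=> h; rewrite h in pI.
- move=> [a [at_ _ h]]; rewrite h in pI.
  have [r1 [r2 [h1 h2 e]]] := vertex_coord at_.
  have [e1 e2] : s1 = r1 /\ s2 = r2 by apply: (in_tile_uniq lt); rewrite -e.
  by subst; case: h1 => e; rewrite e ltxx in s10 s11.
move=> [e [et _ h]]; rewrite h in pI.
have [r1 [r2 [pE h12]]] := edge_coord et pI.
have [e1 e2] := in_tile_uniq lt pE; subst.
by case: h12 => -[e0 _]; rewrite e0 ltxx in s10 s11 s20 s21.
Qed.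

Definition in_ctile (c : code) (i j : nat) (p : 'rV[R]_2) : Prop :=
  exists s : nat -> R, [/\ forall m, 0 <= s m <= 1,
    forall m, (m < 4)%N -> m != i -> m != j -> s m = (has_dir c m)%:R & p = zpoint s].

Lemma region_ctile c i j p : (i < j < 4)%N -> ~~ has_dir c i -> ~~ has_dir c j ->
  tile_region q (realt (c, (i, j))) p <-> in_ctile c i j p.
Proof.
move=> /andP[ij j4] ci cj; have i4 := ltn_trans ij j4.
have key a b : in_tile (realt (c, (i, j))) a b =
    zpoint (fun m => (has_dir c m)%:R + (if m == i then a else 0) + (if m == j then b else 0)).
  by rewrite /in_tile /realt /= !inordK // /pt !zpoint_add.
rewrite tile_regionE; split=> [[a [b [ha hb ->]]]|[s [s01 hs ->]]].
  rewrite key; eexists; split; last by [].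
  - move=> m /=; have [->|mi] := eqVneq m i.
      by rewrite (ltn_eqF ij) (negbTE ci) add0r addr0.
    have [->|mj] := eqVneq m j; first by rewrite (negbTE cj) addr0 add0r.
    by rewrite !addr0; case: (has_dir c m); rewrite ?ler01 ?lexx.
  - by move=> m m4 /negbTE -> /negbTE ->; rewrite !addr0.
exists (s i), (s j); split=> //; rewrite key; apply: zpoint_ext => m m4.
have [->|mi] := eqVneq m i; first by rewrite (ltn_eqF ij) (negbTE ci) add0r addr0.
have [->|mj] := eqVneq m j; first by rewrite (negbTE cj) addr0 add0r.
by rewrite !addr0 hs.
Qed.
End Interior.

(** * The tabulated tilings cover the octagon *)
Local Notation unit_cube := (fun s : nat -> R => forall m, 0 <= s m <= 1).

(** The middle direction is a positive combination of the other two.  Subtract this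
    relation from the coordinates until one of them reaches the boundary. *)
Lemma lower_hexagon (i j l : nat) s : (i < j)%N -> (j < l)%N -> (l < 4)%N -> unit_cube s ->
  exists s', [/\ unit_cube s', forall m, m != i -> m != j -> m != l -> s' m = s m,
    zpoint s' = zpoint s & [\/ s' i = 0, s' l = 0 | s' j = 1]].
Proof.
move=> ij jl l4 hs; have il := ltn_trans ij jl.
have j4 := ltn_trans jl l4; have i4 := ltn_trans ij j4.
have dij := dir_det_gt0 (introT andP (conj ij j4)).
have djl := dir_det_gt0 (introT andP (conj jl l4)).
have dil := dir_det_gt0 (introT andP (conj il l4)).
set a := det2 (dir j) (dir l) in djl; set b := det2 (dir i) (dir j) in dij.
set d := det2 (dir i) (dir l) in dil.
have rel : d *: dir j = a *: dir i + b *: dir l.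
  by apply: plane_eq; rewrite !mxE /a /b /d /det2; ring.
have [t [t0 hi hl hj hc]] : exists t, [/\ 0 <= t, t * a <= s i, t * b <= s l, t * d <= 1 - s j &
    [\/ t * a = s i, t * b = s l | t * d = 1 - s j]].
  have /andP[si _] := hs i; have /andP[sl _] := hs l; have /andP[_ sj] := hs j.
  have k (x y : R) : 0 < y -> x / y * y = x by move=> y0; rewrite divfK // gt_eqF.
  have pos (x y : R) : 0 <= x -> 0 < y -> 0 <= x / y by move=> x0 /ltW; apply: divr_ge0.
  have sj' : 0 <= 1 - s j by rewrite subr_ge0.
  have le (x y z : R) : 0 < z -> x <= y / z -> x * z <= y by move=> z0; rewrite ler_pdivlMr.
  have [h1|/ltW h1] := leP (s i / a) (s l / b).
    have [h2|/ltW h2] := leP (s i / a) ((1 - s j) / d).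
      exists (s i / a); split; [exact: pos|by rewrite k|exact: le|exact: le|].
      by apply: Or31; rewrite k.
    exists ((1 - s j) / d); split; [exact: pos|exact: le| |by rewrite k|].
      by apply: le => //; apply: le_trans h1.
    by apply: Or33; rewrite k.
  have [h2|/ltW h2] := leP (s l / b) ((1 - s j) / d).
    exists (s l / b); split; [exact: pos|exact: le|by rewrite k|exact: le|].
    by apply: Or32; rewrite k.
  exists ((1 - s j) / d); split; [exact: pos| |exact: le|by rewrite k|].
    by apply: le => //; apply: le_trans h1.
  by apply: Or33; rewrite k.
pose s' m := s m + (if m == i then - (t * a) else 0) + (if m == j then t * d else 0)
  + (if m == l then - (t * b) else 0).
have neq x y : (x < y)%N -> (x == y = false) * (y == x = false).
  by move=> h; rewrite (ltn_eqF h) eq_sym (ltn_eqF h).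
have s'i : s' i = s i - t * a by rewrite /s' eqxx !(neq _ _ ij) !(neq _ _ il) !addr0.
have s'j : s' j = s j + t * d by rewrite /s' eqxx !(neq _ _ ij) !(neq _ _ jl) !addr0.
have s'l : s' l = s l - t * b by rewrite /s' eqxx !(neq _ _ il) !(neq _ _ jl) !addr0.
have s'm m : m != i -> m != j -> m != l -> s' m = s m.
  by move=> /negbTE h1 /negbTE h2 /negbTE h3; rewrite /s' h1 h2 h3 !addr0.
have pos (x y : R) : 0 <= x -> 0 < y -> 0 <= x * y by move=> x0 /ltW; apply: mulr_ge0.
have ta := pos _ _ t0 djl; have tb := pos _ _ t0 dij; have td := pos _ _ t0 dil.
exists s'; split=> //.
- move=> m; have /andP[m0 m1] := hs m.
  have [->|mi] := eqVneq m i.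
    by rewrite s'i subr_ge0 hi /= (le_trans (_ : _ <= s i)) ?gerBl //; have /andP[] := hs i.
  have [->|mj] := eqVneq m j.
    have /andP[j0 j1] := hs j; rewrite s'j addr_ge0 //=.
    by rewrite addrC -lerBrDr.
  have [->|ml] := eqVneq m l.
    by rewrite s'l subr_ge0 hl /= (le_trans (_ : _ <= s l)) ?gerBl //; have /andP[] := hs l.
  by rewrite s'm // m0.
- rewrite -zpoint_add // -zpoint_add // -zpoint_add //.
  have -> : (t * d) *: dir j = (t * a) *: dir i + (t * b) *: dir l.
    by rewrite -!scalerA rel scalerDr !scalerA.
  by apply: plane_eq; rewrite !mxE; ring.
rewrite s'i s'j s'l; case: hc => ->; rewrite ?subrr.
- exact: Or31.
- exact: Or32.
- by apply: Or33; rewrite addrC subrK.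
Qed.

(** The previous lemma after a point reflection. *)
Lemma upper_hexagon (i j l : nat) s : (i < j)%N -> (j < l)%N -> (l < 4)%N -> unit_cube s ->
  exists s', [/\ unit_cube s', forall m, m != i -> m != j -> m != l -> s' m = s m,
    zpoint s' = zpoint s & [\/ s' i = 1, s' l = 1 | s' j = 0]].
Proof.
move=> ij jl l4 hs.
have flip s0 : unit_cube s0 -> unit_cube (fun m => 1 - s0 m).
  by move=> h m; have := h m; rewrite subr_ge0 gerBl andbC.
have [s' [s01 hm e h]] := lower_hexagon ij jl l4 (flip _ hs).
exists (fun m => 1 - s' m); split; first exact: flip.
- by move=> m h1 h2 h3; rewrite hm // subKr.
- apply: subr0_eq; rewrite zpointB.
  have := zpointB (fun m => 1 - s m) s'; rewrite e subrr => /esym e'.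
  by rewrite -[RHS]e'; do !congr (_ + _); congr (_ *: _); ring.
case: h => ->; rewrite ?subr0 ?subrr; [exact: Or31|exact: Or32|exact: Or33].
Qed.

Definition covers (ts : seq ctile) (p : 'rV[R]_2) : Prop :=
  exists c i j, (c, (i, j)) \in ts /\ in_ctile c i j p.

Section Hexagon.
Variables (c : code) (i j l : nat) (s : nat -> R).
Hypotheses (ij : (i < j)%N) (jl : (j < l)%N) (l4 : (l < 4)%N).
Hypotheses (ci : ~~ has_dir c i) (cj : ~~ has_dir c j) (cl : ~~ has_dir c l).
Hypothesis hs : unit_cube s.
Hypothesis hc : forall m, (m < 4)%N -> m != i -> m != j -> m != l -> s m = (has_dir c m)%:R.

Let j4 := ltn_trans jl l4.
Let i4 := ltn_trans ij j4.

Lemma half1_covers : covers (half1 c i j l) (zpoint s).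
Proof.
have [s' [s01 hm <- h]] := lower_hexagon ij jl l4 hs.
have hm' m : (m < 4)%N -> m != i -> m != j -> m != l -> s' m = (has_dir c m)%:R.
  by move=> *; rewrite hm // hc.
case: h => h.
- exists c, j, l; split; first by rewrite !inE eqxx ?orbT.
  exists s'; split=> // m m4 mj ml; have [->|mi] := eqVneq m i; last exact: hm'.
  by rewrite h (negbTE ci).
- exists c, i, j; split; first by rewrite !inE eqxx ?orbT.
  exists s'; split=> // m m4 mi mj; have [->|ml] := eqVneq m l; last exact: hm'.
  by rewrite h (negbTE cl).
exists (add_dir c j), i, l; split; first by rewrite !inE eqxx ?orbT.
exists s'; split=> // m m4 mi ml; rewrite has_add_dir //.
by have [->|mj] := eqVneq m j; [rewrite orbT | rewrite orbF; exact: hm'].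
Qed.

Lemma half2_covers : covers (half2 c i j l) (zpoint s).
Proof.
have [s' [s01 hm <- h]] := upper_hexagon ij jl l4 hs.
have hm' m : (m < 4)%N -> m != i -> m != j -> m != l -> s' m = (has_dir c m)%:R.
  by move=> *; rewrite hm // hc.
case: h => h.
- exists (add_dir c i), j, l; split; first by rewrite !inE eqxx ?orbT.
  exists s'; split=> // m m4 mj ml; rewrite has_add_dir //.
  by have [->|mi] := eqVneq m i; [rewrite orbT | rewrite orbF; exact: hm'].
- exists (add_dir c l), i, j; split; first by rewrite !inE eqxx ?orbT.
  exists s'; split=> // m m4 mi mj; rewrite has_add_dir //.
  by have [->|ml] := eqVneq m l; [rewrite orbT | rewrite orbF; exact: hm'].
exists c, i, l; split; first by rewrite !inE eqxx ?orbT.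
exists s'; split=> // m m4 mi ml; have [->|mj] := eqVneq m j; last exact: hm'.
by rewrite h (negbTE cj).
Qed.
End Hexagon.

Lemma in_half (c : code) (i j l : nat) t p : (i < j)%N -> (j < l)%N -> (l < 4)%N ->
  t \in half1 c i j l ++ half2 c i j l -> in_ctile t.1 t.2.1 t.2.2 p ->
  exists s, [/\ unit_cube s,
    forall m, (m < 4)%N -> m != i -> m != j -> m != l -> s m = (has_dir c m)%:R & p = zpoint s].
Proof.
move=> ij jl l4 ht [s [s01 hm ->]]; exists s; split=> // m m4 mi mj ml.
have j4 := ltn_trans jl l4; have i4 := ltn_trans ij j4.
have e x : (x < 4)%N -> m != x -> has_dir (add_dir c x) m = has_dir c m.
  by move=> x4 /negbTE mx; rewrite has_add_dir // mx orbF.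
move: hm; move: ht; rewrite !inE => /or4P[||| /or3P[]] /eqP -> /= -> //;
  by rewrite ?e.
Qed.

(** By flips it suffices to cover the octagon by the first tiling, for which a
    suitable succession of moves in hexagons always ends in one of its tiles. *)
Lemma covers_octagon k s : (k < 8)%N -> unit_cube s -> covers (ctiles k) (zpoint s).
Proof.
elim: k s => [|k ih] s hk hs; last first.
  have hk' := ltnW hk; have /allP/(_ k) := check_forwardP; rewrite mem_iota => /(_ hk').
  case/hasP=> -[[i j] l] htr /hasP[c _] /and4P[ci cj cl hf].
  have [ij jl l4] : [/\ (i < j)%N, (j < l)%N & (l < 4)%N].
    by move: htr; rewrite !inE => /or4P[] /eqP[-> -> ->].
  have [c' [i' [j' [ht hin]]]] := ih s hk' hs.
  have turnE : turn true k = k.+1 by rewrite /turn modn_small.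
  rewrite /flips_to turnE in hf.
  case/orP: hf => /and5P[_ _ /perm_mem hm _ _].
  - have [inold|ninold] := boolP ((c', (i', j')) \in half1 c i j l); last first.
      by exists c', i', j'; split=> //; rewrite hm mem_cat mem_filter ninold ht.
    have inc : (c', (i', j')) \in half1 c i j l ++ half2 c i j l by rewrite mem_cat inold.
    have [s' [s01 hs' e]] := in_half (t := (c', (i', j'))) ij jl l4 inc hin.
    rewrite e; have [c2 [i2 [j2 [h1 h2]]]] := half2_covers ij jl l4 cj s01 hs'.
    by exists c2, i2, j2; split=> //; rewrite hm mem_cat h1 orbT.
  have [inold|ninold] := boolP ((c', (i', j')) \in half2 c i j l); last first.
    by exists c', i', j'; split=> //; rewrite hm mem_cat mem_filter ninold ht.
  have inc : (c', (i', j')) \in half1 c i j l ++ half2 c i j l by rewrite mem_cat inold orbT.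
  have [s' [s01 hs' e]] := in_half (t := (c', (i', j'))) ij jl l4 inc hin.
  rewrite e; have [c2 [i2 [j2 [h1 h2]]]] := half1_covers ij jl l4 ci cl s01 hs'.
  by exists c2, i2, j2; split=> //; rewrite hm mem_cat h1 orbT.
have tl (c : code) i j s' : (c, (i, j)) \in ctiles 0 -> unit_cube s' ->
    (forall m, (m < 4)%N -> m != i -> m != j -> s' m = (has_dir c m)%:R) ->
    zpoint s' = zpoint s -> covers (ctiles 0) (zpoint s).
  by move=> h1 h2 h3 <-; exists c, i, j; split=> //; exists s'.
have last0 s1 : unit_cube s1 -> zpoint s1 = zpoint s -> s1 3%N = 0 -> covers (ctiles 0) (zpoint s).
  move=> h1 h2 h3.
  have [s2 [g1 g2 g3 g4]] := lower_hexagon (isT : 0 < 1)%N (isT : 1 < 2)%N isT h1.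
  have g5 := g2 3%N isT isT isT; rewrite h3 in g5.
  case: g4 => g4.
  - apply: (tl (code_of [::]) 1%N 2%N s2); rewrite ?g3 //.
    by move=> [|[|[|[|//]]]].
  - apply: (tl (code_of [::]) 0%N 1%N s2); rewrite ?g3 //.
    by move=> [|[|[|[|//]]]].
  - apply: (tl (code_of [:: 1]) 0%N 2%N s2); rewrite ?g3 //.
    by move=> [|[|[|[|//]]]].
have top2 s1 : unit_cube s1 -> zpoint s1 = zpoint s -> s1 2%N = 1 -> covers (ctiles 0) (zpoint s).
  move=> h1 h2 h3.
  have [s2 [g1 g2 g3 g4]] := lower_hexagon (isT : 0 < 1)%N (isT : 1 < 3)%N isT h1.
  have g5 := g2 2%N isT isT isT; rewrite h3 in g5.
  case: g4 => g4.
  - apply: (tl (code_of [:: 2]) 1%N 3%N s2); rewrite ?g3 //.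
    by move=> [|[|[|[|//]]]].
  - by apply: (last0 s2) => //; rewrite g3.
  - apply: (tl (code_of [:: 1; 2]) 0%N 3%N s2); rewrite ?g3 //.
    by move=> [|[|[|[|//]]]].
have [s1 [h1 _ h3 h4]] := lower_hexagon (isT : 1 < 2)%N (isT : 2 < 3)%N isT hs.
case: h4 => h4; [|exact: (last0 s1)|exact: (top2 s1)].
have [s2 [g1 g2 g3 g4]] := lower_hexagon (isT : 0 < 2)%N (isT : 2 < 3)%N isT h1.
have g5 := g2 1%N isT isT isT; rewrite h4 in g5.
case: g4 => g4.
- apply: (tl (code_of [::]) 2%N 3%N s2); rewrite ?g3 //.
  by move=> [|[|[|[|//]]]].
- by apply: (last0 s2) => //; rewrite g3.
- by apply: (top2 s2) => //; rewrite g3.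
Qed.

(** * Every tiling is in the table *)
Section Sweep.
Implicit Types t : tile R.
Variable T : {fset tile R}.
Hypothesis hT : zonotopal_tiling q T.

Lemma tile_lt t : t \in T -> (t.2.1 < t.2.2)%N.
Proof. by case: hT => h _ _; exact: h. Qed.

Lemma tile_octagon t p : t \in T -> tile_region q t p -> octagon_region q p.
Proof. by case: hT => _ <- _ h1 h2; exists t. Qed.

Lemma octagon_tile p : octagon_region q p -> exists2 t, t \in T & tile_region q t p.
Proof. by case: hT => _ <- _. Qed.

Lemma ctiles_valid k c i j : (k < 8)%N -> (c, (i, j)) \in ctiles k ->
  [/\ (i < j < 4)%N, ~~ has_dir c i & ~~ has_dir c j].
Proof.
move=> hk h; have /allP/(_ (c, (i, j))) := check_ctilesP.
have -> : (c, (i, j)) \in flatten [seq ctiles k | k <- iota 0 8].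
  by apply/flattenP; exists (ctiles k) => //; apply: map_f; rewrite mem_iota.
by move=> /(_ isT) /andP[-> /andP[/= -> ->]].
Qed.

(** The six tiles already cover the octagon, so a further tile would have its centre
    in one of them. *)
Lemma is_tiling_of_sub k : (k < 8)%N -> (forall c, c \in ctiles k -> realt c \in T) ->
  is_tiling k T.
Proof.
move=> hk sub t; split=> [tT|[c /sub + ->] //].
have [h0 h1] : 0 < (2^-1 : R) /\ (2^-1 : R) < 1 by split; lra.
have half : 0 < (2^-1 : R) < 1 by rewrite h0 h1.
have half' : 0 <= (2^-1 : R) <= 1 by rewrite !ltW.
pose p := in_tile t 2^-1 2^-1.
have ht : tile_region q t p by apply/tile_regionE; exists 2^-1, 2^-1.
have [s hs pE] := octagon_zpoint (tile_octagon tT ht).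
have [c [i [j [hc hin]]]] := covers_octagon hk hs.
have [ij ci cj] := ctiles_valid hk hc.
exists (c, (i, j)) => //; apply: (interior_uniq hT tT (sub _ hc) half half).
by apply/(region_ctile _ ij ci cj); rewrite -/p pE.
Qed.

(** Finitely many tiles cover the ray, so one of them meets it arbitrarily close to
    its origin. *)
Lemma accumulating_tile (z u : 'rV[R]_2) :
  (forall e : R, 0 < e <= 1 -> octagon_region q (z + e *: u)) ->
  exists2 t, t \in T & forall d : R, 0 < d ->
    exists2 e, 0 < e < d & tile_region q t (z + e *: u).
Proof.
move=> hz; apply: contrapT => hn.
have far t : t \in T -> exists d : R, 0 < d /\ forall e, 0 < e < d -> ~ tile_region q t (z + e *: u).
  move=> tT; apply: contrapT => h; apply: hn; exists t => // d d0.
  apply: contrapT => h'; apply: h; exists d; split=> // e he ht; apply: h'.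
  by exists e.
have main (l : seq (tile R)) : (forall t, t \in l -> t \in T) -> exists d : R,
    0 < d /\ forall t, t \in l -> forall e, 0 < e < d -> ~ tile_region q t (z + e *: u).
  elim: l => [_|t l ih hl]; first by exists 1; split.
  have [|d [d0 hd]] := ih; first by move=> t' h; apply: hl; rewrite inE h orbT.
  have [|d' [d'0 hd']] := far t; first by apply: hl; rewrite inE eqxx.
  exists (Num.min d d'); split; first by rewrite lt_min d0.
  move=> t'; rewrite inE => /orP[/eqP -> | h] e /andP[e0]; rewrite lt_min => /andP[ed ed'].
    by apply: hd'; rewrite e0.
  by apply: hd => //; rewrite e0.
have [d [d0 hd]] := main T (fun t h => h).
pose e := Num.min (d / 2) 1.
have e0 : 0 < e by rewrite lt_min divr_gt0 // ltr01.
have e1 : e <= 1 by rewrite ge_min lexx orbT.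
have [|t tT ht] := @octagon_tile (z + e *: u); first by apply: hz; rewrite e0.
apply: (hd t tT e) => //; rewrite e0 /= gt_min ltr_pdivrMr // mulr_natr mulr2n.
by rewrite ltrDl d0.
Qed.

Lemma limit_ge0 (a b : R) : (forall d : R, 0 < d -> exists2 e, 0 < e < d & 0 <= a + e * b) -> 0 <= a.
Proof.
move=> h; rewrite leNgt; apply/negP => a0.
have [b0|b0] := leP b 0.
  have [e /andP[e0 _]] := h 1 ltr01; rewrite leNgt => /negP; apply.
  by rewrite -[0]addr0 ltr_leD // mulr_ge0_le0 // ltW.
have [|e /andP[e0 ed]] := h (- a / b); first by rewrite divr_gt0 // oppr_gt0.
rewrite leNgt => /negP; apply; move: ed; rewrite ltr_pdivlMr // => ed.
by rewrite -ltrBrDl sub0r.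
Qed.

Lemma tile_region_ineq t p : t \in T -> let D := det2 (dir t.2.1) (dir t.2.2) in
  tile_region q t p <-> [/\ 0 <= det2 (p - t.1) (dir t.2.2), det2 (p - t.1) (dir t.2.2) <= D,
    0 <= det2 (dir t.2.1) (p - t.1) & det2 (dir t.2.1) (p - t.1) <= D].
Proof.
move=> tT D; have D0 : 0 < D by apply: (dir_det_gt0); rewrite tile_lt //=.
rewrite tile_regionE; split=> [[s1 [s2 [/andP[s10 s11] /andP[s20 s21] ->]]]|[h1 h2 h3 h4]].
  have -> : in_tile t s1 s2 - t.1 = s1 *: dir t.2.1 + s2 *: dir t.2.2.
    by rewrite /in_tile addrC -addrA addKr.
  rewrite !det2E !mulr0 add0r addr0 -/D; split.
  - by rewrite mulr_ge0 // ltW.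
  - by rewrite ler_piMl // ltW.
  - by rewrite mulr_ge0 // ltW.
  - by rewrite ler_piMl // ltW.
exists (det2 (p - t.1) (dir t.2.2) / D), (det2 (dir t.2.1) (p - t.1) / D); split.
- by apply/andP; split; [apply: divr_ge0 => //; exact: ltW | rewrite ler_pdivrMr // mul1r].
- by apply/andP; split; [apply: divr_ge0 => //; exact: ltW | rewrite ler_pdivrMr // mul1r].
have Dn0 : D != 0 by rewrite gt_eqF.
rewrite /in_tile; apply: plane_eq; rewrite !mxE; apply: (mulfI Dn0);
  by rewrite /D in Dn0 *; rewrite /det2 !mxE in Dn0 *; field.
Qed.

(** Tiles are closed. *)
Lemma accumulating_limit t z u : t \in T ->
  (forall d : R, 0 < d -> exists2 e, 0 < e < d & tile_region q t (z + e *: u)) ->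
  tile_region q t z.
Proof.
move=> tT h; have key (e : R) w : det2 w (z + e *: u - t.1) = det2 w (z - t.1) + e * det2 w u.
  by rewrite /det2 !mxE; ring.
have key' (e : R) w : det2 (z + e *: u - t.1) w = det2 (z - t.1) w + e * det2 u w.
  by rewrite /det2 !mxE; ring.
apply/(tile_region_ineq _ tT); split.
- apply: (@limit_ge0 _ (det2 u (dir t.2.2))) => d /h[e he /(tile_region_ineq _ tT)[h1 h2 h3 h4]].
  by exists e => //; rewrite -key'.
- rewrite -subr_ge0; apply: (@limit_ge0 _ (- det2 u (dir t.2.2))) => d /h[e he /(tile_region_ineq _ tT)[h1 h2 h3 h4]].
  by exists e => //; rewrite mulrN -addrA -opprD -key' subr_ge0.
- apply: (@limit_ge0 _ (det2 (dir t.2.1) u)) => d /h[e he /(tile_region_ineq _ tT)[h1 h2 h3 h4]].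
  by exists e => //; rewrite -key.
- rewrite -subr_ge0; apply: (@limit_ge0 _ (- det2 (dir t.2.1) u)) => d /h[e he /(tile_region_ineq _ tT)[h1 h2 h3 h4]].
  by exists e => //; rewrite mulrN -addrA -opprD -key subr_ge0.
Qed.

(** There are only finitely many vertices to avoid. *)
Lemma generic_point (y v : 'rV[R]_2) : v != 0 -> exists s : R, 0 < s < 1 /\
  forall t, t \in T -> y + s *: v \notin tile_vertices q t.
Proof.
move=> v0.
have main (l : seq 'rV[R]_2) (a b : R) : a < b -> exists s, a < s < b /\ y + s *: v \notin l.
  elim: l a b => [|x l ih] a b ab.
    by exists ((a + b) / 2); split=> //; rewrite !midf_lt.
  have [am mb] : a < (a + b) / 2 /\ (a + b) / 2 < b by rewrite !midf_lt.
  have [s1 [/andP[h1 h1'] n1]] := ih _ _ am; have [s2 [/andP[h2 h2'] n2]] := ih _ _ mb.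
  have [e1|ne1] := eqVneq (y + s1 *: v) x; last first.
    by exists s1; rewrite h1 (lt_trans h1' mb) inE negb_or ne1.
  exists s2; rewrite h2' (lt_trans am h2) inE negb_or n2 andbT; split=> //.
  rewrite -e1 (inj_eq (addrI _)) -subr_eq0 -scalerBl scaler_eq0 (negbTE v0) orbF subr_eq0.
  by rewrite gt_eqF // (lt_trans h1' h2).
have [s [hs nl]] := main (flatten [seq tile_vertices q t | t <- T]) 0 1 ltr01.
exists s; split=> // t tT; apply: contra nl => h.
by apply/flattenP; exists (tile_vertices q t) => //; apply: map_f.
Qed.


Definition right_code (i : nat) : code := code_of (iota 0 i).

(** An edge of the sweeping path is on the right boundary of the octagon, or it is a
    left edge of a tile that has been swept. *)
Definition available (c : code) (i : nat) : Prop :=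
  c = right_code i \/ exists2 t, t \in T &
    (t.1 = pt c /\ t.2.2 = i :> nat) \/ (t.1 + dir t.2.2 = pt c /\ t.2.1 = i :> nat).
(** A tile on the left of an edge has it as its first right edge or as its second
    one. *)
Definition up_tile (c : code) (i : nat) : Prop :=
  exists2 t, t \in T & t.1 = pt c /\ t.2.1 = i :> nat.
Definition down_tile (c : code) (i : nat) : Prop :=
  exists2 t, t \in T & t.1 + dir t.2.1 = pt c /\ t.2.2 = i :> nat.

Lemma code_mem (c : code) : c \in codes.
Proof. by case: c => [[[[] []] []] []]. Qed.

Lemma has_right_code i m : (i < 4)%N -> (m < 4)%N -> has_dir (right_code i) m = (m < i)%N.
Proof. by case: i m => [|[|[|[|//]]]] [|[|[|[|//]]]]. Qed.

(** Each coordinate contributes a nonnegative term to the distance from the supporting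
    line, and the contribution vanishes only at the value on the boundary. *)
Lemma right_boundary i p : (i < 4)%N -> octagon_region q p ->
  0 <= det2 (dir i) (p - pt (right_code i)) /\
  (det2 (dir i) (p - pt (right_code i)) = 0 ->
     exists2 r : R, 0 <= r <= 1 & p = pt (right_code i) + r *: dir i).
Proof.
move=> i4 /(octagon_zpoint)[s hs ->]; rewrite /pt det2_zpointB.
pose F (m : 'I_4) : R := (s m - (has_dir (right_code i) m)%:R) * det2 (dir i) (dir m).
rewrite (eq_bigr F) //.
have F0 (m : 'I_4) : 0 <= F m.
  rewrite /F has_right_code //; have /andP[s0 s1] := hs m.
  case: (ltngtP m i) => h /=.
  - apply: mulr_le0; first by rewrite subr_le0.
    by rewrite det2C oppr_le0 ltW // (dir_det_gt0) // h.
  - by rewrite subr0; apply: mulr_ge0 => //; rewrite ltW // (dir_det_gt0) // h /=.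
  - by rewrite h det2uu mulr0.
split; first by apply: sumr_ge0.
move/eqP; rewrite psumr_eq0 // => /allP z0; exists (s i) => //.
rewrite zpoint_add //; apply: zpoint_ext => m m4.
have [->|mi] := eqVneq m i; first by rewrite has_right_code // ltnn add0r.
rewrite addr0; have := z0 (Ordinal m4) (mem_index_enum _).
rewrite /F /= mulf_eq0 subr_eq0 => /orP[/eqP //|].
by rewrite (negbTE (det_neq0 i4 m4 _)) // eq_sym.
Qed.

Lemma in_tile_octagon t s1 s2 : t \in T -> 0 <= s1 <= 1 -> 0 <= s2 <= 1 ->
  octagon_region q (in_tile t s1 s2).
Proof. by move=> tT h1 h2; apply: (tile_octagon tT); apply/tile_regionE; exists s1, s2. Qed.

Lemma unit0 : 0 <= (0 : R) <= 1. Proof. by rewrite lexx ler01. Qed.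
Lemma unit1 : 0 <= (1 : R) <= 1. Proof. by rewrite lexx ler01. Qed.

Definition has_edge t (y : 'rV[R]_2) (i : nat) : Prop :=
  [\/ t.1 = y /\ t.2.1 = i :> nat, t.1 + dir t.2.1 = y /\ t.2.2 = i :> nat,
      t.1 = y /\ t.2.2 = i :> nat | t.1 + dir t.2.2 = y /\ t.2.1 = i :> nat].

Lemma edge_has_edge t y i : (i < 4)%N -> (y, y + dir i) \in tile_edges q t -> has_edge t y i.
Proof.
move=> i4; rewrite /tile_edges !inE !side_dir.
have inj (m : 'I_4) : dir i = dir m -> m = i :> nat by move/(dir_inj i4 (ltn_ord m)).
case/or4P=> /eqP[-> e].
- by apply: Or41; rewrite (inj _ (addrI _ e)).
- by apply: Or43; rewrite (inj _ (addrI _ e)).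
- by apply: Or42; rewrite (inj _ (addrI _ e)).
- by apply: Or44; split=> //; apply: inj; apply: (addrI (t.1 + dir t.2.2)); rewrite e addrAC.
Qed.

Lemma affine_zero (a b s : R) : 0 < s < 1 -> 0 <= a -> 0 <= a + b -> a + s * b = 0 ->
  a = 0 /\ b = 0.
Proof. by move=> /andP[s0 s1] a0 ab e; split; nra. Qed.

(** The tile does not cross the supporting line of the side and touches it at a point
    that is not a vertex, so it has an edge in that line.  This edge has the length of
    the side and stays inside the octagon, hence is the side. *)
Lemma right_edge_tile t i s : (i < 4)%N -> 0 < s < 1 -> t \in T ->
  pt (right_code i) + s *: dir i \notin tile_vertices q t ->
  tile_region q t (pt (right_code i) + s *: dir i) -> has_edge t (pt (right_code i)) i.
Proof.
set y := pt _ => i4 s01 tT nv /tile_regionE[s1 [s2 [h1 h2 zE]]].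
pose f p := det2 (dir i) (p - y).
have fE a b : f (in_tile t a b) = f t.1 + a * det2 (dir i) (dir t.2.1) + b * det2 (dir i) (dir t.2.2).
  by rewrite /f /in_tile addrAC (addrAC t.1) !det2E.
have f0 a b : 0 <= a <= 1 -> 0 <= b <= 1 -> 0 <= f (in_tile t a b).
  by move=> ha hb; have [] := right_boundary i4 (in_tile_octagon tT ha hb).
have fz a b : 0 <= a <= 1 -> 0 <= b <= 1 -> f (in_tile t a b) = 0 ->
    exists2 r : R, 0 <= r <= 1 & in_tile t a b = y + r *: dir i.
  by move=> ha hb; have [_] := right_boundary i4 (in_tile_octagon tT ha hb).
have z0 : f (in_tile t s1 s2) = 0.
  by rewrite -zE /f addrAC subrr add0r det2E det2uu mulr0.
have dz (m : 'I_4) : det2 (dir i) (dir m) = 0 -> m = i :> nat.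
  move=> d0; apply/eqP; apply: contraT; rewrite eq_sym => /(det_neq0 i4 (ltn_ord m)).
  by rewrite d0 eqxx.
have lt := tile_lt tT.
have dir0 : dir i != 0.
  have [j j4 ij] : exists2 j, (j < 4)%N & i != j.
    by case: (i) => [|n]; [exists 1%N | exists 0%N].
  apply: contraNneq (det_neq0 i4 j4 ij) => ->; rewrite /det2 !mxE; apply/eqP; ring.
have edge p r1 : (exists2 r : R, 0 <= r <= 1 & p = y + r *: dir i) ->
    (exists2 r : R, 0 <= r <= 1 & p + dir i = y + r *: dir i) -> r1 = p -> r1 = y.
  move=> [r /andP[r0 _] ->] [r' /andP[_ r'1]] e ->.
  have e' : (r + 1) *: dir i = r' *: dir i.
    by apply: (addrI y); rewrite -e scalerDl scale1r addrA.
  have : (r + 1 - r') *: dir i == 0 by rewrite scalerBl e' subrr.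
  rewrite scaler_eq0 (negbTE dir0) orbF => /eqP e2.
  have -> : r = 0 by lra.
  by rewrite scale0r addr0.
have bnd (x : R) : 0 <= x <= 1 -> [\/ x = 0, x = 1 | 0 < x < 1].
  move=> /andP[x0 x1]; have [->|n0] := eqVneq x 0; first exact: Or31.
  have [->|n1] := eqVneq x 1; first exact: Or32.
  by apply: Or33; rewrite !lt_neqAle eq_sym n0 n1 x0 x1.
have caseA : 0 < s1 < 1 -> has_edge t y i.
  move=> hs1.
  have [a0 b0] : f (in_tile t 0 s2) = 0 /\ det2 (dir i) (dir t.2.1) = 0.
    apply: (affine_zero hs1); first exact: f0 unit0 h2.
      by have := f0 1 s2 unit1 h2; rewrite !fE; lra.
    by move: z0; rewrite !fE; lra.
  have ai := dz _ b0.
  have p1 : in_tile t 1 s2 = in_tile t 0 s2 + dir i.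
    by rewrite /in_tile ai scale1r scale0r addr0 addrAC.
  have c0 : f (in_tile t 1 s2) = 0 by move: a0; rewrite !fE b0; lra.
  have yE := edge _ _ (fz _ _ unit0 h2 a0) _ erefl; rewrite -p1 in yE.
  move: (yE (fz _ _ unit1 h2 c0)) => {}yE.
  case: (bnd _ h2) => hs2.
  - by apply: Or41; split=> //; rewrite -yE hs2 /in_tile !scale0r !addr0.
  - by apply: Or44; split=> //; rewrite -yE hs2 /in_tile scale0r addr0 scale1r.
  have [_ d0] : f (in_tile t 0 0) = 0 /\ det2 (dir i) (dir t.2.2) = 0.
    apply: (affine_zero hs2); first exact: f0 unit0 unit0.
      by have := f0 0 1 unit0 unit1; rewrite !fE; lra.
    by move: a0; rewrite !fE; lra.
  by have := dz _ d0; rewrite -ai => e; move: lt; rewrite e ltnn.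
have [h01|] : (s1 = 0 \/ s1 = 1) \/ 0 < s1 < 1.
- by case: (bnd _ h1) => h; [left; left|left; right|right].
- have hs2 : 0 < s2 < 1.
    case: (bnd _ h2) => // e2; case/negP: nv; rewrite zE /in_tile /tile_vertices !inE !side_dir;
    case: h01 => ->; rewrite e2 ?scale0r ?scale1r ?addr0 eqxx ?orbT //.
  have [a0 b0] : f (in_tile t s1 0) = 0 /\ det2 (dir i) (dir t.2.2) = 0.
    apply: (affine_zero hs2); first exact: f0 h1 unit0.
      by have := f0 s1 1 h1 unit1; rewrite !fE; lra.
    by move: z0; rewrite !fE; lra.
  have ai := dz _ b0.
  have p1 : in_tile t s1 1 = in_tile t s1 0 + dir i.
    by rewrite /in_tile ai scale1r scale0r addr0.
  have c0 : f (in_tile t s1 1) = 0 by move: a0; rewrite !fE b0; lra.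
  have yE := edge _ _ (fz _ _ h1 unit0 a0) _ erefl; rewrite -p1 in yE.
  move: (yE (fz _ _ h1 unit1 c0)) => {}yE.
  case: h01 => e; rewrite e /in_tile scale0r addr0 in yE.
  - by apply: Or43; split=> //; rewrite -yE scale0r addr0.
  - by apply: Or42; split=> //; rewrite -yE scale1r.
exact: caseA.
Qed.

(** The two tiles meet in a point that is interior to an edge of one of them, so they
    have this edge in common. *)
Lemma shared_edge_tile t0 t c i s : (i < 4)%N -> 0 < s < 1 -> t0 \in T -> t \in T -> t0 != t ->
  (t0.1 = pt c /\ t0.2.2 = i :> nat) \/ (t0.1 + dir t0.2.2 = pt c /\ t0.2.1 = i :> nat) ->
  pt c + s *: dir i \notin tile_vertices q t ->
  tile_region q t (pt c + s *: dir i) -> has_edge t (pt c) i.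
Proof.
move=> i4 /andP[s0 s1] t0T tT ne h0 nv ht.
have lt0 := tile_lt t0T.
have [r1 [r2 [zE hr]]] : exists r1 r2, pt c + s *: dir i = in_tile t0 r1 r2 /\
    ((r1 = 0 /\ r2 = s /\ t0.1 = pt c /\ t0.2.2 = i :> nat) \/
     (r1 = s /\ r2 = 1 /\ t0.1 + dir t0.2.2 = pt c /\ t0.2.1 = i :> nat)).
  case: h0 => -[<- e]; rewrite -e.
    by exists 0, s; rewrite /in_tile scale0r addr0; split=> //; left.
  by exists s, 1; rewrite /in_tile scale1r addrAC; split=> //; right.
have s01 : 0 <= s <= 1 by rewrite !ltW.
have ht0 : tile_region q t0 (pt c + s *: dir i).
  apply/tile_regionE; exists r1, r2; split=> //.
    by case: hr => -[-> _] //; exact: unit0.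
  by case: hr => -[_ [-> _]] //; exact: unit1.
have zI : (tile_region q t0 `&` tile_region q t) (pt c + s *: dir i) by [].
case: hT => _ _ /(_ t0 t t0T tT ne) [h|[a [_ at_ h]]|[e [e0 et h]]]; rewrite h in zI => //.
  by rewrite zI at_ in nv.
have [x1 [x2 [xE hx]]] := edge_coord e0 zI.
have [e1 e2] : x1 = r1 /\ x2 = r2 by apply: (in_tile_uniq lt0); rewrite -xE.
subst x1 x2; apply: edge_has_edge => //.
case: hr => -[a1 [a2 [a3 a4]]]; subst r1 r2; case: hx => -[b1 b2].
- by rewrite -a3 -a4 -b2.
- by move/eqP: b1; rewrite eq_sym oner_eq0.
- by rewrite b1 ltxx in s0.
- by rewrite b1 ltxx in s1.
- by rewrite b1 ltxx in s0.
- by rewrite b1 ltxx in s1.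
- by move/eqP: b1; rewrite oner_eq0.
- by rewrite -a3 -a4 addrAC -b2.
Qed.

(** A tile lies on the right of its left edges. *)
Lemma left_edge_side t (y : 'rV[R]_2) i p : t \in T ->
  (t.1 = y /\ t.2.2 = i :> nat) \/ (t.1 + dir t.2.2 = y /\ t.2.1 = i :> nat) ->
  tile_region q t p -> det2 (dir i) (p - y) <= 0.
Proof.
move=> tT h /tile_regionE[s1 [s2 [/andP[s10 s11] /andP[s20 s21] ->]]].
have D0 : 0 < det2 (dir t.2.1) (dir t.2.2).
  by apply: (dir_det_gt0); rewrite (tile_lt tT) /=.
case: h => -[<- <-].
  have -> : in_tile t s1 s2 - t.1 = s1 *: dir t.2.1 + s2 *: dir t.2.2.
    by rewrite /in_tile addrC -addrA addKr.
  by rewrite !det2E mulr0 addr0 det2C mulrN oppr_le0 mulr_ge0 // ltW.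
have -> : in_tile t s1 s2 - (t.1 + dir t.2.2) = s1 *: dir t.2.1 + (s2 - 1) *: dir t.2.2.
  by rewrite /in_tile; apply: plane_eq; rewrite !mxE; ring.
by rewrite !det2E mulr0 add0r mulr_le0_ge0 ?subr_le0 // ltW.
Qed.

(** From a generic point of the edge a ray leads to the left into the octagon.  The
    tile that it enters contains the point, and therefore has the edge. *)
Lemma left_tile c i : (i < 4)%N -> ~~ has_dir c i -> available c i ->
  ~~ (upper c && upper (add_dir c i)) -> up_tile c i \/ down_tile c i.
Proof.
move=> i4 ci hav nup.
have [j [j4 hj]] : exists j, (j < 4)%N /\ ((i < j)%N && ~~ has_dir c j || (j < i)%N && has_dir c j).
  have /allP/(_ c (code_mem c))/allP/(_ i) := check_upperP.
  rewrite mem_iota => /(_ i4); rewrite (negbTE ci) (negbTE nup) !orFb => /hasP[j].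
  by rewrite mem_iota => j4 hj; exists j.
pose u := if (i < j)%N then dir j else - dir j.
have ij : j != i by case/orP: hj => /andP[h _]; [rewrite gtn_eqF | rewrite ltn_eqF].
have hu : 0 < det2 (dir i) u.
  rewrite /u; case/orP: hj => /andP[h _].
    by rewrite h (dir_det_gt0) // h.
  rewrite ltnNge (ltnW h) /= det2Nr det2C opprK (dir_det_gt0) //.
  by rewrite h.
have dir0 : dir i != 0 by apply/eqP => e; move: hu; rewrite e /det2 !mxE !mul0r subrr ltxx.
have [s [s01 hs]] := generic_point (pt c) dir0.
have /andP[s0 s1] := s01.
set z := pt c + s *: dir i in hs.
have hz (e : R) : 0 < e <= 1 -> octagon_region q (z + e *: u).
  move=> /andP[e0 e1].
  have -> : z + e *: u = zpoint (fun m => (has_dir c m)%:R + (if m == i then s else 0)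
      + (if m == j then (if (i < j)%N then e else - e) else 0)).
    rewrite /z /pt -!zpoint_add //; congr (_ + _).
    by rewrite /u; case: ifP => _ //; rewrite scalerN scaleNr.
  apply: (zpoint_octagon) => m.
  have [->|mi] := eqVneq m i.
    by rewrite eq_sym (negbTE ij) addr0 (negbTE ci) add0r !ltW.
  have [->|mj] := eqVneq m j; last first.
    by rewrite !addr0; case: (has_dir c m); rewrite ?unit0 ?unit1.
  rewrite addr0; case/orP: hj => /andP[h hc].
    by rewrite h (negbTE hc) add0r ltW.
  by rewrite ltnNge (ltnW h) hc /= subr_ge0 e1 gerBl ltW.
have [t tT hacc] := accumulating_tile hz.
have ht := accumulating_limit tT hacc.
have [e /andP[e0 _] hte] := hacc 1 ltr01.
have side t' : t' \in T ->
    (t'.1 = pt c /\ t'.2.2 = i :> nat) \/ (t'.1 + dir t'.2.2 = pt c /\ t'.2.1 = i :> nat) ->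
    ~ tile_region q t' (z + e *: u).
  move=> t'T h /(left_edge_side t'T h).
  have -> : z + e *: u - pt c = s *: dir i + e *: u.
    by rewrite /z addrC -addrA addKr.
  by rewrite !det2E mulr0 add0r leNgt mulr_gt0.
have : has_edge t (pt c) i.
  case: hav => [cE|[t0 t0T h0]]; first by rewrite cE; apply: (right_edge_tile i4 s01) => //; rewrite -cE ?hs.
  apply: (shared_edge_tile i4 s01 t0T tT _ h0) => //; last exact: hs.
  by apply: contra_notN (side t0 t0T h0) => /eqP ->.
case=> h; [by left; exists t|by right; exists t| |].
  by case: (side t tT (or_introl h)).
by case: (side t tT (or_intror h)).
Qed.


(** A vertex of the left boundary is the only maximum of some linear form. *)
Lemma upper_maximal c : upper c -> exists (m : nat) (u : 'rV[R]_2),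
  [/\ forall i, (i < 4)%N -> has_dir c i = (m <= i)%N,
      forall i, (i < 4)%N -> if has_dir c i then 0 < det2 u (dir i) else det2 u (dir i) < 0
    & forall p, octagon_region q p -> det2 u (p - pt c) <= 0].
Proof.
move=> up; have /allP/(_ c (code_mem c)) := check_upper_ltP; rewrite up implyTb => /hasP[m].
rewrite mem_iota => hm /allP hc; have [u hu] := separating (hm : (m <= 4)%N).
have hc' i : (i < 4)%N -> has_dir c i = (m <= i)%N.
  by move=> hi; apply/eqP; apply: hc; rewrite mem_iota.
exists m, u; split=> // [i i4|p /(octagon_zpoint)[s hs ->]].
  by rewrite hc' //; exact: hu.
rewrite /pt det2_zpointB; apply: sumr_le0 => i _.
have := hu i (ltn_ord i); rewrite -hc' //; have /andP[s0 s1] := hs i.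
case: (has_dir c i) => h.
  by rewrite mulr_le0_ge0 ?subr_le0 // ltW.
by rewrite subr0 mulr_ge0_le0 // ltW.
Qed.

(** The tile would leave the octagon. *)
Lemma upper_not_down c i : (i < 4)%N -> ~~ has_dir c i -> upper c -> ~ down_tile c i.
Proof.
move=> i4 ci /upper_maximal[m [u [hm hu hmax]]] [t tT [t1 t2]].
have lt := tile_lt tT.
have := hmax _ (in_tile_octagon tT unit0 unit0).
have -> : in_tile t 0 0 - pt c = - dir t.2.1.
  by rewrite -t1 /in_tile !scale0r !addr0 opprD addrA subrr add0r.
rewrite det2Nr oppr_le0; have := hu _ (ltn_ord t.2.1); case: ifP => h.
  by move: ci; rewrite hm // -t2 (leq_trans _ (ltnW lt)) // -hm.
by rewrite ltNge => /negbTE ->.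
Qed.

Lemma upper_not_up c i : (i < 4)%N -> ~~ has_dir c i -> upper (add_dir c i) -> ~ up_tile c i.
Proof.
move=> i4 ci /upper_maximal[m [u [hm hu hmax]]] [t tT [t1 t2]].
have lt := tile_lt tT.
have := hmax _ (in_tile_octagon tT unit1 unit1).
have -> : in_tile t 1 1 - pt (add_dir c i) = dir t.2.2.
  by rewrite pt_add // -t1 /in_tile !scale1r t2 addrC addKr.
have := hu _ (ltn_ord t.2.2); rewrite hm //.
have -> : (m <= t.2.2)%N.
  apply: leq_trans (ltnW lt); rewrite t2 -hm //.
  by rewrite has_add_dir // eqxx orbT.
by rewrite ltNge => /negbTE ->.
Qed.

Lemma cone_diagonal (a b m M : nat) : (m <= a)%N -> (a < b)%N -> (b <= M)%N -> (M < 4)%N ->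
  0 < det2 (dir a) (dir M - dir m) /\ 0 < det2 (dir b) (dir M - dir m).
Proof.
move=> ma ab bM M4; have b4 := leq_ltn_trans bM M4.
have D i j : (i < j)%N -> (j < 4)%N -> 0 < det2 (dir i) (dir j).
  by move=> ij j4; rewrite (dir_det_gt0) // ij.
have D' i j : (i <= j)%N -> (j < 4)%N -> 0 <= det2 (dir i) (dir j).
  rewrite leq_eqVlt => /orP[/eqP ->|ij] j4; first by rewrite det2uu.
  by rewrite ltW // D.
rewrite !det2Dr !det2Nr !(det2C _ (dir m)) !opprK; split.
  apply: ltr_wpDr; first by apply: D' => //; exact: ltn_trans ab b4.
  by apply: D => //; exact: leq_trans ab bM.
apply: ltr_wpDl; first exact: D'.
by apply: D => //; exact: leq_ltn_trans ma ab.
Qed.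

(** Cramer's rule in the plane. *)
Lemma cone_coord (v w d : 'rV[R]_2) : det2 v w != 0 ->
  d = - (det2 w d / det2 v w) *: v + (det2 v d / det2 v w) *: w.
Proof.
move=> n0; apply: plane_eq; rewrite !mxE; apply: (mulfI n0);
by rewrite /det2 in n0 *; field.
Qed.

(** Near the common point of the two edges each tile fills a sector, and the
    difference of the largest and the smallest of the four directions points into
    both.  So the tiles overlap, and they are equal. *)
Lemma up_down_tile c i i' : (i < 4)%N -> (i' < 4)%N -> ~~ has_dir c i ->
  up_tile c i -> down_tile (add_dir c i) i' -> (i < i')%N /\ realt (c, (i, i')) \in T.
Proof.
move=> i4 i'4 ci [t tT [t1 ti]] [t' t'T [t'1 t'i]].
have lt := tile_lt tT; have lt' := tile_lt t'T.
rewrite pt_add // in t'1.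
pose M := maxn t.2.2 t'.2.2; pose m := minn t.2.1 t'.2.1.
have M4 : (M < 4)%N by rewrite gtn_max !ltn_ord.
pose d := dir M - dir m.
have [hb ha] : 0 < det2 (dir t.2.1) d /\ 0 < det2 (dir t.2.2) d.
  by apply: cone_diagonal; rewrite ?geq_minl ?leq_maxl.
have [hb' ha'] : 0 < det2 (dir t'.2.1) d /\ 0 < det2 (dir t'.2.2) d.
  by apply: cone_diagonal; rewrite ?geq_minr ?leq_maxr.
have D0 : 0 < det2 (dir t.2.1) (dir t.2.2) by rewrite (dir_det_gt0) // lt /=.
have D0' : 0 < det2 (dir t'.2.1) (dir t'.2.2) by rewrite (dir_det_gt0) // lt' /=.
have dE := cone_coord d (lt0r_neq0 D0); have dE' := cone_coord d (lt0r_neq0 D0').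
move: (divr_gt0 ha D0) (divr_gt0 hb D0) (divr_gt0 ha' D0') (divr_gt0 hb' D0') dE dE'.
move: (det2 _ d / _) (det2 _ d / _) (det2 _ d / _) (det2 _ d / _) => b' a' b a.
move=> a0 b0 a'0 b'0 dE dE'.
(* Small enough for all four coordinates. *)
pose e := (1 + a + b + a' + b')^-1.
have s0 : 0 < 1 + a + b + a' + b' by rewrite !addr_gt0.
have e0 : 0 < e by rewrite invr_gt0.
have small x : 0 < x -> x < 1 + a + b + a' + b' -> 0 < e * x < 1.
  by move=> x0 x1; rewrite mulr_gt0 //= mulrC ltr_pdivrMr // mul1r.
have small' x : 0 < x -> x < 1 + a + b + a' + b' -> 0 < 1 - e * x < 1.
  by move=> x0 x1; have /andP[h1 h2] := small x x0 x1; rewrite subr_gt0 h2 gtrBl h1.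
have pE : in_tile t (1 - e * a) (e * b) = in_tile t' (1 - e * a') (e * b').
  have near (x v w : 'rV[R]_2) y z : x + (1 - e * y) *: v + (e * z) *: w = x + v + e *: (- y *: v + z *: w).
    by apply: plane_eq; rewrite !mxE; ring.
  by rewrite /in_tile !near -dE -dE' t'1 t1 ti.
have tt : t = t'.
  apply: (interior_uniq hT tT t'T (s1 := 1 - e * a) (s2 := e * b)).
  - by apply: small' => //; lra.
  - by apply: small => //; lra.
  rewrite pE; apply/tile_regionE; exists (1 - e * a'), (e * b').
  have /andP[h1 h2] : 0 < 1 - e * a' < 1 by apply: small' => //; lra.
  have /andP[h3 h4] : 0 < e * b' < 1 by apply: small => //; lra.
  by split=> //; rewrite !ltW.
rewrite -tt in t'i; rewrite -ti -t'i; split=> //.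
suff -> : realt (c, (nat_of_ord t.2.1, nat_of_ord t.2.2)) = t by [].
by rewrite /realt /= !inord_val -t1; case: (t) => [? [? ?]].
Qed.

Let lt34 p : (p < 3)%N -> (p < 4)%N.
Proof. by move=> h; apply: ltn_trans h _. Qed.

Definition available_path (w : seq nat) : Prop :=
  forall p, (p < 4)%N -> available (prefix w p) (nth 0%N w p).

Lemma word_at w p : w \in words -> (p < 4)%N ->
  [/\ (nth 0 w p < 4)%N, ~~ has_dir (prefix w p) (nth 0 w p)%N
    & prefix w p.+1 = add_dir (prefix w p) (nth 0 w p)%N].
Proof.
move=> hw hp; have /allP/(_ w hw)/allP/(_ p) := check_wordsP.
by rewrite mem_iota => /(_ hp) /and3P[h1 h2 /eqP h3].
Qed.

(** At the first edge that leaves the left boundary the tile continues upwards, and at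
    the last edge before the boundary is reached again it comes from below.  Somewhere
    in between the first kind is followed by the second. *)
Lemma swept_tile w : w \in words -> available_path w -> ascents w != 0%N ->
  exists p, [/\ (p < 3)%N, (nth 0 w p < nth 0 w p.+1)%N
    & realt (prefix w p, (nth 0 w p, nth 0 w p.+1)%N) \in T].
Proof.
move=> hw av asc.
have left p : (p < 4)%N -> upper (prefix w p) && upper (prefix w p.+1) \/
    up_tile (prefix w p) (nth 0 w p)%N \/ down_tile (prefix w p) (nth 0 w p)%N.
  move=> hp; have [h1 h2 h3] := word_at hw hp; rewrite h3.
  have [|n] := boolP (upper _ && _); first by left.
  by right; apply: left_tile => //; exact: av.
have noD p : (p < 4)%N -> upper (prefix w p) -> ~ down_tile (prefix w p) (nth 0 w p)%N.
  by move=> hp; have [h1 h2 h3] := word_at hw hp; apply: upper_not_down.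
have noU p : (p < 4)%N -> upper (prefix w p.+1) -> ~ up_tile (prefix w p) (nth 0 w p)%N.
  by move=> hp; have [h1 h2 h3] := word_at hw hp; rewrite h3; apply: upper_not_up.
have found p : (p < 3)%N -> up_tile (prefix w p) (nth 0 w p)%N ->
    down_tile (prefix w p.+1) (nth 0 w p.+1)%N -> exists p, [/\ (p < 3)%N, (nth 0 w p < nth 0 w p.+1)%N
    & realt (prefix w p, (nth 0 w p, nth 0 w p.+1)%N) \in T].
  move=> hp U D; have p4 : (p < 4)%N := lt34 hp.
  have [h1 h2 h3] := word_at hw p4; have [g1 _ _] := word_at hw (hp : p.+1 < 4)%N.
  by rewrite h3 in D; have [lt tT] := up_down_tile h1 g1 h2 U D; exists p.
have /allP/(_ w hw) /andP[_ /eqP hup] := check_movesP.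
rewrite (negbTE asc) in hup.
(* Once off the left boundary, the tiles turn up until one comes from below. *)
have climb p : (p < 3)%N -> ~~ upper (prefix w p.+1) -> up_tile (prefix w p) (nth 0 w p)%N ->
    (exists p, [/\ (p < 3)%N, (nth 0 w p < nth 0 w p.+1)%N
      & realt (prefix w p, (nth 0 w p, nth 0 w p.+1)%N) \in T]) \/
    up_tile (prefix w p.+1) (nth 0 w p.+1)%N.
  move=> hp nu U; case: (left p.+1 hp) => [/andP[u _]|[U'|D]]; first by rewrite u in nu.
    by right.
  by left; exact: found U D.
have start p : (p < 4)%N -> upper (prefix w p) -> ~~ upper (prefix w p.+1) ->
    up_tile (prefix w p) (nth 0 w p)%N.
  move=> hp u nu; case: (left p hp) => [/andP[_ u']|[//|D]]; first by rewrite u' in nu.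
  by case: (noD p hp u D).
have u0 : upper (prefix w 0) by rewrite /prefix take0.
have u4 : upper (prefix w 4).
  have : all (fun w => upper (prefix w 4)) words by vm_compute.
  by move/allP; apply.
have finish p : (p < 4)%N -> ~~ upper (prefix w p) -> up_tile (prefix w p) (nth 0 w p)%N ->
    (exists p, [/\ (p < 3)%N, (nth 0 w p < nth 0 w p.+1)%N
      & realt (prefix w p, (nth 0 w p, nth 0 w p.+1)%N) \in T]).
  elim: (3 - p)%N {-2}p (erefl (3 - p)%N) => [|n ih] p' hn hp' nu U.
    have e : p' = 3%N by lia.
    by rewrite e in U; case: (noU 3%N isT u4).
  have p3 : (p' < 3)%N by lia.
  have nu' : ~~ upper (prefix w p'.+1) by apply/negP => u'; exact: noU hp' u' U.
  case: (climb p' p3 nu' U) => // U'; apply: (ih p'.+1) => //; lia.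
have go p : (p < 3)%N -> upper (prefix w p) -> ~~ upper (prefix w p.+1) ->
    (exists p, [/\ (p < 3)%N, (nth 0 w p < nth 0 w p.+1)%N
      & realt (prefix w p, (nth 0 w p, nth 0 w p.+1)%N) \in T]).
  move=> hp u nu; have U := start p (lt34 hp) u nu.
  by case: (climb p hp nu U) => // U'; apply: (finish p.+1).
have [u1|n1] := boolP (upper (prefix w 1)); last exact: (go 0%N).
have [u2|n2] := boolP (upper (prefix w 2)); last exact: (go 1%N).
have [u3|n3] := boolP (upper (prefix w 3)); last exact: (go 2%N).
by move: hup; rewrite /= u0 u1 u2 u3 u4.
Qed.

Lemma swap_available w p : w \in words -> (p < 3)%N -> available_path w ->
  (nth 0 w p < nth 0 w p.+1)%N ->
  realt (prefix w p, (nth 0 w p, nth 0 w p.+1)%N) \in T -> available_path (swap w p).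
Proof.
move=> hw hp av lt hT' r hr.
have [a4 _ _] := word_at hw (lt34 hp).
have [b4 _ _] := word_at hw (hp : p.+1 < 4)%N.
have /allP/(_ w hw)/allP/(_ p) := check_swapP; rewrite mem_iota => /(_ hp)/allP/(_ r).
rewrite mem_iota => /(_ hr) /or3P[/andP[/eqP -> /eqP ->]|/andP[/eqP -> /eqP ->]|].
- exact: av.
- by right; eexists; first exact: hT'; left; rewrite /= inordK.
move=> /andP[/andP[/eqP -> /eqP ->] nh]; right; eexists; first exact: hT'.
by right; rewrite /= !inordK // pt_add.
Qed.

Lemma sweep_induction n w done : w \in words -> ascents w = n -> available_path w ->
  (forall c, c \in done -> realt c \in T) ->
  exists2 s, s \in sweeps n w done & forall c, c \in s -> realt c \in T.
Proof.
elim: n w done => [|n ih] w done hw asc av hd; first by exists done; rewrite ?inE.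
have [|p [hp lt hT']] := swept_tile hw av; first by rewrite asc.
have hm : (swap w p, (prefix w p, (nth 0 w p, nth 0 w p.+1)%N)) \in moves w.
  by apply/mapP; exists p => //; rewrite mem_filter lt mem_iota.
have /allP/(_ w hw) /andP[/allP/(_ _ hm) /andP[/= hw' /eqP asc'] _] := check_movesP.
have [|||s hs hsT] := ih (swap w p) ((prefix w p, (nth 0 w p, nth 0 w p.+1)%N) :: done) hw'.
- by move: asc'; rewrite asc => -[].
- exact: swap_available.
- by move=> c; rewrite inE => /orP[/eqP ->|/hd].
exists s => //=; apply/flattenP; eexists; last exact: hs.
by apply/mapP; eexists; first exact: hm.
Qed.

Theorem tiling_classification : exists2 k, (k < 8)%N & is_tiling k T.
Proof.
have av : available_path [:: 0; 1; 2; 3]%N.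
  by move=> [|[|[|[|//]]]] _; left.
(* The right boundary is swept to the left one in six moves. *)
have hw : [:: 0; 1; 2; 3]%N \in words by [].
have [//|s hs sT] := sweep_induction (n := 6) (done := [::]) hw erefl av.
have /allP/(_ s hs)/hasP[k] := check_sweepsP; rewrite mem_iota => hk /allP sub.
by exists k => //; apply: (is_tiling_of_sub) => // c /sub/sT.
Qed.
End Sweep.

Implicit Types (t : tile R) (T : {fset tile R}).
Variable K : fieldType.
Local Notation label := {vspace 'rV[K]_3}.

(** * Flips of labelled tilings *)
Definition coherent_cycle (f : code -> label) (Q : seq code) : Prop :=
  coherent_quad (f (nth empty_code Q 0)) (f (nth empty_code Q 1))
    (f (nth empty_code Q 2)) (f (nth empty_code Q 3)).

Lemma coherent_dihedral f a b c d Q : Q \in dihedral [:: a; b; c; d] ->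
  coherent_cycle f Q -> coherent_cycle f [:: a; b; c; d].
Proof.
have r := @coherent_quad_rot K; have v := @coherent_quad_rev K.
rewrite /dihedral !inE /coherent_cycle.
do 7?[case/orP]; move=> /eqP ->; rewrite /rot /=; eauto 7.
Qed.

Lemma coherent_dihedral_in f a b c d s : dihedral_in [:: a; b; c; d] s ->
  (forall Q, Q \in s -> coherent_cycle f Q) -> coherent_cycle f [:: a; b; c; d].
Proof. by move=> /hasP[Q /coherent_dihedral h hs] /(_ Q hs); exact: h. Qed.

Lemma ctile_pts k (S : code) i j : (k < 8)%N -> (S, (i, j)) \in ctiles k ->
  [/\ pt (add_dir S i) = pt S + dir i, pt (add_dir S j) = pt S + dir j
    & pt (add_dir (add_dir S i) j) = pt S + dir i + dir j].
Proof.
move=> hk h; have [/andP[ij j4] ni nj] := ctiles_valid hk h.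
have i4 := ltn_trans ij j4.
split; rewrite ?pt_add // has_add_dir //.
by rewrite negb_or nj /= gtn_eqF.
Qed.

Lemma coherent_realt k f ct : (k < 8)%N -> ct \in ctiles k ->
  coherent_tile q f (realt ct) <-> coherent_cycle (fun c => f (pt c)) (cycle4 ct).
Proof.
case: ct => S [i j] hk h; have [e1 e2 e3] := ctile_pts hk h.
have [/andP[ij j4] _ _] := ctiles_valid hk h; have i4 := ltn_trans ij j4.
by rewrite /coherent_cycle /= e1 e2 e3 /coherent_tile /= !side_dir !inordK.
Qed.

Lemma ctile_vertices k ct c : (k < 8)%N -> ct \in ctiles k -> c \in cycle4 ct -> c \in vertices k.
Proof.
move=> hk h hc; have /allP/(_ k) := check_verticesP; rewrite mem_iota => /(_ hk).
by case/andP=> /allP/(_ _ h)/allP/(_ _ hc).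
Qed.

Lemma tile_verticesE k ct : (k < 8)%N -> ct \in ctiles k ->
  tile_vertices q (realt ct) = map pt (cycle4 ct).
Proof.
case: ct => S [i j] hk h; have [e1 e2 e3] := ctile_pts hk h.
have [/andP[ij j4] _ _] := ctiles_valid hk h; have i4 := ltn_trans ij j4.
by rewrite /tile_vertices /= e1 e2 e3 !side_dir !inordK.
Qed.

Lemma tiling_vertexE k T y : (k < 8)%N -> is_tiling k T ->
  tiling_vertex q T y <-> exists2 c, c \in vertices k & y = pt c.
Proof.
move=> hk hT; split.
  move=> [t /hT[ct hct ->]]; rewrite (tile_verticesE hk hct) => /mapP[c hc ->].
  by exists c => //; exact: ctile_vertices hct hc.
move=> [c hc ->]; have /allP/(_ k) := check_verticesP; rewrite mem_iota => /(_ hk).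
case/andP=> _ /allP/(_ _ hc)/hasP[ct hct hcc].
exists (realt ct); first by apply/hT; exists ct.
by rewrite (tile_verticesE hk hct); apply: map_f.
Qed.

Lemma realt_inj k ct ct' : (k < 8)%N -> ct \in ctiles k -> ct' \in ctiles k ->
  realt ct = realt ct' -> ct = ct'.
Proof.
case: ct ct' => S [i j] [S' [i' j']] hk h h'.
have [/andP[ij j4] _ _] := ctiles_valid hk h; have i4 := ltn_trans ij j4.
have [/andP[ij' j4'] _ _] := ctiles_valid hk h'; have i4' := ltn_trans ij' j4'.
case=> /(pt_inj hk) e /(congr1 val) /= + /(congr1 val) /=.
rewrite !inordK // => -> ->; rewrite e //.
  by apply: ctile_vertices hk h _; rewrite inE eqxx.
by apply: ctile_vertices hk h' _; rewrite inE eqxx.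
Qed.

Lemma tiling_tile k T x (i j : 'I_4) : (k < 8)%N -> is_tiling k T -> (x, (i, j)) \in T ->
  exists2 S, x = pt S & (S, (i : nat, j : nat)) \in ctiles k.
Proof.
move=> hk hT /hT[[S [a b]] h [-> -> ->]].
have [/andP[ab b4] _ _] := ctiles_valid hk h; have a4 := ltn_trans ab b4.
by exists S => //; rewrite !inordK.
Qed.

Lemma tiling_ext k T T' : is_tiling k T -> is_tiling k T' -> T = T'.
Proof. by move=> h h'; apply/fsetP => t; apply/idP/idP => [/h/h'|/h'/h]. Qed.

Definition realizes (X : {fset tile R}) (cs : seq ctile) : Prop :=
  forall t, t \in X <-> exists2 ct, ct \in cs & t = realt ct.

Lemma tile_code (i j : 'I_4) (S : code) : realt (S, (i : nat, j : nat)) = (pt S, (i, j)).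
Proof. by rewrite /realt /= !inord_val. Qed.

Lemma mem_fset3 (A : choiceType) (a b c x : A) :
  (x \in [fset a; b; c]%fset) = [|| x == a, x == b | x == c].
Proof. by rewrite !inE orbA. Qed.

Lemma realizes3 t1 t2 t3 ct1 ct2 ct3 : t1 = realt ct1 -> t2 = realt ct2 -> t3 = realt ct3 ->
  realizes [fset t1; t2; t3]%fset [:: ct1; ct2; ct3].
Proof.
move=> -> -> -> t; rewrite mem_fset3; split.
  by case/or3P=> /eqP ->; [exists ct1|exists ct2|exists ct3]; rewrite // !inE eqxx ?orbT.
by move=> [ct]; rewrite !inE => /or3P[] /eqP -> ->; rewrite eqxx ?orbT.
Qed.

(** The corners of the tiles of the hexagon are vertices of the tiling, hence equal as
    subsets as soon as they are equal as points. *)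
Lemma flip_neighbour k T old c new c' : (k < 8)%N -> is_tiling k T ->
  hexagon_flip q old c new c' -> (old `<=` T)%fset ->
  exists oldc newc cc cc' e, [/\ flips_to k oldc newc cc cc' e,
    realizes old oldc, realizes new newc, c = pt cc & c' = pt cc'].
Proof.
move=> hk hT [x [i [j [l [ij jl h]]]]] /fsubsetP sub.
have l4 := ltn_ord l; have j4 := ltn_ord j; have i4 := ltn_ord i.
have tr : (i : nat, j : nat, l : nat) \in triples.
  move: ij jl l4 {h sub j4 i4}; move: (nat_of_ord i) (nat_of_ord j) (nat_of_ord l) => a b d.
  by move=> + + d4; case: d d4 => [|[|[|[|//]]]] _; case: b => [|[|[|//]]]; case: a => [|[|//]].
have tile3 t : t \in old -> t \in T by apply: sub.
have inj S S' : S \in vertices k -> S' \in vertices k -> pt S = pt S' -> S = S'.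
  exact: pt_inj.
have vx ct d : ct \in ctiles k -> d \in cycle4 ct -> d \in vertices k.
  exact: ctile_vertices.
case: h => -[oldE cE newE c'E].
- have [S xS h1] : exists2 S, x = pt S & (S, (i : nat, j : nat)) \in ctiles k.
    by apply: tiling_tile hk hT _; apply: tile3; rewrite oldE mem_fset3 eqxx.
  have [S2 xS2 h2] : exists2 S, x = pt S & (S, (j : nat, l : nat)) \in ctiles k.
    by apply: tiling_tile hk hT _; apply: tile3; rewrite oldE mem_fset3 eqxx ?orbT.
  have [S3 xS3 h3] : exists2 S, x + side q j = pt S & (S, (i : nat, l : nat)) \in ctiles k.
    by apply: tiling_tile hk hT _; apply: tile3; rewrite oldE mem_fset3 eqxx ?orbT.
  have [_ pj _] := ctile_pts hk h1.
  have e2 : S2 = S.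
    apply: inj; rewrite -?xS ?xS2 //; [apply: vx h2 _|apply: vx h1 _]; by rewrite !inE eqxx.
  subst S2; have [_ pl _] := ctile_pts hk h2.
  have e3 : S3 = add_dir S j.
    apply: inj; first by apply: vx h3 _; rewrite !inE eqxx.
      by apply: vx h1 _; rewrite !inE eqxx ?orbT.
    by rewrite -xS3 xS side_dir pj.
  subst S3; have [pi _ pil] := ctile_pts hk h1.
  have [/andP[_ _] ni nj] := ctiles_valid hk h1; have [_ _ nl] := ctiles_valid hk h2.
  have all1 : all (mem (ctiles k)) (half1 S i j l) by rewrite /= h1 h2 h3.
  have [e hfl] := half1_flips hk tr all1 (code_mem S).
  exists (half1 S i j l), (half2 S i j l), (add_dir S j), (add_dir (add_dir S i) l), e; split=> //.
  + rewrite oldE /hexagon_tiling1; apply: realizes3; rewrite tile_code ?xS //.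
    by rewrite side_dir pj.
  + rewrite newE /hexagon_tiling2; apply: realizes3; rewrite tile_code ?xS //.
      by rewrite side_dir pi.
    by rewrite side_dir pl.
  + by rewrite cE /hexagon_center1 xS side_dir pj.
  rewrite c'E /hexagon_center2 xS !side_dir -pi (pt_add l4) //.
  by rewrite has_add_dir // negb_or nl /= gtn_eqF // (ltn_trans ij jl).
have [S xS h1] : exists2 S, x = pt S & (S, (i : nat, l : nat)) \in ctiles k.
  by apply: tiling_tile hk hT _; apply: tile3; rewrite oldE mem_fset3 eqxx.
have [S2 xS2 h2] : exists2 S, x + side q i = pt S & (S, (j : nat, l : nat)) \in ctiles k.
  by apply: tiling_tile hk hT _; apply: tile3; rewrite oldE mem_fset3 eqxx ?orbT.
have [S3 xS3 h3] : exists2 S, x + side q l = pt S & (S, (i : nat, j : nat)) \in ctiles k.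
  by apply: tiling_tile hk hT _; apply: tile3; rewrite oldE mem_fset3 eqxx ?orbT.
have [pi pl pil] := ctile_pts hk h1.
have e2 : S2 = add_dir S i.
  apply: inj; first by apply: vx h2 _; rewrite !inE eqxx.
    by apply: vx h1 _; rewrite !inE eqxx ?orbT.
  by rewrite -xS2 xS side_dir pi.
have e3 : S3 = add_dir S l.
  apply: inj; first by apply: vx h3 _; rewrite !inE eqxx.
    by apply: vx h1 _; rewrite !inE eqxx ?orbT.
  by rewrite -xS3 xS side_dir pl.
subst S2 S3.
have [_ ni nl] := ctiles_valid hk h1; have [_ nj _] := ctiles_valid hk h2.
have pj : pt (add_dir S j) = pt S + dir j.
  by apply: pt_add => //; move: nj; rewrite has_add_dir // negb_or => /andP[].
have all2 : all (mem (ctiles k)) (half2 S i j l) by rewrite /= h1 h2 h3.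
have [e hfl] := half2_flips hk tr all2 (code_mem S).
exists (half2 S i j l), (half1 S i j l), (add_dir (add_dir S i) l), (add_dir S j), e; split=> //.
- rewrite oldE /hexagon_tiling2; apply: realizes3; rewrite tile_code ?xS //.
    by rewrite side_dir pi.
  by rewrite side_dir pl.
- rewrite newE /hexagon_tiling1; apply: realizes3; rewrite tile_code ?xS //.
  by rewrite side_dir pj.
- by rewrite cE /hexagon_center2 xS !side_dir -pil.
by rewrite c'E /hexagon_center1 xS side_dir pj.
Qed.

(** What a uniquely determined flip says of the labels, with vertices as subsets. *)
Definition flip_labels e k (f f' : code -> label) : Prop :=
  [/\ forall d, d \in vertices k -> d != inner (idx e k 0) -> f' d = f d,
      forall ct, ct \in fresh_tiles k (turn e k) -> coherent_cycle f' (cycle4 ct)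
    & forall L, (forall ct, ct \in fresh_tiles k (turn e k) ->
        coherent_cycle (fun d => if d == inner (idx e k 3) then L else f' d) (cycle4 ct)) ->
      L = f' (inner (idx e k 3))].

Lemma flip_codes k T lam T' lam' : (k < 8)%N -> is_tiling k T ->
  unique_desargues_flip (K := K) q T lam T' lam' ->
  exists e, is_tiling (turn e k) T' /\
    flip_labels e k (fun c => lam (pt c)) (fun c => lam' (pt c)).
Proof.
move=> hk hT [old [c [new [c' [[hfl sub] T'E hkeep hcoh huniq]]]]].
have [oldc [newc [cc [cc' [e [hf ro rn ccE cc'E]]]]]] := flip_neighbour hk hT hfl sub.
case/and5P: hf => /eqP c1 /eqP c2 /perm_mem hct /perm_mem hnew /allP holdc.
have [turn8 inv0] : (turn e k < 8)%N /\ inner (idx e k 0) \in vertices k.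
  have he : e \in bools by case: (e).
  have /allP/(_ e he)/allP/(_ k) := check_turnP.
  by rewrite mem_iota => /(_ hk)/and5P[_ h1 _ /allP/(_ 0%N isT) h2 _].
have hT' : is_tiling (turn e k) T'.
  move=> t; rewrite T'E !inE; split.
    case/orP=> [/andP[nold /hT[ct hct' tE]]|/rn[ct h ->]].
      exists ct => //; rewrite hct mem_cat mem_filter hct' andbT; apply/orP; left.
      by apply: contra nold => h; apply/ro; exists ct.
    by exists ct => //; rewrite hct mem_cat h orbT.
  move=> [ct]; rewrite hct mem_cat mem_filter => /orP[/andP[nold h]|h] ->; last first.
    by apply/orP; right; apply/rn; exists ct.
  apply/orP; left; apply/andP; split; last by apply/hT; exists ct.
  apply: contra nold => /ro[ct' h' /(realt_inj hk h)]; move=> -> //.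
  exact: holdc.
exists e; split=> //; rewrite /flip_labels -c2; split.
- move=> d hd nd; apply: hkeep; first by apply/(tiling_vertexE _ hk hT); exists d.
  by rewrite ccE; apply: contra_neq nd => /(pt_inj hk hd); rewrite c1; apply.
- move=> ct hct'; have ct1 : ct \in ctiles (turn e k).
    by move: hct'; rewrite mem_filter => /andP[].
  by apply/(coherent_realt _ turn8 ct1)/hcoh/rn; exists ct; rewrite // -hnew.
move=> L hL; rewrite -cc'E; apply: huniq => t /rn[ct h ->].
have hfr : ct \in fresh_tiles k (turn e k) by rewrite hnew.
have ct1 : ct \in ctiles (turn e k) by move: hfr; rewrite mem_filter => /andP[].
apply/(coherent_realt _ turn8 ct1); have := hL ct hfr.
have c'v : cc' \in vertices (turn e k).
  have he : e \in bools by case: (e).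
  have /allP/(_ e he)/allP/(_ k) := check_turnP; rewrite c2.
  by rewrite mem_iota => /(_ hk)/and5P[_ _ -> _ _].
have same d : d \in cycle4 ct -> (if pt d == c' then L else lam' (pt d)) =
    (if d == cc' then L else lam' (pt d)).
  move=> hd; rewrite cc'E; have dv := ctile_vertices turn8 ct1 hd.
  have [->|n] := eqVneq d cc'; first by rewrite eqxx.
  by rewrite ifN //; apply: contra_neq n => /(pt_inj turn8 dv); apply.
by rewrite /coherent_cycle !same //; case: (ct) => ? [? ?]; rewrite !inE eqxx ?orbT.
Qed.
End Geometry.

(** * Going once around *)
Lemma idx_turn e k m : idx e (turn e k) m = idx e k m.+1.
Proof.
rewrite /idx /turn; case: e; first by rewrite modnDml addSnnS.
by rewrite -!addnA modnDml; congr (_ %% 8)%N; lia.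
Qed.

Lemma idx_iter e k n m : idx e (iter n (turn e) k) m = idx e k (n + m).
Proof. by elim: n m => // n ih m; rewrite iterS idx_turn ih addSnnS. Qed.

Lemma idx_periodic e k m : idx e k (m + 8) = idx e k m.
Proof.
rewrite /idx; case: e; first by rewrite addnA modnDr.
by rewrite mulnDr addnA addnC modnMDl.
Qed.

Lemma outer_mod r : outer r \in map outer (iota 0 8).
Proof.
have -> : outer r = outer (r %% 8) by rewrite /outer modn_mod.
by apply: map_f; rewrite mem_iota ltn_mod.
Qed.

Lemma outer_vertex k r : outer r \in vertices k.
Proof. by rewrite mem_cat outer_mod. Qed.

Lemma turn_facts e k : (k < 8)%N ->
  [/\ turn (~~ e) (turn e k) = k, (turn e k < 8)%N,
      forall m, (m < 3)%N -> inner (idx e k m) \in vertices k,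
      forall m m', (m < 4)%N -> (m' < 4)%N -> m != m' -> inner (idx e k m) != inner (idx e k m')
    & forall c, c \in vertices k -> (exists r, c = outer r) \/
         exists2 m, (m < 3)%N & c = inner (idx e k m)].
Proof.
move=> hk; have he : e \in bools by case: e.
have /allP/(_ e he)/allP/(_ k) := check_turnP.
rewrite mem_iota => /(_ hk)/and5P[/eqP h1 h2 _ /allP h3 /and3P[h4 _ /allP h6]]; split=> //.
- by move=> m hm; apply: h3; rewrite mem_iota.
- move=> m m' hm hm' ne; apply: contra ne => e'.
  have := nth_uniq empty_code (i := m) (j := m') _ _ h4.
  rewrite size_map size_iota !(nth_map 0%N) ?size_iota // !nth_iota // (eqP e') eqxx.
  by move=> <-.
move=> c /h6 /orP[/mapP[r _ ->]|/mapP[m]]; first by left; exists r.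
by rewrite mem_iota => hm ->; right; exists m.
Qed.

Lemma outer_inner r s : outer r != inner s.
Proof.
have /allP/(_ true isT)/allP/(_ 0%N isT)/and5P[_ _ _ _ /and3P[_ /hasPn h _]] := check_turnP.
have := h (s %% 8)%N; rewrite mem_iota ltn_mod => /(_ isT).
have -> : inner (s %% 8) = inner s by rewrite /inner modn_mod.
by apply: contra => /eqP <-; exact: outer_mod.
Qed.

Section RoundTrip.
Variable K : fieldType.
Local Notation label := {vspace 'rV[K]_3}.
Variables (e : bool) (k : nat) (f : nat -> code -> label).
Hypothesis hk : (k < 8)%N.
Local Notation kn n := (iter n (turn e) k).
Hypothesis hstart : forall ct, ct \in ctiles k -> coherent_cycle (f 0) (cycle4 ct).
Hypothesis hflip : forall n, (n < 8)%N -> flip_labels e (kn n) (f n) (f n.+1).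

Lemma kn_lt n : (kn n < 8)%N.
Proof. by elim: n => //= n ih; have [] := turn_facts e ih. Qed.

Lemma outer_label n r : (n <= 8)%N -> f n (outer r) = f 0 (outer r).
Proof.
elim: n => // n ih hn; have [hkeep _ _] := hflip hn.
by rewrite hkeep ?ih ?outer_vertex ?outer_inner // ltnW.
Qed.

(** The vertex number m is created by the flip number m - 3, which yields the
    labelling number m - 2; for the three initial vertices the difference is 0. *)
Definition inner_label m : label := f (m - 2) (inner (idx e k m)).
Definition outer_label_at m : label := f 0 (outer (idx e k m)).

Lemma inner_labelE n m : (n <= 8)%N -> (n <= m <= n + 2)%N ->
  f n (inner (idx e k m)) = inner_label m.
Proof.
elim: n m => [|n ih] m hn /andP[nm mn].
  by rewrite /inner_label (_ : m - 2 = 0)%N //; lia.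
have [->|ne] := eqVneq m (n + 3)%N.
  by rewrite /inner_label (_ : n + 3 - 2 = n.+1)%N //; lia.
have [hkeep _ _] := hflip hn; have [_ _ h3 h4 _] := turn_facts e (kn_lt n).
have e1 : idx e k m = idx e (kn n) (m - n) by rewrite idx_iter; congr idx; lia.
rewrite hkeep; first by apply: ih; lia.
  by rewrite e1; apply: h3; lia.
by rewrite e1; apply: h4; lia.
Qed.

Lemma start_cycle a b c d : dihedral_in [:: a; b; c; d] (map cycle4 (ctiles k)) ->
  coherent_cycle (f 0) [:: a; b; c; d].
Proof. by move/coherent_dihedral_in; apply=> Q /mapP[ct /hstart h ->]. Qed.

Lemma start_quads Q : Q \in [:: quadG e k 0; quadG e k 1; quadG e k 2;
   quadH e k 0; quadH e k 1; quadJ e k 0] -> coherent_cycle (f 0) Q.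
Proof.
move=> hQ; have he : e \in bools by case: (e).
have /allP/(_ e he)/allP/(_ k) := check_startP; rewrite mem_iota => /(_ hk)/allP/(_ Q hQ).
have [a [b [c [d ->]]]] : exists a b c d, Q = [:: a; b; c; d].
  by move: hQ; rewrite !inE => /or4P[||| /or3P[]] /eqP ->; do 4!eexists.
exact: start_cycle.
Qed.

Lemma fresh_facts n : let new := map cycle4 (fresh_tiles (kn n) (turn e (kn n))) in
  let quads := [:: quadG e (kn n) 3; quadH e (kn n) 2; quadJ e (kn n) 1] in
  (forall Q, Q \in quads -> dihedral_in Q new) /\ (forall Q, Q \in new -> dihedral_in Q quads).
Proof.
move=> new quads; have he : e \in bools by case: (e).
have /allP/(_ e he)/allP/(_ (kn n)) := check_freshP; rewrite mem_iota => /(_ (kn_lt n)).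
by case/andP=> /allP h1 /allP h2.
Qed.

Lemma fresh_quads n Q : (n < 8)%N ->
  Q \in [:: quadG e (kn n) 3; quadH e (kn n) 2; quadJ e (kn n) 1] ->
  coherent_cycle (f n.+1) Q.
Proof.
move=> hn hQ; have [h1 _] := fresh_facts n; have {}h1 := h1 Q hQ.
have [_ hc _] := hflip hn.
have [a [b [c [d QE]]]] : exists a b c d, Q = [:: a; b; c; d].
  by move: hQ; rewrite !inE => /or3P[] /eqP ->; do 4!eexists.
rewrite QE in h1 *; apply: (coherent_dihedral_in h1) => Q' /mapP[ct hct ->].
exact: hc.
Qed.

Let outerE n r : (n <= 8)%N -> f n (outer (idx e k r)) = outer_label_at r.
Proof. by move=> hn; rewrite outer_label. Qed.

(** The quadrilaterals of the first tiling and the new ones of each flip are those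
    that [label_octagon_closes] asks for. *)
Lemma round_trip d : d \in vertices k -> f 8 d = f 0 d.
Proof.
have hB m : outer_label_at (m + 8) = outer_label_at m by rewrite /outer_label_at idx_periodic.
have hG m : (m <= 10)%N -> coherent_quad (inner_label m) (outer_label_at (m + 3))
    (outer_label_at m) (outer_label_at (m + 5)).
  have [m3 _|m3 m10] := ltnP m 3.
    have := @start_quads (quadG e k m); rewrite /coherent_cycle /=.
    rewrite (inner_labelE (n := 0)) //.
    by apply; case: m m3 => [|[|[|//]]] _; rewrite !inE eqxx ?orbT.
  have [n mE] : exists n, m = (n + 3)%N by exists (m - 3)%N; lia.
  have hn : (n < 8)%N by lia.
  have := @fresh_quads n (quadG e (kn n) 3) hn (mem_head _ _).
  rewrite /coherent_cycle /= !idx_iter !outerE // -mE.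
  rewrite inner_labelE ?(addnA n 3 3) ?(addnA n 3 5) -?mE //; lia.
have hH m : (m <= 9)%N -> coherent_quad (inner_label m) (inner_label m.+1)
    (outer_label_at (m + 6)) (outer_label_at (m + 3)).
  have [m2 _|m2 m9] := ltnP m 2.
    have := @start_quads (quadH e k m); rewrite /coherent_cycle /=.
    rewrite !(inner_labelE (n := 0)) //; [|lia..].
    by apply; case: m m2 => [|[|//]] _; rewrite !inE eqxx ?orbT.
  have [n mE] : exists n, m = (n + 2)%N by exists (m - 2)%N; lia.
  have hn : (n < 8)%N by lia.
  have := @fresh_quads n (quadH e (kn n) 2) hn; rewrite !inE eqxx orbT => /(_ isT).
  rewrite /coherent_cycle /= !idx_iter !outerE //.
  rewrite !inner_labelE //; try lia.
  by rewrite mE -addnS -!addnA.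
have hJ m : (m <= 8)%N -> coherent_quad (inner_label m) (inner_label m.+1)
    (inner_label m.+2) (outer_label_at (m + 5)).
  have [m1 _|m1 m8] := ltnP m 1.
    have := @start_quads (quadJ e k m); rewrite /coherent_cycle /=.
    rewrite !(inner_labelE (n := 0)) //; [|lia..].
    by apply; case: m m1 => [|//] _; rewrite !inE eqxx ?orbT.
  have [n mE] : exists n, m = n.+1 by exists (m - 1)%N; lia.
  have hn : (n < 8)%N by lia.
  have := @fresh_quads n (quadJ e (kn n) 1) hn; rewrite !inE eqxx !orbT => /(_ isT).
  rewrite /coherent_cycle /= !idx_iter !outerE //.
  rewrite !inner_labelE //; try lia.
  by rewrite mE (addSnnS n) addn1 addn2 addn3.
have hU m L : (m < 8)%N ->
    coherent_quad L (outer_label_at (m + 6)) (outer_label_at (m + 3)) (outer_label_at (m + 8)) ->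
    coherent_quad (inner_label m.+2) L (outer_label_at (m + 8)) (outer_label_at (m + 5)) ->
    coherent_quad (inner_label m.+1) (inner_label m.+2) L (outer_label_at (m + 6)) ->
    L = inner_label m.+3.
  move=> hm q1 q2 q3; have [_ _ uniq] := hflip hm.
  have [_ fr] := fresh_facts m; have [_ _ _ ne _] := turn_facts e (kn_lt m).
  have -> : inner_label m.+3 = f m.+1 (inner (idx e (kn m) 3)).
    by rewrite idx_iter inner_labelE ?addn3 //; lia.
  apply: uniq => ct hct.
  have {}fr := fr (cycle4 ct) (map_f _ hct).
  case: ct hct fr => S [i j] hct fr; apply: (coherent_dihedral_in fr).
  set g := fun d => _.
  have gi r : (r < 3)%N -> g (inner (idx e (kn m) r)) = f m.+1 (inner (idx e (kn m) r)).
    by move=> hr; rewrite /g ifN // ne //; lia.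
  have go r : g (outer r) = f m.+1 (outer r) by rewrite /g ifN // outer_inner.
  have g3 : g (inner (idx e (kn m) 3)) = L by rewrite /g eqxx.
  move=> Q; rewrite !inE => /or3P[] /eqP ->; rewrite /coherent_cycle /= ?g3 !go ?gi // !idx_iter !outerE //.
  - by rewrite inner_labelE ?addn2 //; lia.
  - by rewrite !inner_labelE ?addn2 ?addn1 //; lia.
have [e8 e9 e10] := label_octagon_closes hB hG hH hJ hU.
have back m : (m < 3)%N -> inner_label (m + 8) = inner_label m.
  by case: m => [|[|[|//]]].
have [_ _ _ _ split] := turn_facts e hk.
move=> /split [[r ->]|[m hm ->]]; first by rewrite outer_label.
rewrite -{1}(idx_periodic e k m).
have h0 : f 0 (inner (idx e k m)) = inner_label m by apply: inner_labelE => //; lia.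
have h8 : f 8 (inner (idx e k (m + 8))) = inner_label (m + 8) by apply: inner_labelE => //; lia.
by rewrite h0 h8 back.
Qed.
End RoundTrip.

Theorem theorem9p13 (R : realType) (K : fieldType)
    (hK : K = R :> fieldType \/ K = R[i] :> fieldType)
    (q : 'Z_8 -> 'rV[R]_2) (hq : cs_convex_octagon q)
    (T : nat -> {fset tile R}) (lam : nat -> 'rV[R]_2 -> {vspace 'rV[K]_3})
    (hT0 : zonotopal_tiling q (T 0%N))
    (hlam0 : coherent_labeling q (T 0%N) (lam 0%N))
    (hflip : forall n : nat, (n < 8)%N ->
       unique_desargues_flip q (T n) (lam n) (T n.+1) (lam n.+1))
    (hdistinct : forall m n : nat, (m < 8)%N -> (n < 8)%N -> T m = T n -> m = n)
    (hclosed : T 8%N = T 0%N) :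
  forall y : 'rV[R]_2, tiling_vertex q (T 0%N) y -> lam 8%N y = lam 0%N y.
Proof.
have [k hk tk] := tiling_classification hq hT0.
pose f n (c : code) := lam n (pt q c).
have [e [t1 f1]] := flip_codes hq hk tk (hflip 0%N isT).
have lt8 n : (iter n (turn e) k < 8)%N by elim: n => //= n ih; have [] := turn_facts e ih.
have all n : (n < 8)%N -> [/\ is_tiling q (iter n (turn e) k) (T n),
    is_tiling q (iter n.+1 (turn e) k) (T n.+1) & flip_labels e (iter n (turn e) k) (f n) (f n.+1)].
  elim: n => [_|n ih hn]; first by split.
  have [h0 h1 _] := ih (ltnW hn).
  have [e' [h2 h3]] := flip_codes hq (lt8 n.+1) h1 (hflip n.+1 hn).
  have [e'E|ne] := eqVneq e' e; first by rewrite e'E in h2 h3; split.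
  (* Turning back would repeat the tiling of two flips ago. *)
  have e'E : e' = ~~ e by move: ne; case: (e'); case: (e).
  have [back _ _ _ _] := turn_facts e (lt8 n).
  rewrite e'E iterS back in h2; have TT := tiling_ext h2 h0.
  have [n2|n2] := ltnP n.+2 8; first by have := hdistinct _ _ n2 (ltnW (ltnW n2)) TT; lia.
  have nE : n = 6%N by lia.
  by move: TT; rewrite nE hclosed => /(hdistinct 0%N 6%N isT isT).
move=> y /(tiling_vertexE _ hk tk)[d hd ->].
apply: (@round_trip K e k f hk _ _ d hd) => [ct hct|n hn]; last by have [] := all n hn.
have [_ hc] := hlam0; apply/(coherent_realt _ _ hk hct)/hc.
by apply/tk; exists ct.
Qed.
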